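(* For each $\varepsilon>0$, the set $\mathrm{graph}(c+v^\varepsilon_x)$ is backward invariant under the discount Hamiltonian flow: $\phi^s_{H,c,\varepsilon}(\mathrm{graph}(c+v^\varepsilon_x))\subset\mathrm{graph}(c+v^\varepsilon_x)$ for all $s\le 0$.
   Context: $H:\mathbb{T}^n\times\mathbb{R}^n\to\mathbb{R}$ is $C^2$, $H_{pp}$ is positive definite, $H(x,p)/|p|\to+\infty$ as $|p|\to\infty$ uniformly in $x$. $c\in\mathbb{R}^n$ is fixed and $h(c)$ is the unique constant for which $H(x,c+v_x)=h(c)$ has a viscosity solution on $\mathbb{T}^n$. For $\varepsilon>0$, $v^\varepsilon$ is the unique viscosity solution of $\varepsilon v^\varepsilon+H(x,c+v^\varepsilon_x)=h(c)$ on $\mathbb{T}^n$ (Lipschitz). $\mathrm{graph}(c+v^\varepsilon_x):=\{(x,c+v^\varepsilon_x(x)):x\in\mathbb{T}^n,\ v^\varepsilon\text{ differentiable at }x\}$. $\phi^s_{H,c,\varepsilon}$ is the flow on $\mathbb{T}^n\times\mathbb{R}^n$ of $x'=H_p(x,p)$, $p'=-H_x(x,p)+\varepsilon c-\varepsilon p$. *)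

(* Defs.v *)
(* Points of T^n are represented by their lifts in
   R^n = 'rV[R]_n; functions on T^n are Z^n-periodic functions on R^n. *)
From HB Require Import structures.
From mathcomp Require Import all_boot all_order all_algebra.
From mathcomp Require Import all_classical all_reals all_analysis.
Set Implicit Arguments. Unset Strict Implicit. Unset Printing Implicit Defensive.
Import Order.TTheory GRing.Theory Num.Theory.
Import numFieldNormedType.Exports.
Local Open Scope classical_set_scope.
Local Open Scope ring_scope.

Section Defs.
Context {R : realType} {n : nat}.
Notation vec := 'rV[R]_n.

Definition evec (i : 'I_n) : vec := delta_mx 0 i.

Definition intvec (k : vec) : Prop := exists z : 'I_n -> int, k = \row_i (z i)%:~R.

Definition periodic (u : vec -> R) : Prop :=
  forall x k, intvec k -> u (x + k) = u x.

Definition periodicH (H : vec -> vec -> R) : Prop :=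
  forall x p k, intvec k -> H (x + k) p = H x p.

Definition grad (u : vec -> R) (x : vec) : vec := \row_i derive u x (evec i).

Definition C1fun (u : vec -> R) : Prop :=
  (forall x, differentiable u x) /\ continuous (grad u).

Definition pder (F : vec -> vec -> R) (a b : vec) (x p : vec) : R :=
  derive1 (fun t : R => F (x + t *: a) (p + t *: b)) 0.
Definition pder_ex (F : vec -> vec -> R) (a b : vec) (x p : vec) : Prop :=
  derivable (fun t : R => F (x + t *: a) (p + t *: b)) 0 1.

Definition cdir (b : bool) (i : 'I_n) : vec * vec :=
  if b then (evec i, 0) else (0, evec i).

Definition C1_2 (F : vec -> vec -> R) : Prop :=
  forall b i, (forall x p, pder_ex F (cdir b i).1 (cdir b i).2 x p) /\
    continuous (fun z : vec * vec => pder F (cdir b i).1 (cdir b i).2 z.1 z.2).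

Definition C2_2 (F : vec -> vec -> R) : Prop :=
  C1_2 F /\ forall b i, C1_2 (pder F (cdir b i).1 (cdir b i).2).

Definition Hx (H : vec -> vec -> R) (x p : vec) : vec :=
  \row_i pder H (evec i) 0 x p.
Definition Hp (H : vec -> vec -> R) (x p : vec) : vec :=
  \row_i pder H 0 (evec i) x p.

Definition Hpp (H : vec -> vec -> R) (x p : vec) : 'M[R]_n :=
  \matrix_(i, j) pder (pder H 0 (evec j)) 0 (evec i) x p.

Definition Hpp_posdef (H : vec -> vec -> R) : Prop :=
  forall x p (xi : vec), xi != 0 -> 0 < (xi *m Hpp H x p *m xi^T) 0 0.

Definition superlinear (H : vec -> vec -> R) : Prop :=
  forall M : R, exists K : R, forall x p, K < `|p| -> M <= H x p / `|p|.

Definition visc_sub (G : vec -> R -> vec -> R) (u : vec -> R) : Prop :=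
  forall (phi : vec -> R) (x0 : vec), C1fun phi ->
    (\forall y \near x0, u y - phi y <= u x0 - phi x0) ->
    G x0 (u x0) (grad phi x0) <= 0.
Definition visc_super (G : vec -> R -> vec -> R) (u : vec -> R) : Prop :=
  forall (phi : vec -> R) (x0 : vec), C1fun phi ->
    (\forall y \near x0, u x0 - phi x0 <= u y - phi y) ->
    0 <= G x0 (u x0) (grad phi x0).
Definition visc_sol (G : vec -> R -> vec -> R) (u : vec -> R) : Prop :=
  continuous u /\ visc_sub G u /\ visc_super G u.

Definition visc_sol_torus (G : vec -> R -> vec -> R) (u : vec -> R) : Prop :=
  periodic u /\ visc_sol G u.

Definition crit_eq (H : vec -> vec -> R) (c : vec) (h : R) : vec -> R -> vec -> R :=
  fun x _ q => H x (c + q) - h.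

Definition disc_eq (H : vec -> vec -> R) (c : vec) (h eps : R) : vec -> R -> vec -> R :=
  fun x r q => eps * r + H x (c + q) - h.

Definition graph_c (c : vec) (v : vec -> R) : set (vec * vec) :=
  [set z | exists x, differentiable v x /\ z = (x, c + grad v x)].

Definition disc_flow_at (H : vec -> vec -> R) (c : vec) (eps : R)
    (X P : R -> vec) (t : R) : Prop :=
  is_derive t 1 X (Hp H (X t) (P t)) /\
  is_derive t 1 P (- Hx H (X t) (P t) + eps *: c - eps *: P t).

End Defs.

(* Main.v *)
(* Put F(x,q) = H(x,c+q) - h, so that v solves eps v + F(x,Dv) = 0 and q = p - c
   satisfies q' = -F_x - eps q.  Along a characteristic (X,Q), the function
   a = -F(X,Q)/eps satisfies a' + eps a = Q.F_p - F; the characteristic is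
   calibrated when v(X) = a.

   Two barriers replace the calculus of variations, and every test function is
   quadratic.  Since F is uniformly convex in q on bounded sets, the function
   a + b + Q.(y-X) + K|y-X-xi|^2 is, for K large, a time-dependent
   supersolution for every displacement xi(s), provided that b' + eps b
   dominates a multiple of |xi|^2 + |xi'|^2; comparing v with it controls
   v(X+xi) - Q.xi - a.  Conversely a - (K+1+A(s-tau))|y-X|^2 + Q.(y-X) is a
   subsolution on a short interval before tau.  At a point where a paraboloid
   touches v from below with some room, the two comparisons trap the minimum of
   v minus the second barrier on the characteristic, which is therefore
   calibrated for a short time; a calibrated piece produces a new lower
   paraboloid with a constant that depends only on its length, so this
   propagates to all negative times.  If v is merely differentiable at x, then
   (x,Dv(x)) is a limit of such touching points, and calibration passes to the
   limit by Gronwall.  Finally, along a calibrated characteristic v is pinched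
   at all times s < 0 between two paraboloids of slope Q(s), hence
   differentiable there with gradient Q(s). *)

Require Import Defs.
From HB Require Import structures.
From mathcomp Require Import all_boot all_order all_algebra.
From mathcomp Require Import all_classical all_reals all_analysis.
From mathcomp Require Import ring lra.
Set Implicit Arguments. Unset Strict Implicit. Unset Printing Implicit Defensive.
Import Order.TTheory GRing.Theory Num.Theory.
Import numFieldNormedType.Exports.
Local Open Scope classical_set_scope.
Local Open Scope ring_scope.

(** * Euclidean calculus for curves in coordinates *)

Section Euclid.
Context {R : realType} {n : nat}.
Notation vec := 'rV[R]_n.
Implicit Types (x y z V W : vec) (X Y : R -> vec) (s : R).

(** Nothing bounds the derivatives of [H] for large momenta: convexity and Taylor constants exist
    only on a box of momenta, and the flow itself might escape in finite time. The constants are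
    therefore fixed in the order [V] (bound of [v]), [r0] (coercivity below the level [eps * V]),
    [B], and then [al], [C], [speed], which depend on the box of size [B]. The curves used are
    solutions of the field with momentum clamped to that box, which is globally Lipschitz and has
    solutions for all times. Along curves issued from the graph the slope bound [4 * r0] keeps the
    momentum inside the box at negative times, so there the clamp never acts. The basic comparison
    transports upper bounds on [v] forward in time and, by contraposition, lower bounds backward.
    This is why a lower paraboloid touching at one time governs the past of the characteristic, and
    why the invariance is a backward one. *)

Definition dot (x y : vec) : R := \sum_i x 0 i * y 0 i.
Definition sq (x : vec) : R := dot x x.

Lemma dotC x y : dot x y = dot y x.
Proof. by apply: eq_bigr => i _; rewrite mulrC. Qed.

Lemma dotDl x y z : dot (x + y) z = dot x z + dot y z.
Proof. by rewrite /dot -big_split; apply: eq_bigr => i _ /=; rewrite mxE mulrDl. Qed.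

Lemma dotDr x y z : dot x (y + z) = dot x y + dot x z.
Proof. by rewrite dotC dotDl !(dotC x). Qed.

Lemma dotZl a x y : dot (a *: x) y = a * dot x y.
Proof. by rewrite /dot mulr_sumr; apply: eq_bigr => i _; rewrite mxE mulrA. Qed.

Lemma dotZr a x y : dot x (a *: y) = a * dot x y.
Proof. by rewrite dotC dotZl dotC. Qed.

Lemma dotNl x y : dot (- x) y = - dot x y.
Proof. by rewrite -scaleN1r dotZl mulN1r. Qed.

Lemma dotNr x y : dot x (- y) = - dot x y.
Proof. by rewrite dotC dotNl dotC. Qed.

Lemma dot0l x : dot 0 x = 0.
Proof. by rewrite -(scale0r 0) dotZl mul0r. Qed.

Lemma dot0r x : dot x 0 = 0.
Proof. by rewrite dotC dot0l. Qed.

Definition dotE := (dotDl, dotDr, dotNl, dotNr, dotZl, dotZr).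

Lemma sq_ge0 x : 0 <= sq x.
Proof. by apply: sumr_ge0 => i _; rewrite -expr2 sqr_ge0. Qed.

Lemma sq0 : sq 0 = 0. Proof. exact: dot0l. Qed.

Lemma sqN x : sq (- x) = sq x.
Proof. by rewrite /sq !dotE opprK. Qed.

Lemma sqZ a x : sq (a *: x) = a ^+ 2 * sq x.
Proof. by rewrite /sq !dotE; ring. Qed.

Lemma sqD x y : sq (x + y) = sq x + 2 * dot x y + sq y.
Proof. by rewrite /sq !dotE (dotC y x); ring. Qed.

Lemma sqB x y : sq (x - y) = sq x - 2 * dot x y + sq y.
Proof. by rewrite sqD sqN dotNr; ring. Qed.

Lemma sqDle x y : sq (x + y) <= 2 * sq x + 2 * sq y.
Proof. by have := sq_ge0 (x - y); rewrite sqB sqD; lra. Qed.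

Lemma dot_young a x y : 0 < a -> 2 * dot x y <= a * sq x + a^-1 * sq y.
Proof.
move=> a0; have := sq_ge0 (a *: x - y); rewrite sqB sqZ dotZl => h.
rewrite -(ler_pM2l a0) mulrDr !mulrA divff ?gt_eqF//; nra.
Qed.

Lemma sqr_coord_le x i : x 0 i ^+ 2 <= sq x.
Proof.
rewrite /sq /dot (bigD1 i)//= -expr2 lerDl.
by apply: sumr_ge0 => j _; rewrite -expr2 sqr_ge0.
Qed.

Lemma sq_eq0 x : sq x <= 0 -> x = 0.
Proof.
move=> x0; apply/rowP => i; rewrite mxE; apply/eqP; rewrite -sqrf_eq0 eq_le.
by rewrite sqr_ge0 andbT (le_trans (sqr_coord_le x i)).
Qed.

Lemma coord_le_norm (x : vec) i : `|x 0 i| <= `|x|.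
Proof.
by rewrite [leRHS]/Num.Def.normr/= mx_normrE; exact: (le_bigmax _ _ (0, i)).
Qed.

Lemma norm_le_coord (x : vec) e : 0 <= e -> (forall i, `|x 0 i| <= e) -> `|x| <= e.
Proof.
move=> e0 xe; rewrite [leLHS]/Num.Def.normr/= mx_normrE; apply: bigmax_le => //.
by move=> [i j] _ /=; rewrite ord1.
Qed.

Lemma sq_le_norm x : sq x <= n%:R * `|x| ^+ 2.
Proof.
have -> : n%:R * `|x| ^+ 2 = \sum_(i < n) `|x| ^+ 2.
  by rewrite sumr_const card_ord mulr_natl.
apply: ler_sum => i _; rewrite -expr2 -real_normK ?num_real//.
by rewrite lerXn2r ?nnegrE// coord_le_norm.
Qed.

Lemma norm_le_sq x e : 0 <= e -> sq x <= e ^+ 2 -> `|x| <= e.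
Proof.
move=> e0 xe; apply: norm_le_coord => // i.
rewrite -ler_sqr ?nnegrE// real_normK ?num_real//.
exact: le_trans (sqr_coord_le _ _) _.
Qed.

(** Coordinatewise derivatives let the scalar rules act under the sum in [dot]; [vderP] is the
    bridge to the vector derivative of [disc_flow_at]. *)
Definition vder (X : R -> vec) (s : R) (V : vec) :=
  forall i, is_derive s 1 (fun t => X t 0 i) (V 0 i).

Lemma vderP X s V : is_derive s 1 X V <-> vder X s V.
Proof.
split=> [XV i|XV].
  have dX : derivable X s 1 by exact: ex_derive.
  have := @derive_mx _ _ _ _ X s 1 dX; rewrite (@derive_val _ _ _ _ _ _ _ XV) => ->.
  by rewrite mxE; apply: derivableP; exact: ((derivable_mxP _ _ _).1 dX).
have dX : derivable X s 1.
  by apply/derivable_mxP => i j; rewrite ord1; apply: ex_derive; exact: (XV j).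
apply: DeriveDef => //; rewrite derive_mx//; apply/rowP => i; rewrite [LHS]mxE.
exact: (@derive_val _ _ _ _ _ _ _ (XV i)).
Qed.

Lemma vder_continuous X s V : vder X s V -> {for s, continuous X}.
Proof.
move=> /vderP XV; apply/differentiable_continuous/derivable1_diffP; exact: ex_derive.
Qed.

Lemma vder_dot X Y s V W : vder X s V -> vder Y s W ->
  is_derive s 1 (fun t => dot (X t) (Y t)) (dot V (Y s) + dot (X s) W).
Proof.
move=> XV YW.
have -> : (fun t => dot (X t) (Y t)) =
    \sum_i ((fun t => X t 0 i) * (fun t => Y t 0 i)).
  by apply/funext => t; rewrite fct_sumE.
apply: is_derive_eq.
  by apply: is_derive_sum => i; apply: is_deriveM; [exact: XV|exact: YW].
by rewrite /dot -big_split; apply: eq_bigr => i _ /=; rewrite addrC; congr (_ + _); rewrite mulrC.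
Qed.

Lemma vderD X Y s V W : vder X s V -> vder Y s W -> vder (fun t => X t + Y t) s (V + W).
Proof. by move=> /vderP XV /vderP YW; apply/vderP; exact: is_deriveD. Qed.

Lemma vderN X s V : vder X s V -> vder (fun t => - X t) s (- V).
Proof. by move=> /vderP XV; apply/vderP; exact: is_deriveN. Qed.

Lemma vder_cst x s : vder (fun=> x) s 0.
Proof. by apply/vderP; exact: is_derive_cst. Qed.

Lemma vderB X Y s V W : vder X s V -> vder Y s W -> vder (fun t => X t - Y t) s (V - W).
Proof. by move=> XV YW; exact: vderD XV (vderN YW). Qed.

Lemma vder_scale (f : R -> R) s df x : is_derive s 1 f df ->
  vder (fun t => f t *: x) s (df *: x).
Proof.
move=> fd i; rewrite mxE.
have -> : (fun t => (f t *: x) 0 i) = f * cst (x 0 i).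
  by apply/funext => t; rewrite mxE.
by apply: is_derive_eq; rewrite scaler0 add0r mulrC.
Qed.

Lemma vder_sq X s V : vder X s V ->
  is_derive s 1 (fun t => sq (X t)) (2 * dot (X s) V).
Proof.
by move=> XV; apply: is_derive_eq; [exact: vder_dot|rewrite (dotC V); ring].
Qed.

End Euclid.

(** * One-dimensional calculus and quadratic test functions *)

Section Calculus.
Context {R : realType}.

(** The remainder form reduces later differentiability arguments to inequalities. It includes
    [h = 0], where both sides vanish. *)
Lemma is_deriveEv (V W : normedModType R) (f : V -> W) (s v : V) (d : W) :
  is_derive s v f d <->
  forall e, 0 < e -> exists2 r, 0 < r &
    forall h, `|h| <= r -> `|f (s + h *: v) - f s - h *: d| <= e * `|h|.
Proof.
have E h : h != 0 -> `|d - h^-1 *: (f (h *: v + s) - f s)| * `|h| =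
    `|f (s + h *: v) - f s - h *: d|.
  move=> h0; rewrite mulrC -normrZ scalerBr scalerA divff// scale1r distrC.
  by rewrite (addrC s).
split=> [fd e e0|fd].
  have : (fun h => h^-1 *: (f (h *: v + s) - f s)) @ 0^' --> d.
    rewrite -(@derive_val _ _ _ _ _ _ _ fd).
    exact: (@ex_derive _ _ _ _ _ _ _ fd).
  move=> /cvgrPdist_le/(_ _ e0)[/= r r0 rP]; exists (r / 2); first by rewrite divr_gt0.
  move=> h hr; have [->|h0] := eqVneq h 0.
    by rewrite !scale0r addr0 subrr subr0 !normr0 mulr0.
  have := rP h; rewrite /= sub0r normrN => /(_ _ h0) H.
  by rewrite -E// ler_wpM2r//; apply: H; lra.
have fd' : (fun h => h^-1 *: (f (h *: v + s) - f s)) @ 0^' --> d.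
  apply/cvgrPdist_le => e e0; have [r r0 rP] := fd e e0.
  near=> h.
  have h0 : h != 0 by near: h; exact: nbhs_dnbhs_neq.
  have hr : `|h| <= r by near: h; apply: dnbhs0_le.
  by have := rP h hr; rewrite -E// ler_pM2r// normr_gt0.
apply: DeriveDef; first by apply/cvg_ex; exists d.
by apply/cvg_lim.
Unshelve. all: by end_near. Qed.

Lemma is_deriveE (f : R -> R) (s d : R) : is_derive s 1 f d <->
  forall e, 0 < e -> exists2 r, 0 < r &
    forall h, `|h| <= r -> `|f (s + h) - f s - d * h| <= e * `|h|.
Proof.
rewrite is_deriveEv; split=> fd e /fd[r r0 rP]; exists r => // h /rP;
  by rewrite /GRing.scale /= mulr1 (mulrC d).
Qed.

Lemma derive_right_ge0 (f : R -> R) (s d r : R) : 0 < r -> is_derive s 1 f d ->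
  (forall h, 0 < h <= r -> f s <= f (s + h)) -> 0 <= d.
Proof.
move=> r0 /is_deriveE fd fs; rewrite leNgt; apply/negP => d0.
have [|r' r'0 rP] := fd (- d / 2); first by lra.
set h := Num.min r r'.
have h0 : 0 < h by rewrite /h; case: (lerP r r').
have hr : h <= r by rewrite ge_min lexx.
have hr' : `|h| <= r' by rewrite gtr0_norm// ge_min lexx orbT.
have := rP h hr'; rewrite (gtr0_norm h0) ler_norml => /andP[_ h1].
have h2 : f s <= f (s + h) by apply: fs; rewrite h0 hr.
nra.
Qed.

Lemma derive_left_ge0 (f : R -> R) (s d r : R) : 0 < r -> is_derive s 1 f d ->
  (forall h, 0 < h <= r -> f (s - h) <= f s) -> 0 <= d.
Proof.
move=> r0 /is_deriveE fd fs; rewrite leNgt; apply/negP => d0.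
have [|r' r'0 rP] := fd (- d / 2); first by lra.
set h := Num.min r r'.
have h0 : 0 < h by rewrite /h; case: (lerP r r').
have hr : h <= r by rewrite ge_min lexx.
have hr' : `|- h| <= r' by rewrite normrN gtr0_norm// ge_min lexx orbT.
have := rP (- h) hr'; rewrite normrN (gtr0_norm h0) ler_norml => /andP[h1 _].
have h2 : f (s - h) <= f s by apply: fs; rewrite h0 hr.
nra.
Qed.

Lemma is_derive_continuous (f : R -> R) (s d : R) : is_derive s 1 f d -> {for s, continuous f}.
Proof. by move=> fd; apply/differentiable_continuous/derivable1_diffP/ex_derive. Qed.

Lemma derive_ge0_le (f df : R -> R) (a b : R) : a <= b ->
  (forall x, a <= x <= b -> is_derive x 1 f (df x)) ->
  (forall x, a <= x <= b -> 0 <= df x) -> f a <= f b.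
Proof.
move=> ab fd df0.
have [x||c cab] := @MVT_segment R f df a b ab.
- by rewrite in_itv/= => /andP[? ?]; apply: fd; rewrite !ltW.
- apply: continuous_in_subspaceT => x; rewrite inE/= in_itv/= => xab.
  exact: (is_derive_continuous (fd _ xab)).
rewrite in_itv/= in cab => fab; rewrite -subr_ge0 fab.
by rewrite mulr_ge0 ?subr_ge0// df0.
Qed.

End Calculus.

Section Quadratic.
Context {R : realType} {n : nat}.
Notation vec := 'rV[R]_n.


Definition quad (a : R) (b z : vec) (K : R) (y : vec) : R :=
  a + dot b (y - z) + K * sq (y - z).

Lemma quad_shift a b z K y w : quad a b z K w =
  quad a b z K y + dot (b + (2 * K) *: (y - z)) (w - y) + K * sq (w - y).
Proof.
rewrite /quad; have -> : w - z = (y - z) + (w - y) by rewrite [RHS]addrC subrKA.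
by move: (y - z) (w - y) => s t; rewrite sqD !dotE; ring.
Qed.

Lemma quad_differentiable a b z K y : differentiable (quad a b z K) y.
Proof.
have dc i x : differentiable (fun y : vec => y 0 i - z 0 i) x.
  by apply: differentiableB => //; exact: differentiable_coord.
have -> : quad a b z K = cst a + \sum_i ((fun y : vec => b 0 i *: (y 0 i - z 0 i)))
    + K *: (\sum_i ((fun y : vec => y 0 i - z 0 i) * (fun y : vec => y 0 i - z 0 i))).
  apply/funext => t; rewrite /quad.
  transitivity (a + \sum_i b 0 i *: (t 0 i - z 0 i) +
    K * \sum_i ((t 0 i - z 0 i) * (t 0 i - z 0 i))).
    by congr (_ + _ + K * _); apply: eq_bigr => i _; rewrite !mxE.
  by rewrite !fctE /= !fct_sumE.
apply: differentiableD; first apply: differentiableD => //.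
  by apply: differentiable_sum => i; apply: differentiableZ.
by apply: differentiableZ; apply: differentiable_sum => i; apply: differentiableM.
Qed.

Lemma dot_evec (b : vec) i : dot b (evec i) = b 0 i.
Proof.
rewrite /dot (bigD1 i)//= big1 ?addr0 ?mxE ?eqxx ?mulr1// => j ji.
by rewrite mxE (negbTE ji) ?andbF mulr0.
Qed.

Lemma quad_pinch_derive (u : vec -> R) (x p v : vec) K :
  (forall y, `|u y - u x - dot p (y - x)| <= K * sq (y - x)) ->
  is_derive x v u (dot p v).
Proof.
move=> uP; apply/is_deriveEv => e e0.
have K0 : 0 <= `|K| * sq v by rewrite mulr_ge0// sq_ge0.
exists (e / (`|K| * sq v + 1)) => [|h hr]; first by rewrite divr_gt0//; lra.
have := uP (x + h *: v); rewrite [x + _]addrC addrK dotZr sqZ => /le_trans; apply.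
rewrite ler_pdivlMr in hr; last by lra.
have h2 : h ^+ 2 = `|h| * `|h| by rewrite -expr2 real_normK ?num_real.
have Kle := ler_norm K; have v0 := sq_ge0 v; have h0 := normr_ge0 h.
rewrite h2; apply: (@le_trans _ _ (`|h| * (`|h| * (`|K| * sq v)))).
  have -> : K * (`|h| * `|h| * sq v) = (`|h| * `|h| * sq v) * K by ring.
  have -> : `|h| * (`|h| * (`|K| * sq v)) = (`|h| * `|h| * sq v) * `|K| by ring.
  by rewrite ler_wpM2l// !mulr_ge0.
by rewrite mulrC ler_wpM2r//; nra.
Qed.

Lemma quad_pinch_grad (u : vec -> R) (x p : vec) K :
  (forall y, `|u y - u x - dot p (y - x)| <= K * sq (y - x)) -> grad u x = p.
Proof.
move=> uP; apply/rowP => i; rewrite mxE -dot_evec.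
exact: (@derive_val _ _ _ _ _ _ _ (quad_pinch_derive _ uP)).
Qed.

Lemma quad_grad a b z K y : grad (quad a b z K) y = b + (2 * K) *: (y - z).
Proof.
(* Recentred at [y], the quadratic differs from its affine part by exactly [K * sq (w - y)]. *)
apply: (@quad_pinch_grad _ _ _ `|K|) => w; rewrite (quad_shift _ _ _ _ y).
set A := quad _ _ _ _ _; set B := dot _ _.
have -> : A + B + K * sq (w - y) - A - B = K * sq (w - y) by ring.
by rewrite normrM (ger0_norm (sq_ge0 _)).
Qed.

Lemma quad_C1 a b z K : C1fun (quad a b z K).
Proof.
split=> [x|]; first exact: quad_differentiable.
have -> : grad (quad a b z K) = fun y => b + (2 * K) *: (y - z).
  by apply/funext => y; rewrite quad_grad.
by move=> y; apply: differentiable_continuous; exact: differentiableD.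
Qed.

End Quadratic.

(** * Compactness and periodicity *)

Lemma fst_continuous (U V : topologicalType) : continuous (@fst U V).
Proof. by move=> [x y]; exact: cvg_fst. Qed.

Lemma snd_continuous (U V : topologicalType) : continuous (@snd U V).
Proof. by move=> [x y]; exact: cvg_snd. Qed.

Section Compactness.
Context {R : realType} {n : nat}.
Notation vec := 'rV[R]_n.

Lemma dot_continuous (T : topologicalType) (f g : T -> vec) (t : T) :
  {for t, continuous f} -> {for t, continuous g} ->
  {for t, continuous (fun t => dot (f t) (g t))}.
Proof.
move=> fc gc; rewrite /dot.
apply: cvg_big => [|i _]; first exact: add_continuous.
apply: cvgM.
- by apply: (@cvg_comp _ _ _ f (fun v : vec => v 0 i) _ _ _ fc); exact: coord_continuous.
- by apply: (@cvg_comp _ _ _ g (fun v : vec => v 0 i) _ _ _ gc); exact: coord_continuous.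
Qed.

Definition box (B : R) (p : vec) : Prop := forall i, `|p 0 i| <= B.

Lemma box_compact B : compact (box B).
Proof.
have -> : box B = [set v : vec | forall i, `[- B, B]%classic (v 0 i)].
  apply/seteqP; split => [p pB i|p pB i]; first by rewrite /= in_itv/= -ler_norml.
  by have := pB i; rewrite /= in_itv/= -ler_norml.
apply: (@rV_compact _ _ (fun=> `[- B, B]%classic)) => i.
exact: segment_compact.
Qed.

Lemma box0 B : 0 <= B -> box B 0.
Proof. by move=> B0 i; rewrite mxE normr0. Qed.

Lemma boxP B p : 0 <= B -> box B p <-> `|p| <= B.
Proof.
move=> B0; split=> [pB|pB i]; first exact: norm_le_coord.
exact: le_trans (coord_le_norm _ _) pB.
Qed.

Lemma sq_box B p : 0 <= B -> sq p <= B ^+ 2 -> box B p.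
Proof. by move=> B0 pB; apply/boxP => //; exact: norm_le_sq. Qed.

Lemma not_box_sq B p : 0 <= B -> ~ box B p -> B ^+ 2 < sq p.
Proof. by move=> B0 pB; rewrite ltNge; apply/negP => /(sq_box B0). Qed.

Lemma continuous_segment_bounded (f : R -> R) (a b : R) : a <= b ->
  (forall s, a <= s <= b -> {for s, continuous f}) ->
  exists M, forall s, a <= s <= b -> `|f s| <= M.
Proof.
move=> ab fc.
have [|c _ cP] := @EVT_max R (fun s => `|f s|) a b ab.
  apply: continuous_in_subspaceT => x; rewrite inE/= in_itv/= => xab.
  by apply: cvg_norm; exact: fc.
by exists `|f c| => s sab; apply: cP; rewrite in_itv.
Qed.

(** The source of all touching points. Space is not compact, but a bounded [u] loses against a
    paraboloid whose opening stays above [ka]: outside a fixed box in the variable [y - Y s], the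
    value at [Y s] wins. The centre [X] of the slope and the vertex [Y] are separate because the
    upper barrier is displaced from the characteristic. Minima are obtained with [- v], problems at
    a fixed time with [s0 = s1]. *)
Lemma barrier_max (u : vec -> R) (V ka s0 s1 : R) (a K : R -> R) (b X Y : R -> vec) :
  s0 <= s1 -> 0 < ka -> continuous u -> (forall y, `|u y| <= V) ->
  continuous a -> continuous K -> continuous b -> continuous X -> continuous Y ->
  (forall s, s0 <= s <= s1 -> ka <= K s) ->
  let S s y := a s + dot (b s) (y - X s) + K s * sq (y - Y s) in
  exists s y, s0 <= s <= s1 /\
    forall s' y', s0 <= s' <= s1 -> u y' - S s' y' <= u y - S s y.
Proof.
move=> s01 ka0 uc uV ac Kc bc Xc Yc Kka S.
pose f (z : R * vec) := u (Y z.1 + z.2) - S z.1 (Y z.1 + z.2).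
have V0 : 0 <= V by exact: le_trans (normr_ge0 _) (uV 0).
have [M MP] := continuous_segment_bounded s01
  (fun s _ => dot_continuous (bc s) (bc s)).
have M0 : 0 <= M by apply: le_trans (normr_ge0 _) (MP s0 _); rewrite lexx.
have fc : continuous f.
  move=> z.
  have c1 (W : topologicalType) (g : R -> W) : continuous g ->
      (g \o fst) x @[x --> z] --> g z.1.
    by move=> gc; apply: (@cvg_comp _ _ _ fst g _ _ _ (@fst_continuous _ _ z)); exact: gc.
  have Yz : (fun x : R * vec => Y x.1 + x.2) x @[x --> z] --> Y z.1 + z.2.
    by apply: cvgD; [exact: c1 Yc|exact: snd_continuous].
  apply: cvgB; first by apply: (@cvg_comp _ _ _ (fun x : R * vec => Y x.1 + x.2) u _ _ _ Yz); exact: uc.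
  apply: cvgD; first apply: cvgD.
  - exact: c1 ac.
  - apply: (@dot_continuous _ (fun x : R * vec => b x.1)
      (fun x : R * vec => Y x.1 + x.2 - X x.1)); first exact: c1 bc.
    by apply: cvgB; [exact: Yz|exact: c1 Xc].
  - apply: cvgM; first exact: c1 Kc.
    apply: (@dot_continuous _ (fun x : R * vec => Y x.1 + x.2 - Y x.1)
      (fun x : R * vec => Y x.1 + x.2 - Y x.1));
    by apply: cvgB; [exact: Yz|exact: c1 Yc].
(* [2 * V] bounds the oscillation of [u]; [M / (2 * ka)] is what Young's inequality leaves of the
   linear term after spending half of the quadratic one. The radius satisfies [2 * c <= ka * r], and
   [1 <= r] gives [r <= r ^+ 2]. *)
pose c := 2 * V + M / (2 * ka).
have c0 : 0 <= c by rewrite addr_ge0 ?mulr_ge0 ?invr_ge0 ?mulr_ge0 ?(ltW ka0).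
pose r := 1 + c * 2 / ka.
have r1 : 1 <= r by rewrite /r lerDl ?mulr_ge0 ?invr_ge0 ?(ltW ka0).
have fbig s eta : s0 <= s <= s1 -> ~ box r eta -> f (s, eta) <= f (s, 0).
  move=> ss /not_box_sq => /(_ (le_trans ler01 r1)) rsq.
  rewrite /f /S /= addr0 [Y s + _]addrC addrK.
  have -> : eta + Y s - X s = (Y s - X s) + eta by rewrite -addrA addrC.
  rewrite subrr sq0 mulr0 addr0 dotDr.
  have := uV (Y s); have := uV (eta + Y s); rewrite !ler_norml => /andP[_ u1] /andP[u2 _].
  have := @dot_young _ _ (ka^-1) (- b s) eta; rewrite invr_gt0 => /(_ ka0).
  rewrite invrK dotNl sqN => yo.
  have := MP s ss; rewrite ger0_norm ?sq_ge0// -/(sq _) => bM.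
  have Ks := Kka s ss.
  have eta0 := sq_ge0 eta.
  have h1 : ka * sq eta <= K s * sq eta by rewrite ler_wpM2r.
  have h2 : ka^-1 * sq (b s) <= ka^-1 * M by rewrite ler_wpM2l// invr_ge0 ltW.
  have h3 : 2 * c <= ka * sq eta.
    have : r <= sq eta by apply: le_trans (ltW rsq); rewrite expr2; nra.
    move=> rs; apply: (@le_trans _ _ (ka * r)); last by rewrite ler_wpM2l// ltW.
    have -> : ka * r = ka + 2 * c by rewrite /r; field; rewrite gt_eqF.
    by rewrite lerDr ltW.
  have h4 : M / (2 * ka) = ka^-1 * M / 2 by field; rewrite gt_eqF.
  move: h3; rewrite /c h4; lra.
have [|||/= [s eta]] := @compact_EVT_max _ _ f (`[s0, s1]%classic `*` box r).
- by exists (s0, 0); split; [rewrite /= in_itv/= lexx|apply: box0; exact: le_trans ler01 r1].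
- apply: compact_setX; [exact: segment_compact|exact: box_compact].
- exact: continuous_subspaceT.
rewrite inE => -[/= ss _] sP; rewrite in_itv/= in ss.
exists s, (Y s + eta); split => // s' y' ss'.
have f0 : f (s', 0) <= f (s, eta).
  apply: sP; rewrite inE; split; first by rewrite /= in_itv.
  by apply: box0; exact: le_trans ler01 r1.
have -> : u y' - S s' y' = f (s', y' - Y s') by rewrite /f /= [Y s' + _]addrC subrK.
rewrite -/(f (s, eta)); have [yr|yr] := pselect (box r (y' - Y s')).
  by apply: sP; rewrite inE; split => //; rewrite /= in_itv.
exact: le_trans (fbig _ _ ss' yr) f0.
Qed.

Lemma exists_intvec_box (x : vec) : exists k, intvec k /\ box 1 (x + k).
Proof.
exists (\row_i (- Num.floor (x 0 i))%:~R); split.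
  by exists (fun i => - Num.floor (x 0 i)).
move=> i; rewrite !mxE; have /andP[] := floor_itv (x 0 i).
by rewrite rmorphN intrD ler_norml; lra.
Qed.

(** Compactness of the torus in lifted form: an integer translation brings [x] into [box 1] without
    changing [f]. *)
Lemma periodic_bounded (f : vec -> vec -> R) B : 0 <= B ->
  (forall (x p k : vec), intvec k -> f (x + k) p = f x p) ->
  continuous (fun z : vec * vec => f z.1 z.2) ->
  exists2 M, 0 <= M & forall x p, box B p -> `|f x p| <= M.
Proof.
move=> B0 fper fc.
have [|||/= z _ zP] :=
    @compact_EVT_max _ R (fun z : vec * vec => `|f z.1 z.2|) (box 1 `*` box B).
- by exists (0, 0); split; exact: box0.
- by apply: compact_setX; exact: box_compact.
- by apply: continuous_subspaceT => z; apply: cvg_norm; exact: fc.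
exists `|f z.1 z.2| => // x p pB; have [k [kZ xk]] := exists_intvec_box x.
rewrite -(fper x p k kZ).
by apply: (zP (x + k, p)); rewrite inE.
Qed.

Lemma norm_sphere_compact : compact [set p : vec | `|p| = 1].
Proof.
apply: (@subclosed_compact _ _ (box 1) _ (@box_compact 1)).
  have -> : [set p : vec | `|p| = 1] = Num.norm @^-1` [set 1] by [].
  by apply: (preimage_closed _ (@closed_eq _ _)) => p _; exact: norm_continuous.
by move=> p /= p1; apply/boxP; rewrite ?p1.
Qed.

(** The minimum over base points, momenta in the box and unit directions is positive by compactness;
    homogeneity extends it to all [w]. The norm is the maximum norm, hence a factor of the dimension
    in passing to [sq]. *)
Lemma periodic_posdef_bound (Q : vec -> vec -> vec -> R) B : 0 <= B ->
  (forall (x p w k : vec), intvec k -> Q (x + k) p w = Q x p w) ->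
  continuous (fun z : (vec * vec) * vec => Q z.1.1 z.1.2 z.2) ->
  (forall (x p w : vec), w != 0 -> 0 < Q x p w) ->
  (forall (x p w : vec) a, Q x p (a *: w) = a ^+ 2 * Q x p w) ->
  exists2 al, 0 < al & forall x p w, box B p -> al * sq w <= Q x p w.
Proof.
move=> B0 Qper Qc Qpos QZ.
have Q0 x p : Q x p 0 = 0 by have := QZ x p 0 0; rewrite scale0r expr0n mul0r.
(* The unit sphere is empty only in dimension zero, where every vector vanishes. *)
have [[w0 w01]|noS] := pselect ([set p : vec | `|p| = 1] !=set0); last first.
  have w0 (w : vec) : w = 0.
    have [//|w0] := eqVneq w 0; exfalso; apply: noS; exists (`|w|^-1 *: w).
    by rewrite /= normrZ normfV normr_id mulVf// normr_eq0.
  exists 1 => // x p w _; rewrite (w0 w) sq0 mulr0.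
  by rewrite Q0.
have [|||/= z zin zP] := @compact_EVT_min _ R
  (fun z : (vec * vec) * vec => Q z.1.1 z.1.2 z.2)
  ((box 1 `*` box B) `*` [set p : vec | `|p| = 1]).
- by exists ((0, 0), w0); split => //; split; exact: box0.
- by apply: compact_setX; [apply: compact_setX; exact: box_compact|exact: norm_sphere_compact].
- exact: continuous_subspaceT.
rewrite inE in zin; case: zin => _ /= z1.
have m0 : 0 < Q z.1.1 z.1.2 z.2.
  by apply: Qpos; rewrite -normr_eq0 z1 oner_neq0.
set m := Q _ _ _ in m0 zP.
exists (m / (n%:R + 1)) => [|x p w pB]; first by rewrite divr_gt0// ltr_wpDl.
have n0 : 0 < n%:R + 1 :> R by rewrite ltr_wpDl.
have [->|w_neq0] := eqVneq w 0.
  by rewrite sq0 mulr0 Q0.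
have [k [kZ xk]] := exists_intvec_box x.
have wn : 0 < `|w| by rewrite normr_gt0.
have -> : w = `|w| *: (`|w|^-1 *: w) by rewrite scalerA divff ?gt_eqF// scale1r.
set w' := _ *: w; rewrite QZ.
have w'1 : `|w'| = 1 by rewrite normrZ normfV normr_id mulVf// gt_eqF.
have mQ : m <= Q x p w'.
  by rewrite -(Qper x p w' k kZ); apply: (zP (x + k, p, w')); rewrite inE.
rewrite sqZ mulrCA ler_wpM2l ?sqr_ge0//; apply: le_trans mQ.
rewrite mulrAC ler_pdivrMr// ler_wpM2l ?(ltW m0)//.
by have := sq_le_norm w'; rewrite w'1 expr1n mulr1; lra.
Qed.

End Compactness.

(** * Continuous partial derivatives and the chain rule *)

Section Differentiability.
Context {R : realType} {n : nat}.
Notation vec := 'rV[R]_n.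

Lemma MVT_signed (f df : R -> R) (h : R) : (forall t : R, is_derive t 1 f (df t)) ->
  exists2 c, `|c| <= `|h| & f h - f 0 = df c * h.
Proof.
move=> fd.
have fc : continuous f by move=> t; exact: is_derive_continuous (fd t).
have [h0|h0] := leP 0 h.
  have [|c] := @MVT_segment R f df 0 h h0; [exact: continuous_subspaceT|].
  rewrite in_itv/= subr0 => /andP[c0 ch] fE; exists c => //.
  by rewrite !ger0_norm.
have [|c] := @MVT_segment R f df h 0 (ltW h0); [exact: continuous_subspaceT|].
rewrite in_itv/= sub0r => /andP[c0 ch] fE; exists c; last by lra.
by rewrite !ler0_norm ?lerN2// ltW.
Qed.

Definition norm1 (w : vec) : R := \sum_i `|w 0 i|.

Lemma norm1_ge0 w : 0 <= norm1 w. Proof. exact: sumr_ge0. Qed.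

Lemma norm1_le_norm w : norm1 w <= n%:R * `|w|.
Proof.
have -> : n%:R * `|w| = \sum_(i < n) `|w| by rewrite sumr_const card_ord mulr_natl.
by apply: ler_sum => i _; exact: coord_le_norm.
Qed.

Lemma norm_evec_le i : `|evec i : vec| <= 1.
Proof.
apply: norm_le_coord => // j; rewrite mxE.
by case: (_ && _); rewrite ?normr1 ?normr0.
Qed.

Section C1.
Variable F : vec -> vec -> R.
Hypothesis FC1 : C1_2 F.

(** A single finite index type for the derivatives in [x] ([true]) and in [p] ([false]) allows sums
    and inductions over all directions at once; [coef] gives the matching coordinates of an
    increment. *)
Definition dpart (k : bool * 'I_n) (x p : vec) : R :=
  pder F (cdir k.1 k.2).1 (cdir k.1 k.2).2 x p.

Lemma is_derive_dpart k (x p : vec) (s : R) :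
  is_derive s 1 (fun t : R => F (x + t *: (cdir k.1 k.2).1) (p + t *: (cdir k.1 k.2).2))
   (dpart k (x + s *: (cdir k.1 k.2).1) (p + s *: (cdir k.1 k.2).2)).
Proof.
have [Fex _] := FC1 k.1 k.2.
have := Fex (x + s *: (cdir k.1 k.2).1) (p + s *: (cdir k.1 k.2).2).
move=> /derivableP; rewrite -derive1E -/(pder _ _ _ _ _) -/(dpart _ _ _) => /is_deriveE Fd.
apply/is_deriveE => e /Fd[r r0 rP]; exists r => // h /rP.
by rewrite add0r !scale0r !addr0 -!addrA -!scalerDl.
Qed.

Definition coef (xi pi : vec) (k : bool * 'I_n) : R := if k.1 then xi 0 k.2 else pi 0 k.2.

Lemma sum_pairs (G : nmodType) (f : bool * 'I_n -> G) :
  \sum_k f k = \sum_i f (true, i) + \sum_i f (false, i).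
Proof.
rewrite (eq_bigr (fun k => f (k.1, k.2))); last by case.
by rewrite -(pair_bigA _ (fun b i => f (b, i)))/= big_bool.
Qed.

Lemma sum_coef_abs xi pi : \sum_k `|coef xi pi k| = norm1 xi + norm1 pi.
Proof. exact: sum_pairs. Qed.

Lemma sum_coef_dpart xi pi x p : \sum_k coef xi pi k * dpart k x p =
  dot (Hx F x p) xi + dot (Hp F x p) pi.
Proof.
rewrite sum_pairs; congr (_ + _); apply: eq_bigr => i _;
  by rewrite /coef /dpart /= mxE mulrC.
Qed.

Lemma sum_coef1 xi pi : \sum_k coef xi pi k *: (cdir k.1 k.2).1 = xi.
Proof.
rewrite sum_pairs /= [X in _ + X]big1 ?addr0; last by move=> i _; rewrite scaler0.
by rewrite [RHS]row_sum_delta.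
Qed.

Lemma sum_coef2 xi pi : \sum_k coef xi pi k *: (cdir k.1 k.2).2 = pi.
Proof.
rewrite sum_pairs /= [X in X + _]big1 ?add0r; last by move=> i _; rewrite scaler0.
by rewrite [RHS]row_sum_delta.
Qed.

Lemma cdir_norm (b : bool) (i : 'I_n) :
  `|(cdir b i).1 : vec| <= 1 /\ `|(cdir b i).2 : vec| <= 1.
Proof. by case: b => /=; rewrite normr0; split => //; exact: norm_evec_le. Qed.

(** [C1_2] offers only partial derivatives; their continuity near [(x, p)] yields the total
    expansion. The remainder is measured by [norm1] because the increment is reached along
    coordinate directions, and this is the length of the path. *)
Lemma C1_2_expansion x p e : 0 < e -> exists2 r, 0 < r &
  forall xi pi, `|xi| <= r -> `|pi| <= r ->
  `|F (x + xi) (p + pi) - F x p - (dot (Hx F x p) xi + dot (Hp F x p) pi)|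
    <= e * (norm1 xi + norm1 pi).
Proof.
move=> e0.
have : \forall z \near (x, p), forall k, `|dpart k x p - dpart k z.1 z.2| <= e.
  apply: (@filter_forall _ (bool * 'I_n)%type (fun k (z : vec * vec) => `|dpart k x p - dpart k z.1 z.2| <= e) (nbhs (x, p)) _) => k; have [_ Fc] := FC1 k.1 k.2.
  by have /cvgrPdist_le/(_ _ e0) := Fc (x, p).
move=> /nbhs_ballP[r0 /= r00 rP].
pose r := r0 / 2.
have r_gt0 : 0 < r by rewrite divr_gt0.
have near_dpart (x' p' : vec) k : `|x' - x| <= r -> `|p' - p| <= r ->
    `|dpart k x' p' - dpart k x p| <= e.
  move=> xr pr; rewrite distrC; apply: (rP (x', p')).
  have rr0 : r < r0 by rewrite /r; move: r00 => /=; lra.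
  split; rewrite -ball_normE /ball_ /= distrC; exact: le_lt_trans rr0.
(* Induction on the list of directions: the mean value theorem on the added leg compares its
   derivative with the one at [(x, p)], and the whole path stays within [r] of the base point. *)
have telescope xi pi (s : seq (bool * 'I_n)) :
    \sum_(k <- s) `|coef xi pi k| <= r ->
    `|F (x + \sum_(k <- s) coef xi pi k *: (cdir k.1 k.2).1)
        (p + \sum_(k <- s) coef xi pi k *: (cdir k.1 k.2).2) - F x p
      - \sum_(k <- s) coef xi pi k * dpart k x p|
    <= e * \sum_(k <- s) `|coef xi pi k|.
  elim: s => [_|k s IHs].
    by rewrite !big_nil !addr0 subrr subr0 normr0 mulr0.
  rewrite !big_cons; set A := \sum_(j <- s) _ *: _.1; set B := \sum_(j <- s) _ *: _.2.
  set N := \sum_(j <- s) `|_|; set w := coef _ _ k => wN.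
  have w0 := normr_ge0 w.
  have Nr : N <= r by lra.
  have AN : `|A| <= N.
    apply: le_trans (ler_norm_sum _ _ _) _; apply: ler_sum => j _.
    by rewrite normrZ ler_piMr//; have [] := cdir_norm j.1 j.2.
  have BN : `|B| <= N.
    apply: le_trans (ler_norm_sum _ _ _) _; apply: ler_sum => j _.
    by rewrite normrZ ler_piMr//; have [] := cdir_norm j.1 j.2.
  have [c cw] := MVT_signed w (is_derive_dpart k (x + A) (p + B)).
  rewrite !scale0r !addr0 => cE.
  have [d1 d2] := cdir_norm k.1 k.2.
  have /near_dpart H1 : `|x + A + c *: (cdir k.1 k.2).1 - x| <= r.
    rewrite addrC !addrA addNr add0r; apply: le_trans (ler_normD _ _) _.
    have : `|c *: (cdir k.1 k.2).1| <= `|c| by rewrite normrZ ler_piMr.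
    lra.
  have {H1}/H1 H : `|p + B + c *: (cdir k.1 k.2).2 - p| <= r.
    rewrite addrC !addrA addNr add0r; apply: le_trans (ler_normD _ _) _.
    have : `|c *: (cdir k.1 k.2).2| <= `|c| by rewrite normrZ ler_piMr.
    lra.
  have -> : x + (w *: (cdir k.1 k.2).1 + A) = x + A + w *: (cdir k.1 k.2).1.
    by rewrite addrA addrAC.
  have -> : p + (w *: (cdir k.1 k.2).2 + B) = p + B + w *: (cdir k.1 k.2).2.
    by rewrite addrA addrAC.
  have {H}H := H k.
  have IH := IHs Nr.
  set Fw := F _ _ in cE *; set F1 := F _ _ in cE IH; set D1 := dpart _ _ _ in cE H.
  set S := \sum_(j <- s) _ in IH *.
  have -> : Fw - F x p - (w * dpart k x p + S) =
      (F1 - F x p - S) + w * (D1 - dpart k x p).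
    have -> : Fw = F1 + D1 * w by lra.
    by ring.
  apply: le_trans (ler_normD _ _) _; rewrite (mulrDr e) (addrC (e * `|w|)) lerD// normrM mulrC.
  by rewrite ler_wpM2r.
exists (r / (2 * n%:R + 1)).
  by rewrite divr_gt0// ltr_wpDl// mulr_ge0.
move=> xi pi xr pr.
have := telescope xi pi (index_enum (bool * 'I_n)%type).
rewrite sum_coef1 sum_coef2 sum_coef_dpart sum_coef_abs; apply.
have n0 : 0 < 2 * n%:R + 1 :> R by rewrite ltr_wpDl// mulr_ge0.
have h1 := norm1_le_norm xi; have h2 := norm1_le_norm pi.
rewrite ler_pdivlMr// in xr; rewrite ler_pdivlMr// in pr.
have x0 := normr_ge0 xi; have p0 := normr_ge0 pi.
by lra.
Qed.

Lemma chain_rule (X P : R -> vec) s V W : vder X s V -> vder P s W ->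
  is_derive s 1 (fun t => F (X t) (P t))
    (dot (Hx F (X s) (P s)) V + dot (Hp F (X s) (P s)) W).
Proof.
move=> XV PW; apply/is_deriveE => e e0.
set a := Hx F _ _; set b := Hp F _ _.
have n0 : 0 <= n%:R :> R by [].
(* [L] bounds the [norm1] increments of both curves per unit of [|h|]. Half of [e] goes to the
   remainder of [F], the other half to the remainders of [X] and [P], which the gradient multiplies
   by at most [M]. *)
pose L : R := n%:R * (`|V| + `|W| + 2) + 1.
have L0 : 0 < L by rewrite ltr_wpDl// mulr_ge0// !addr_ge0.
have [r r0 rP] := @C1_2_expansion (X s) (P s) (e / (2 * L)) (divr_gt0 e0 (mulr_gt0 (ltr0n _ 2) L0)).
pose M : R := norm1 a + norm1 b + 1.
have M0 : 0 < M by rewrite ltr_wpDl// addr_ge0// norm1_ge0.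
pose e1 := Num.min 1 (e / (2 * M)).
have e10 : 0 < e1 by rewrite lt_min ltr01 divr_gt0// mulr_gt0.
have e11 : e1 <= 1 by rewrite ge_min lexx.
have e1e : e1 * (2 * M) <= e by rewrite -ler_pdivlMr ?mulr_gt0// ge_min lexx orbT.
have /vderP/is_deriveEv/(_ _ e10)[rX rX0 rXP] := XV.
have /vderP/is_deriveEv/(_ _ e10)[rP' rP0 rPP] := PW.
pose L' := `|V| + `|W| + 2.
have L'0 : 0 < L' by rewrite ltr_wpDl// addr_ge0.
exists (Num.min (Num.min rX rP') (r / L')).
  by rewrite !lt_min rX0 rP0 divr_gt0.
move=> h; rewrite !le_min => /andP[/andP[hX hP] hr].
have h0 := normr_ge0 h.
have := rXP h hX; have := rPP h hP.
rewrite /GRing.scale /= mulr1 -/(GRing.scale _ _) => pe xe.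
set xi := X (s + h) - X s; set pi := P (s + h) - P s.
have xiE : `|xi| <= `|h| * (`|V| + 1).
  have -> : xi = (xi - h *: V) + h *: V by rewrite subrK.
  by apply: le_trans (ler_normD _ _) _; rewrite normrZ; move: xe; rewrite -/xi; nra.
have piE : `|pi| <= `|h| * (`|W| + 1).
  have -> : pi = (pi - h *: W) + h *: W by rewrite subrK.
  by apply: le_trans (ler_normD _ _) _; rewrite normrZ; move: pe; rewrite -/pi; nra.
have V0 := normr_ge0 V; have W0 := normr_ge0 W.
have hL : `|h| * L' <= r by rewrite -ler_pdivlMr.
have xir : `|xi| <= r by apply: le_trans hL; apply: le_trans xiE _; rewrite /L'; nra.
have pir : `|pi| <= r by apply: le_trans hL; apply: le_trans piE _; rewrite /L'; nra.
have := rP xi pi xir pir; rewrite -/a -/b /xi /pi ![_ s + (_ - _)]addrC !subrK -/xi -/pi => main.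
have dot_le (u w : vec) : `|dot u w| <= norm1 u * `|w|.
  rewrite /dot /norm1 mulr_suml; apply: le_trans (ler_norm_sum _ _ _) _.
  by apply: ler_sum => i _; rewrite normrM ler_wpM2l// coord_le_norm.
have d1 := le_trans (dot_le a (xi - h *: V)) (ler_wpM2l (norm1_ge0 a) xe).
have d2 := le_trans (dot_le b (pi - h *: W)) (ler_wpM2l (norm1_ge0 b) pe).
rewrite dotDr dotNr dotZr in d1; rewrite dotDr dotNr dotZr in d2.
have o1 := norm1_le_norm xi; have o2 := norm1_le_norm pi.
set T := F (X (s + h)) _ - _ in main *.
have -> : T - (dot a V + dot b W) * h =
  (T - (dot a xi + dot b pi)) + (dot a xi - h * dot a V) + (dot b pi - h * dot b W) by ring.
apply: le_trans (ler_normD _ _) _.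
apply: le_trans (lerD (ler_normD _ _) (lexx _)) _.
have k1 : norm1 xi + norm1 pi <= `|h| * L.
  have q1 : n%:R * `|xi| <= n%:R * (`|h| * (`|V| + 1)) by rewrite ler_wpM2l.
  have q2 : n%:R * `|pi| <= n%:R * (`|h| * (`|W| + 1)) by rewrite ler_wpM2l.
  have -> : `|h| * L = n%:R * (`|h| * (`|V| + 1)) + n%:R * (`|h| * (`|W| + 1)) + `|h|.
    by rewrite /L; ring.
  by apply: le_trans (lerD (le_trans o1 q1) (le_trans o2 q2)) _; rewrite lerDl.
have k2 : e / (2 * L) * (norm1 xi + norm1 pi) <= e / 2 * `|h|.
  have -> : e / 2 * `|h| = e / (2 * L) * (`|h| * L) by field; rewrite gt_eqF.
  by rewrite ler_wpM2l// divr_ge0 ?ltW// mulr_gt0.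
have a0 := norm1_ge0 a; have b0 := norm1_ge0 b.
have k3 : (norm1 a + norm1 b) * (e1 * `|h|) <= e / 2 * `|h|.
  rewrite mulrA ler_wpM2r// ler_pdivlMr//; apply: le_trans e1e.
  rewrite mulrAC mulrC (mulrC _ 2).
  by rewrite ler_wpM2l ?(ltW e10)// /M ler_wpM2l// lerDl.
apply: le_trans (lerD (lerD main d1) d2) _.
have -> : e * `|h| = e / 2 * `|h| + e / 2 * `|h| by rewrite -mulrDl -splitr.
by rewrite -addrA -mulrDl lerD.
Qed.

Lemma is_derive_line (x p xi pi : vec) (s : R) :
  is_derive s 1 (fun t : R => F (x + t *: xi) (p + t *: pi))
    (dot (Hx F (x + s *: xi) (p + s *: pi)) xi + dot (Hp F (x + s *: xi) (p + s *: pi)) pi).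
Proof.
have line (y w : vec) : vder (fun t : R => y + t *: w) s w.
  rewrite -[w in vder _ _ w]add0r -[w in vder _ _ (0 + w)]scale1r.
  by apply: vderD; [exact: vder_cst|apply: vder_scale; exact: is_derive_id].
by apply: (@chain_rule (fun t => x + t *: xi) (fun t => p + t *: pi)); exact: line.
Qed.

End C1.
End Differentiability.

(** * Second-order bounds on a box *)

Section SecondOrder.
Context {R : realType} {n : nat}.
Notation vec := 'rV[R]_n.

(** Monotonicity is applied twice, to [g1] and then to [g], each minus its polynomial model. The
    matching upper estimate comes from [- g]. *)
Lemma taylor2_ge (g g1 g2 : R -> R) (m : R) :
  (forall t : R, is_derive t 1 g (g1 t)) -> (forall t : R, is_derive t 1 g1 (g2 t)) ->
  (forall t, 0 <= t <= 1 -> m <= g2 t) -> g 0 + g1 0 + m / 2 <= g 1.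
Proof.
move=> dg dg1 mg2.
have g1_ge t : 0 <= t <= 1 -> g1 0 + m * t <= g1 t.
  move=> /andP[t0 t1].
  have := @derive_ge0_le _ (g1 - (m *: id)) (fun t => g2 t - m) 0 t t0.
  rewrite !fctE /= /GRing.scale /= mulr0 subr0 lerBrDr; apply.
    by move=> x _; apply: is_derive_eq; rewrite /GRing.scale /= mulr1.
  by move=> x /andP[x0 xt]; rewrite subr_ge0 mg2// x0 (le_trans xt).
pose w := (g - (g1 0 *: id) - ((m / 2) *: (id * id))) : R -> R.
have := @derive_ge0_le _ w (fun t => g1 t - g1 0 - m * t) 0 1 ler01.
rewrite /w !fctE /= /GRing.scale /= !mulr0 !mulr1 !subr0 => H.
suff : g 0 <= g 1 - g1 0 - m / 2 by lra.
apply: H => [x _|x x01]; last by have := g1_ge x x01; lra.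
by apply: is_derive_eq; rewrite /GRing.scale /=; field.
Qed.

Lemma sqr_norm1_le (w : vec) : norm1 w ^+ 2 <= n%:R * sq w.
Proof.
have -> : norm1 w ^+ 2 = \sum_i \sum_j `|w 0 i| * `|w 0 j|.
  by rewrite expr2 {1}/norm1 mulr_suml; apply: eq_bigr => i _; rewrite mulr_sumr.
have -> : n%:R * sq w = \sum_(i < n) \sum_(j < n) (w 0 i ^+ 2 + w 0 j ^+ 2) / 2.
  transitivity (\sum_(i < n) (n%:R * w 0 i ^+ 2 / 2 + sq w / 2)).
    rewrite big_split /= sumr_const card_ord -!mulr_suml -mulr_sumr.
    rewrite -[X in _ = _ + X]mulr_natl.
    have -> : \sum_i w 0 i ^+ 2 = sq w by apply: eq_bigr => i _; rewrite expr2.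
    by field.
  apply: eq_bigr => i _; rewrite -mulr_suml big_split /= sumr_const card_ord mulrDl.
  by rewrite mulr_natl; congr (_ + _ / _); apply: eq_bigr => j _; rewrite expr2.
apply: ler_sum => i _; apply: ler_sum => j _.
rewrite -(real_normK (num_real (w 0 i))) -(real_normK (num_real (w 0 j))).
by have := sqr_ge0 (`|w 0 i| - `|w 0 j|); nra.
Qed.

Lemma pder_shift (F : vec -> vec -> R) (a b k x p : vec) :
  (forall x p, F (x + k) p = F x p) -> pder F a b (x + k) p = pder F a b x p.
Proof.
move=> Fk; rewrite /pder.
suff -> : (fun t : R => F (x + k + t *: a) (p + t *: b)) =
  (fun t : R => F (x + t *: a) (p + t *: b)) by [].
by apply/funext => t; rewrite -addrA (addrC k) addrA; exact: Fk.
Qed.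

Variable F : vec -> vec -> R.
Hypothesis Fper : periodicH F.
Hypothesis FC2 : C2_2 F.
Hypothesis Fpos : Hpp_posdef F.
Variable B : R.
Hypothesis B0 : 0 <= B.

Let FC1 : C1_2 F := FC2.1.
Let dFC1 k : C1_2 (dpart F k). Proof. exact: FC2.2. Qed.

Lemma dpart_periodic (G : vec -> vec -> R) k : periodicH G -> periodicH (dpart G k).
Proof. by move=> Gper x p z zZ; apply: pder_shift => y q; exact: Gper. Qed.

Lemma dpart_bounded (G : vec -> vec -> R) : periodicH G -> C1_2 G ->
  exists2 M, 0 <= M & forall k x p, box B p -> `|dpart G k x p| <= M.
Proof.
move=> Gper GC1.
have /choice[M MP] k : exists M, 0 <= M /\ forall x p, box B p -> `|dpart G k x p| <= M.
  have [M M0 MP] := @periodic_bounded _ _ (dpart G k) B B0 (dpart_periodic k Gper)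
    (GC1 k.1 k.2).2.
  by exists M.
exists (\sum_k M k); first by apply: sumr_ge0 => k _; have [] := MP k.
move=> k x p pB; apply: le_trans ((MP k).2 x p pB) _.
by rewrite (bigD1 k)//= lerDl; apply: sumr_ge0 => j _; have [] := MP j.
Qed.

Lemma dpart2_bounded :
  exists2 M, 0 <= M & forall k l x p, box B p -> `|dpart (dpart F k) l x p| <= M.
Proof.
have /choice[M MP] k : exists M, 0 <= M /\
    forall l x p, box B p -> `|dpart (dpart F k) l x p| <= M.
  by have [M M0 MP] := dpart_bounded (dpart_periodic k Fper) (dFC1 k); exists M.
exists (\sum_k M k); first by apply: sumr_ge0 => k _; have [] := MP k.
move=> k l x p pB; apply: le_trans ((MP k).2 l x p pB) _.
by rewrite (bigD1 k)//= lerDl; apply: sumr_ge0 => j _; have [] := MP j.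
Qed.

Definition hess (x p xi pi : vec) : R :=
  \sum_k coef xi pi k * \sum_l coef xi pi l * dpart (dpart F k) l x p.

Lemma is_derive_grad_line (x p xi pi : vec) (s : R) :
  is_derive s 1 (fun t : R => dot (Hx F (x + t *: xi) (p + t *: pi)) xi +
                              dot (Hp F (x + t *: xi) (p + t *: pi)) pi)
    (hess (x + s *: xi) (p + s *: pi) xi pi).
Proof.
have -> : (fun t : R => dot (Hx F (x + t *: xi) (p + t *: pi)) xi +
                    dot (Hp F (x + t *: xi) (p + t *: pi)) pi) =
    (fun t => \sum_k coef xi pi k *: dpart F k (x + t *: xi) (p + t *: pi)).
  by apply/funext => t; rewrite -sum_coef_dpart.
have : forall r : seq (bool * 'I_n), is_derive s 1
    (fun t => \sum_(k <- r) coef xi pi k *: dpart F k (x + t *: xi) (p + t *: pi))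
    (\sum_(k <- r) coef xi pi k *: \sum_l coef xi pi l * dpart (dpart F k) l (x + s *: xi) (p + s *: pi)).
  elim=> [|k r IHr].
    rewrite big_nil; have -> : (fun t => \sum_(k <- [::]) coef xi pi k *:
      dpart F k (x + t *: xi) (p + t *: pi)) = cst 0 by apply/funext => t; rewrite big_nil.
    exact: is_derive_cst.
  rewrite big_cons; have -> : (fun t => \sum_(k <- k :: r) coef xi pi k *:
      dpart F k (x + t *: xi) (p + t *: pi)) =
    coef xi pi k *: (fun t : R => dpart F k (x + t *: xi) (p + t *: pi)) +
    (fun t => \sum_(k <- r) coef xi pi k *: dpart F k (x + t *: xi) (p + t *: pi)).
    by apply/funext => t; rewrite big_cons.
  apply: is_deriveD; apply: is_deriveZ; rewrite sum_coef_dpart.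
  exact: is_derive_line (dFC1 k) _ _ _ _ _.
by apply.
Qed.

Lemma box_segment (p pi : vec) t : 0 <= t <= 1 -> box B p -> box B (p + pi) ->
  box B (p + t *: pi).
Proof.
move=> /andP[t0 t1] pB qB i; have := pB i; have := qB i.
by rewrite !mxE !ler_norml => /andP[a1 a2] /andP[b1 b2]; apply/andP; split; nra.
Qed.

Lemma dpart_lipschitz : exists2 M, 0 <= M & forall k x p x' p', box B p -> box B p' ->
  `|dpart F k x p - dpart F k x' p'| <= M * (norm1 (x - x') + norm1 (p - p')).
Proof.
have [M M0 MP] := dpart2_bounded; exists M => // k x p x' p' pB p'B.
set xi := x - x'; set pi := p - p'.
have [||c c01] := @MVT_segment _ (fun t : R => dpart F k (x' + t *: xi) (p' + t *: pi))
  (fun t => \sum_l coef xi pi l * dpart (dpart F k) l (x' + t *: xi) (p' + t *: pi)) 0 1 ler01.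
- move=> t _; rewrite sum_coef_dpart; exact: is_derive_line (dFC1 k) _ _ _ _ _.
- apply: continuous_subspaceT => t; apply: is_derive_continuous.
  exact: is_derive_line (dFC1 k) _ _ _ _ _.
rewrite in_itv/= in c01; rewrite !scale0r !scale1r !addr0 subr0 mulr1.
rewrite /xi /pi ![_ + (_ - _)]addrC !subrK => ->.
apply: le_trans (ler_norm_sum _ _ _) _; rewrite -sum_coef_abs mulr_sumr.
apply: ler_sum => l _; rewrite normrM mulrC ler_wpM2r//; apply: MP.
by apply: box_segment => //; rewrite /pi addrC subrK.
Qed.

Lemma Hpp_form x p (w : vec) : (w *m Hpp F x p *m w^T) 0 0 =
  \sum_i \sum_j w 0 i * w 0 j * dpart (dpart F (false, i)) (false, j) x p.
Proof.
rewrite mxE; apply: eq_bigr => i _; rewrite !mxE mulr_suml.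
by apply: eq_bigr => j _; rewrite !mxE [LHS]mulrC mulrA.
Qed.

(** Isolates the block in [p] alone, the only one with a sign; the others are merely bounded. *)
Lemma coef_quad_split (xi pi : vec) (D : bool * 'I_n -> bool * 'I_n -> R) :
  \sum_k coef xi pi k * (\sum_l coef xi pi l * D k l) =
  \sum_i \sum_j pi 0 i * pi 0 j * D (false, i) (false, j) +
  (\sum_i \sum_j xi 0 i * xi 0 j * D (true, i) (true, j) +
   \sum_i \sum_j xi 0 i * pi 0 j * (D (true, i) (false, j) + D (false, j) (true, i))).
Proof.
have -> : \sum_i \sum_j xi 0 i * pi 0 j * (D (true, i) (false, j) + D (false, j) (true, i)) =
   \sum_i \sum_j xi 0 i * pi 0 j * D (true, i) (false, j) +
   \sum_i \sum_j pi 0 i * xi 0 j * D (false, i) (true, j).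
  rewrite [X in _ = _ + X]exchange_big /= -big_split; apply: eq_bigr => i _ /=.
  by rewrite -big_split; apply: eq_bigr => j _ /=; rewrite mulrDr (mulrC (pi 0 j)).
transitivity ((\sum_i \sum_j xi 0 i * xi 0 j * D (true, i) (true, j) +
   \sum_i \sum_j xi 0 i * pi 0 j * D (true, i) (false, j)) +
  (\sum_i \sum_j pi 0 i * xi 0 j * D (false, i) (true, j) +
   \sum_i \sum_j pi 0 i * pi 0 j * D (false, i) (false, j))); last by ring.
rewrite sum_pairs; congr (_ + _); rewrite -big_split; apply: eq_bigr => i _ /=;
  by rewrite sum_pairs mulrDr !mulr_sumr; congr (_ + _); apply: eq_bigr => j _;
     rewrite mulrA.
Qed.

Lemma sum2_le (a b : vec) (D : 'I_n -> 'I_n -> R) M :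
  (forall i j, `|D i j| <= M) ->
  `|\sum_i \sum_j a 0 i * b 0 j * D i j| <= M * (norm1 a * norm1 b).
Proof.
move=> DM; apply: le_trans (ler_norm_sum _ _ _) _.
rewrite [X in _ * (X * _)]/norm1 mulr_suml mulr_sumr; apply: ler_sum => i _.
apply: le_trans (ler_norm_sum _ _ _) _.
rewrite mulrA mulr_sumr; apply: ler_sum => j _.
rewrite !normrM mulrC; have := DM i j; have ai := normr_ge0 (a 0 i); have bj := normr_ge0 (b 0 j).
by move=> DM'; rewrite -mulrA ler_wpM2r// mulr_ge0.
Qed.

Lemma hess_bounds : exists al C, [/\ 0 < al, 0 <= C &
  forall x p xi pi, box B p ->
    al * sq pi - C * sq xi <= hess x p xi pi <= C * (sq xi + sq pi)].
Proof.
have [M M0 MP] := dpart2_bounded.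
have dper k l : periodicH (dpart (dpart F k) l).
  by apply: dpart_periodic; exact: dpart_periodic.
have dcont k l : continuous (fun z : vec * vec => dpart (dpart F k) l z.1 z.2).
  exact: (dFC1 k l.1 l.2).2.
pose Q x p (w : vec) :=
  \sum_i \sum_j w 0 i * w 0 j * dpart (dpart F (false, i)) (false, j) x p.
have [al al0 alP] : exists2 al, 0 < al & forall x p w, box B p -> al * sq w <= Q x p w.
  apply: (@periodic_posdef_bound _ _ Q B B0).
  - move=> x p w k kZ; apply: eq_bigr => i _; apply: eq_bigr => j _.
    by rewrite dper.
  - move=> z; apply: cvg_big => [|i _]; first exact: add_continuous.
    apply: cvg_big => [|j _]; first exact: add_continuous.
    have c1 (k : 'I_n) : (fun y : (vec * vec) * vec => y.2 0 k) y @[y --> z] --> (z.2 : vec) 0 k.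
      apply: (@cvg_comp _ _ _ snd (fun v : vec => v 0 k) _ _ _ (@snd_continuous _ _ z)).
      exact: coord_continuous.
    apply: cvgM; first by apply: cvgM; exact: c1.
    apply: (@cvg_comp _ _ _ fst (fun z : vec * vec => dpart (dpart F (false, i)) (false, j) z.1 z.2)
      _ _ _ (@fst_continuous _ _ z)).
    exact: dcont.
  - by move=> x p w w0; rewrite /Q -Hpp_form; exact: Fpos.
  - move=> x p w a; rewrite /Q mulr_sumr; apply: eq_bigr => i _.
    by rewrite mulr_sumr; apply: eq_bigr => j _; rewrite !mxE; ring.
pose N : R := n%:R + 1.
have N0 : 0 < N by rewrite ltr_wpDl.
(* Weight in Young's inequality for the mixed block: as [t * N = al / 2], the cross terms consume
   half of the convexity, and the rest, with factor [M ^+ 2 / t], is charged to [xi]. *)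
pose t := al / (2 * N).
have t0 : 0 < t by rewrite divr_gt0// mulr_gt0.
pose C1 := (M + M ^+ 2 / t) * N.
have C10 : 0 <= C1.
  by rewrite mulr_ge0 ?(ltW N0)// addr_ge0// mulr_ge0 ?sqr_ge0// invr_ge0 ltW.
have C20 : 0 <= 4 * M * N by rewrite !mulr_ge0// ltW.
exists (al / 2), (C1 + 4 * M * N); split=> [||x p xi pi pB]; first by rewrite divr_gt0.
  by rewrite addr_ge0.
set X := norm1 xi; set P := norm1 pi.
have X0 : 0 <= X by exact: norm1_ge0.
have P0 : 0 <= P by exact: norm1_ge0.
have XN : X ^+ 2 <= N * sq xi.
  by apply: le_trans (sqr_norm1_le _) _; rewrite ler_wpM2r ?sq_ge0// lerDl.
have PN : P ^+ 2 <= N * sq pi.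
  by apply: le_trans (sqr_norm1_le _) _; rewrite ler_wpM2r ?sq_ge0// lerDl.
have sx := sq_ge0 xi; have sp := sq_ge0 pi.
apply/andP; split.
  have h0 := alP x p pi pB.
  pose S1 := \sum_i \sum_j xi 0 i * xi 0 j * dpart (dpart F (true, i)) (true, j) x p.
  pose S2 := \sum_i \sum_j xi 0 i * pi 0 j *
    (dpart (dpart F (true, i)) (false, j) x p + dpart (dpart F (false, j)) (true, i) x p).
  have hs : hess x p xi pi = Q x p pi + (S1 + S2).
    exact: (coef_quad_split xi pi (fun k l => dpart (dpart F k) l x p)).
  have h1 : `|S1| <= M * (X * X) by apply: sum2_le => i j; exact: MP.
  have h2 : `|S2| <= (2 * M) * (X * P).
    apply: sum2_le => i j; apply: le_trans (ler_normD _ _) _.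
    by rewrite mulr_natl mulr2n lerD// MP.
  rewrite hs; move: (Q x p pi) S1 S2 h0 h1 h2 {hs} => q S1 S2 h0.
  rewrite !ler_norml => /andP[h1 _] /andP[h2 _].
  have h3 : (2 * M) * (X * P) <= t * P ^+ 2 + M ^+ 2 / t * X ^+ 2.
    have : 0 <= (t * P - M * X) ^+ 2 / t by rewrite divr_ge0 ?sqr_ge0// ltW.
    have -> : (t * P - M * X) ^+ 2 / t = t * P ^+ 2 + M ^+ 2 / t * X ^+ 2 - 2 * M * (X * P).
      by field; rewrite gt_eqF.
    by rewrite subr_ge0.
  have h4 : t * P ^+ 2 <= al / 2 * sq pi.
    apply: le_trans (ler_wpM2l (ltW t0) PN) _.
    by rewrite mulrA; have -> : t * N = al / 2 by rewrite /t; field; rewrite gt_eqF.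
  have h5 : (M + M ^+ 2 / t) * X ^+ 2 <= C1 * sq xi.
    rewrite /C1 -mulrA ler_wpM2l// addr_ge0// mulr_ge0 ?sqr_ge0// invr_ge0 ltW//.
  have h6 : 0 <= 4 * M * N * sq xi by rewrite mulr_ge0.
  move: h1 h2 h3 h4 h5 h6 h0; rewrite mulrDl -[X * X]expr2; lra.
have : `|hess x p xi pi| <= M * ((X + P) * (X + P)).
  rewrite /hess; apply: le_trans (ler_norm_sum _ _ _) _.
  rewrite -{1}/(norm1 xi) -/X -/P mulrCA.
  have -> : (X + P) * (M * (X + P)) = \sum_k `|coef xi pi k| * (M * (X + P)).
    by rewrite -mulr_suml sum_coef_abs.
  apply: ler_sum => k _; rewrite normrM ler_wpM2l//.
  apply: le_trans (ler_norm_sum _ _ _) _; rewrite -sum_coef_abs mulr_sumr.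
  by apply: ler_sum => l _; rewrite normrM mulrC ler_wpM2r// MP.
rewrite ler_norml => /andP[_]; move/le_trans; apply.
have h1 : M * ((X + P) * (X + P)) <= M * (2 * X ^+ 2 + 2 * P ^+ 2).
  by rewrite ler_wpM2l//; have := sqr_ge0 (X - P); rewrite !expr2; nra.
have h2 : M * (2 * X ^+ 2 + 2 * P ^+ 2) <= M * (2 * (N * sq xi) + 2 * (N * sq pi)).
  by rewrite ler_wpM2l//; lra.
have h3 : 0 <= C1 * (sq xi + sq pi) by rewrite mulr_ge0// addr_ge0.
have h4 : 0 <= M * N * (sq xi + sq pi).
  by rewrite mulr_ge0 ?addr_ge0// mulr_ge0// ltW.
nra.
Qed.

(** The form in which convexity enters everything below. The two variables play different roles:
    moving [p] yields a definite gain, moving [x] a loss that the barriers must pay. Boxes are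
    convex, so the segment between the momenta stays where the constants hold. *)
Lemma taylor_bounds : exists al C, [/\ 0 < al, 0 <= C &
  forall x p xi pi, box B p -> box B (p + pi) ->
    let L := F x p + dot (Hx F x p) xi + dot (Hp F x p) pi in
    L + al * sq pi - C * sq xi <= F (x + xi) (p + pi) <= L + C * (sq xi + sq pi)].
Proof.
have [al [C [al0 C0 hP]]] := hess_bounds.
exists (al / 2), (C / 2); split; [by rewrite divr_gt0|by rewrite divr_ge0|].
move=> x p xi pi pB qB; cbv zeta; set L := F x p + dot _ _ + dot _ _.
have hb t : 0 <= t <= 1 -> al * sq pi - C * sq xi <= hess (x + t *: xi) (p + t *: pi) xi pi
    <= C * (sq xi + sq pi).
  by move=> t01; apply: hP; exact: box_segment.
pose g (t : R) := F (x + t *: xi) (p + t *: pi).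
pose g1 (t : R) := dot (Hx F (x + t *: xi) (p + t *: pi)) xi +
                   dot (Hp F (x + t *: xi) (p + t *: pi)) pi.
have dg (t : R) : is_derive t 1 g (g1 t) by exact: is_derive_line.
have dg1 (t : R) : is_derive t 1 g1 (hess (x + t *: xi) (p + t *: pi) xi pi).
  exact: is_derive_grad_line.
have e0 : g 0 + g1 0 = L by rewrite /g /g1 !scale0r !addr0 addrA.
have e1 : g 1 = F (x + xi) (p + pi) by rewrite /g !scale1r.
have lo := @taylor2_ge g g1 _ (al * sq pi - C * sq xi) dg dg1
  (fun t t01 => proj1 (andP (hb t t01))).
have hi := @taylor2_ge (- g) (- g1) (fun t => - hess (x + t *: xi) (p + t *: pi) xi pi)
  (- (C * (sq xi + sq pi))) (fun t => is_deriveN (dg t)) (fun t => is_deriveN (dg1 t)).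
have {}hi : - g 0 - g1 0 - (C * (sq xi + sq pi)) / 2 <= - g 1.
  by rewrite -mulNr; apply: hi => t t01; rewrite lerN2; case/andP: (hb t t01).
rewrite -e1 -e0; move: lo hi; move: (g 0) (g1 0) (g 1) => a b c'; lra.
Qed.

End SecondOrder.

(** * Global flows of Lipschitz vector fields *)

Section Picard.
Context {R : realType}.

Lemma primitive_right (g : R -> R) (a : R) : continuous g ->
  exists G : R -> R, forall t : R, a < t -> is_derive t 1 G (g t).
Proof.
move=> gc; exists (fun t => \int[lebesgue_measure]_(x in `[a, t]) g x)%R => t ta.
have [||||d dE] := @continuous_FTC1 R g (BLeft a) t (t + 1).
- by rewrite ltrDl.
- apply: continuous_compact_integrable; first exact: segment_compact.
  exact: continuous_subspaceT.
- by rewrite lte_fin.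
- exact: gc.
- by apply: (DeriveDef d); rewrite -derive1E; exact: dE.
Qed.

Lemma eq_derive_eq (f g df : R -> R) (a b : R) : a <= b ->
  (forall x : R, a <= x <= b -> is_derive x 1 f (df x)) ->
  (forall x : R, a <= x <= b -> is_derive x 1 g (df x)) -> f b - f a = g b - g a.
Proof.
move=> ab fd gd.
have le f' g' : (forall x : R, a <= x <= b -> is_derive x 1 f' (df x)) ->
    (forall x : R, a <= x <= b -> is_derive x 1 g' (df x)) -> f' a - g' a <= f' b - g' b.
  move=> fd' gd'; have := @derive_ge0_le _ (f' - g') (fun=> 0) a b ab; apply => //.
  by move=> x xab; rewrite -(subrr (df x)); apply: is_deriveB; [exact: fd'|exact: gd'].
by have := le _ _ fd gd; have := le _ _ gd fd; lra.
Qed.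

(** Integrals with base point [a] are controlled only to the right of [a]. Normalised to vanish at
    [0], those with different negative base points agree on their common range, so the base point
    may move with [t]. *)
Lemma primitive (g : R -> R) : continuous g ->
  exists G : R -> R, G 0 = 0 /\ forall t : R, is_derive t 1 G (g t).
Proof.
move=> gc.
have /choice[F FP] a : exists G : R -> R, forall t : R, a < t -> is_derive t 1 G (g t).
  exact: primitive_right.
pose G a t := F a t - F a 0.
have GE a b t : a < 0 -> b < 0 -> a < t -> b < t -> G a t = G b t.
  move=> a0 b0 at_ bt; rewrite /G; have [t0|t0] := leP 0 t.
    apply: (@eq_derive_eq (F a) (F b) g) => // x /andP[x0 _]; apply: FP;
    exact: lt_le_trans x0.
  suff : F a 0 - F a t = F b 0 - F b t by lra.
  apply: (@eq_derive_eq (F a) (F b) g t 0 (ltW t0)) => x /andP[x0 _]; apply: FP;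
    exact: lt_le_trans x0.
exists (fun t => G (- (`|t| + 1)) t); split; first by rewrite /G subrr.
move=> t.
have t0 := normr_ge0 t.
(* One fixed base point, far enough to the left, replaces the moving one for all [s] within distance
   one of [t]. *)
have : is_derive t 1 (G (- (`|t| + 3))) (g t).
  have -> : G (- (`|t| + 3)) = F (- (`|t| + 3)) - cst (F (- (`|t| + 3)) 0) by [].
  rewrite -[g t]subr0; apply: is_deriveB.
  by apply: FP; have := ler_norm (- t); rewrite normrN; lra.
apply: near_eq_is_derive.
near=> s.
have st : `|s - t| < 1.
  near: s; apply/nbhs_ballP; exists 1; first exact: ltr01.
  by move=> s; rewrite -ball_normE /= distrC.
have s0 := normr_ge0 s.
have := ler_norm s; have := ler_norm (- s); have := ler_norm t; have := ler_norm (- t).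
rewrite !normrN => h1 h2 h3 h4.
have h5 : `|s| <= `|t| + 1.
  by rewrite -(subrK t s); apply: le_trans (ler_normD _ _) _; lra.
by apply: GE => //; rewrite ltrNl; lra.
Unshelve. all: by end_near. Qed.

Lemma half_pow_small (C e : R) : 0 < e -> exists k, C / 2 ^+ k <= e.
Proof.
move=> e0; exists (Num.bound (C / e)).
set k := Num.bound _.
have Ck : C / e < k%:R.
  apply: le_lt_trans (ler_norm _) _; have := archi_boundP (normr_ge0 (C / e)).
  by rewrite /k /Num.bound normr_id.
rewrite ler_pdivrMr ?exprn_gt0// mulrC -ler_pdivrMr//; apply: ltW.
apply: (lt_le_trans Ck); rewrite -natrX ler_nat; exact/ltnW/ltn_expl.
Qed.

(** * Picard iteration in a weighted norm on the whole line *)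

Section Solution.
Variables (J : finType) (f : (J -> R) -> J -> R) (L : R) (z0 : J -> R).
Hypothesis L0 : 0 < L.
Hypothesis fL : forall z w e, (forall j, `|z j - w j| <= e) ->
  forall j, `|f z j - f w j| <= L * e.

(** Bielecki weight: its primitive satisfies [|W| <= w / (2 * L)], so applying the field and
    integrating halves errors measured in units of [w], for all times at once and in both
    directions. *)
Let w (t : R) := expR (2 * L * t) + expR (- (2 * L) * t).
Let W (t : R) := (expR (2 * L * t) - expR (- (2 * L) * t)) / (2 * L).

Let L20 : 0 < 2 * L. Proof. by rewrite mulr_gt0. Qed.

Lemma is_derive_expRM (a t : R) : is_derive t 1 (fun t => expR (a * t)) (a * expR (a * t)).
Proof.
have h : is_derive t 1 (a *: (id : R -> R)) a.
  by apply: is_derive_eq; rewrite /GRing.scale /= mulr1.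
rewrite [X in is_derive _ _ _ X]mulrC.
exact: (@is_derive1_comp R expR (a *: id) t _ _ (is_derive_expR _) h).
Qed.

Let dW (t : R) : is_derive t 1 W (w t).
Proof.
have -> : W = (2 * L)^-1 *: ((fun t => expR (2 * L * t)) - (fun t => expR (- (2 * L) * t))).
  by apply/funext => s; rewrite /W mulrC.
have d1 := is_derive_expRM (2 * L) t; have d2 := is_derive_expRM (- (2 * L)) t.
by apply: is_derive_eq; rewrite /w /GRing.scale /=; field; rewrite gt_eqF.
Qed.

Let w_gt0 t : 0 < w t. Proof. by rewrite addr_gt0// expR_gt0. Qed.

Let W_le t : `|W t| <= w t / (2 * L).
Proof.
rewrite /W normrM normfV (gtr0_norm L20) ler_wpM2r ?invr_ge0 ?(ltW L20)//.
by apply: le_trans (ler_normB _ _) _; rewrite !gtr0_norm ?expR_gt0.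
Qed.

Let primitive_bound (G g : R -> R) c : G 0 = 0 -> 0 <= c ->
  (forall t : R, is_derive t 1 G (g t)) -> (forall t, `|g t| <= c * w t) ->
  forall t, `|G t| <= c / (2 * L) * w t.
Proof.
move=> G0 c0 dG gw t.
have W0 : W 0 = 0 by rewrite /W !mulr0 subrr mul0r.
have mono H h : (forall t : R, is_derive t 1 H (h t)) -> (forall t, `|h t| <= c * w t) ->
    forall a b, a <= b -> c * W a + H a <= c * W b + H b.
  move=> dH hw a b ab.
  have := @derive_ge0_le _ (c *: W + H) (fun t => c * w t + h t) a b ab; apply.
    by move=> x _; apply: is_deriveD; exact: (@is_deriveZ _ _ _ W c x 1 _ (dW x)).
  by move=> x _; have := hw x; rewrite ler_norml => /andP[]; lra.
have m1 := mono G g dG gw.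
have m2 := mono (- G) (fun t => - g t) (fun t => is_deriveN (dG t)).
have {}m2 := m2 (fun t => ltac:(rewrite normrN; exact: gw)).
have := W_le t; rewrite ler_norml => /andP[w1 w2].
have cW1 : c * W t <= c * (w t / (2 * L)) by rewrite ler_wpM2l.
have cW2 : c * - (w t / (2 * L)) <= c * W t by rewrite ler_wpM2l.
have -> : c / (2 * L) * w t = c * (w t / (2 * L)) by rewrite mulrAC mulrA.
rewrite ler_norml.
have [t0|t0] := leP 0 t.
  by have := m1 _ _ t0; have := m2 _ _ t0; rewrite !fctE G0 W0; lra.
by have := m1 _ _ (ltW t0); have := m2 _ _ (ltW t0); rewrite !fctE G0 W0; lra.
Qed.

Let field_continuous (Z : R -> J -> R) : (forall j, continuous (fun t => Z t j)) ->
  forall j, continuous (fun t => f (Z t) j).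
Proof.
move=> Zc j t; apply/cvgrPdist_le => e e0.
near=> s.
have -> : e = L * (e / L) by field; rewrite gt_eqF.
apply: fL; near: s; apply: filter_forall => i.
by have /cvgrPdist_le/(_ _ (divr_gt0 e0 L0)) := Zc i t.
Unshelve. all: by end_near. Qed.

Theorem picard : exists Z : R -> J -> R, (forall j, Z 0 j = z0 j) /\
  forall (t : R) j, is_derive t 1 (fun s => Z s j) (f (Z t) j).
Proof.
(* The choice is made total: the value returned for a discontinuous [g] is a default that the
   iteration never meets. *)
have /choice[prim primP] (g : R -> R) : exists G : R -> R, continuous g ->
    G 0 = 0 /\ forall t : R, is_derive t 1 G (g t).
  have [gc|ngc] := pselect (continuous g); last by exists g.
  by have [G GP] := primitive gc; exists G.
pose fix Zs k : R -> J -> R :=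
  if k is k'.+1 then fun t j => z0 j + prim (fun s => f (Zs k' s) j) t else fun _ => z0.
have Zsc k j : continuous (fun t => Zs k t j).
  elim: k j => [|k IHk] j t; first exact: cst_continuous.
  apply: cvgD; first exact: cvg_cst.
  have [_ /(_ t) d] := primP _ (field_continuous IHk (j := j)).
  exact: is_derive_continuous d.
have fc k j := field_continuous (Zsc k) (j := j).
have dZs k j (t : R) : is_derive t 1 (fun t => Zs k.+1 t j) (f (Zs k t) j).
  have [_ d] := primP _ (fc k j); rewrite -[f _ _]add0r.
  exact: is_deriveD.
have Zs0 k j : Zs k 0 j = z0 j.
  by case: k => [//|k] /=; have [-> _] := primP _ (fc k j); rewrite addr0.
pose D := \sum_j `|f z0 j|.
have fD j : `|f z0 j| <= D.
  by rewrite /D (bigD1 j)//= lerDl sumr_ge0.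
have D0 : 0 <= D by rewrite sumr_ge0.
have w1 t : 1 <= w t.
  have [t0|t0] := leP 0 t.
    have : 1 <= expR (2 * L * t) by rewrite -[X in X <= _]expR0 ler_expR; apply: mulr_ge0 => //; exact: ltW.
    by have := expR_gt0 (- (2 * L) * t); rewrite /w; lra.
  have : 1 <= expR (- (2 * L) * t) by rewrite -[X in X <= _]expR0 ler_expR mulNr oppr_ge0; apply: mulr_ge0_le0; exact: ltW.
  by have := expR_gt0 (2 * L * t); rewrite /w; lra.
pose E := D / (2 * L).
have E0 : 0 <= E by apply: divr_ge0 => //; exact: ltW.
have step k t j : `|Zs k.+1 t j - Zs k t j| <= E / 2 ^+ k * w t.
  elim: k t j => [|k IHk] t j.
    rewrite expr0 divr1.
    apply: (@primitive_bound (fun t => Zs 1 t j - Zs 0 t j) (fun=> f z0 j) D) => //.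
    - by rewrite !Zs0 subrr.
    - move=> s; rewrite -[f _ _]subr0; apply: is_deriveB; exact: is_derive_cst.
    - by move=> s; apply: le_trans (fD j) _; rewrite ler_peMr.
  have -> : E / 2 ^+ k.+1 = (L * (E / 2 ^+ k)) / (2 * L).
    by rewrite exprS; field; rewrite expf_neq0 ?pnatr_eq0//= gt_eqF.
  apply: (@primitive_bound (fun t => Zs k.+2 t j - Zs k.+1 t j)
    (fun t => f (Zs k.+1 t) j - f (Zs k t) j)).
  - by rewrite !Zs0 subrr.
  - by rewrite mulr_ge0 ?(ltW L0)// divr_ge0// exprn_ge0.
  - by move=> s; rewrite -mulrA; apply: fL => i; exact: IHk.
(* The radius is the sum of all remaining step bounds, so the intervals from [lo] to [hi] are
   nested, and the supremum of their left ends is a limit with an explicit rate. *)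
pose lo k t j := Zs k t j - 2 * E / 2 ^+ k * w t.
pose hi k t j := Zs k t j + 2 * E / 2 ^+ k * w t.
have pow k : 2 * E / 2 ^+ k.+1 = E / 2 ^+ k.
  by rewrite exprS; field; rewrite expf_neq0.
have pow' k : 2 * E / 2 ^+ k = 2 * (E / 2 ^+ k) by rewrite mulrA.
have Ek k t : 0 <= E / 2 ^+ k * w t.
  by rewrite mulr_ge0 ?(ltW (w_gt0 t))// divr_ge0// exprn_ge0.
have lo_S k t j : lo k t j <= lo k.+1 t j.
  by rewrite /lo pow pow'; have := step k t j; rewrite ler_norml => /andP[]; lra.
have hi_S k t j : hi k.+1 t j <= hi k t j.
  by rewrite /hi pow pow'; have := step k t j; rewrite ler_norml => /andP[]; lra.
have lohi k t j : lo k t j <= hi k t j.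
  by rewrite /lo /hi pow'; have := Ek k t; lra.
have lo_add k m t j : lo k t j <= lo (k + m)%N t j.
  by elim: m => [|m IH]; rewrite ?addn0// addnS (le_trans IH).
have hi_add k m t j : hi (k + m)%N t j <= hi k t j.
  by elim: m => [|m IH]; rewrite ?addn0// addnS (le_trans (hi_S _ _ _)).
have lo_hi k m t j : lo k t j <= hi m t j.
  apply: le_trans (lo_add k m t j) _; apply: le_trans (lohi _ _ _) _.
  by rewrite addnC hi_add.
pose Z t j := sup [set lo k t j | k in [set: nat]].
have ZP k t j : `|Z t j - Zs k t j| <= 2 * E / 2 ^+ k * w t.
  have h1 : lo k t j <= Z t j.
    apply: ub_le_sup; last by exists k.
    by exists (hi 0%N t j) => _ [m _ <-].
  have h2 : Z t j <= hi k t j.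
    apply: ge_sup; first by exists (lo 0%N t j); exists 0%N.
    by move=> _ [m _ <-].
  by move: h1 h2; rewrite /lo /hi ler_norml => h1 h2; apply/andP; split; lra.
have wc : continuous w.
  move=> t; apply: cvgD; exact: is_derive_continuous (is_derive_expRM _ _).
have Zc j : continuous (fun t => Z t j).
  move=> t; apply/cvgrPdist_le => e e0.
  have [k kP] := half_pow_small (2 * E * (2 * w t + 1)) (divr_gt0 e0 (ltr0n _ 2)).
  have e20 : 0 < e / 2 by rewrite divr_gt0.
  near=> s.
  have c1 : `|Zs k t j - Zs k s j| <= e / 2.
    by near: s; have /cvgrPdist_le/(_ _ e20) := Zsc k j t.
  have c2 : `|w t - w s| <= 1 by near: s; have /cvgrPdist_le/(_ _ ltr01) := wc t.
  have -> : Z t j - Z s j = (Z t j - Zs k t j) + (Zs k t j - Zs k s j) - (Z s j - Zs k s j).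
    by ring.
  apply: le_trans (ler_normB _ _) _; apply: le_trans (lerD (ler_normD _ _) (lexx _)) _.
  have := ZP k t j; have := ZP k s j.
  have : 2 * E / 2 ^+ k * w s <= 2 * E / 2 ^+ k * (w t + 1).
    apply: ler_wpM2l; first by rewrite pow' mulr_ge0// divr_ge0// exprn_ge0.
    by move: c2; rewrite ler_norml => /andP[]; lra.
  have : 2 * E * (2 * w t + 1) / 2 ^+ k = 2 * E / 2 ^+ k * (w t + 1) + 2 * E / 2 ^+ k * w t.
    by ring.
  lra.
have fZc j := field_continuous Zc (j := j).
have ZE t j : Z t j = z0 j + prim (fun s => f (Z s) j) t.
  have [P0 dP] := primP _ (fZc j).
  set Y := _ + _.
  have close k : `|Zs k.+1 t j - Y| <= L * (2 * E / 2 ^+ k) / (2 * L) * w t.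
    apply: (@primitive_bound (fun t => Zs k.+1 t j - (z0 j + prim (fun s => f (Z s) j) t))
      (fun t => f (Zs k t) j - f (Z t) j)).
    - by rewrite Zs0 P0 addr0 subrr.
    - by rewrite pow' mulr_ge0 ?(ltW L0)// mulr_ge0// divr_ge0// exprn_ge0.
    - move=> s.
      have dY : is_derive s 1 (fun t => z0 j + prim (fun s => f (Z s) j) t) (f (Z s) j).
        by rewrite -[f _ _]add0r; apply: is_deriveD; exact: is_derive_cst.
      exact: (@is_deriveB _ _ _ (fun t => Zs k.+1 t j) _ s 1 _ _ (dZs _ _ _) dY).
    - move=> s; rewrite -(mulrA L); apply: fL => i; rewrite distrC; exact: ZP.
  have bound k : `|Z t j - Y| <= 2 * E * w t / 2 ^+ k.
    have := close k; have := ZP k.+1 t j.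
    have -> : Z t j - Y = (Z t j - Zs k.+1 t j) + (Zs k.+1 t j - Y) by ring.
    rewrite pow.
    have -> : L * (2 * E / 2 ^+ k) / (2 * L) * w t = E / 2 ^+ k * w t.
      by field; rewrite expf_neq0 ?pnatr_eq0//= gt_eqF.
    have -> : 2 * E * w t / 2 ^+ k = E / 2 ^+ k * w t + E / 2 ^+ k * w t by ring.
    by move=> h1 h2; apply: le_trans (ler_normD _ _) _; rewrite lerD.
  apply/eqP; rewrite -subr_eq0 -normr_le0; apply/ler_addgt0Pr => e e0.
  by have [k kP] := half_pow_small (2 * E * w t) e0; rewrite add0r (le_trans (bound k)).
exists Z; split=> [j|t j].
  by rewrite ZE; have [-> _] := primP _ (fZc j); rewrite addr0.
have [_ dP] := primP _ (fZc j).
have -> : (fun s => Z s j) = cst (z0 j) + prim (fun s => f (Z s) j).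
  by apply/funext => s; rewrite ZE.
by rewrite -[f _ _]add0r; apply: is_deriveD.
Unshelve. all: by end_near. Qed.

End Solution.
End Picard.

(** * Calibrated characteristics *)

(** The contradiction at a maximum of [v] minus the upper barrier. [Q] is the squared distance to
    the displaced vertex. Convexity yields [4 * al * K ^+ 2 * Q]; Young's inequality for the
    velocity of the displacement takes half of it, and [C <= al * K ^+ 2] lets the other half pay
    [2 * C * Q]. What remains in terms of the displacement is covered by [be]. *)
Lemma barrier_arith (R : realFieldType)
    (eps al C K Q F0 Fy gx ge fe f px pe ee sxi sdx sxe be dbe ac y d : R) :
  0 < eps -> 0 <= K -> 0 <= Q -> 0 <= C -> C <= al * K ^+ 2 -> 0 <= d ->
  F0 + (gx + ge) + 2 * K * fe + al * ((2 * K) ^+ 2 * Q) - C * sxe <= Fy ->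
  0 <= - (f + dbe + (- gx - eps * px + (- ge - eps * pe) - f) + K * (- (2 * (fe + ee)))) ->
  2 * (K * ee) <= 2 * al * (K ^+ 2 * Q) + (2 * al)^-1 * sdx ->
  2 * C * sxi + (2 * al)^-1 * sdx <= dbe + eps * be ->
  sxe <= 2 * sxi + 2 * Q -> eps * ac = - F0 ->
  d < y - (ac + be + (px + pe) + K * Q) -> eps * y + Fy <= 0 -> False.
Proof.
move=> eps0 K0 Q0 C0 KC d0 T nS yo bg sx ea f1 eq.
have h1 : 0 < eps * (y - (ac + be + (px + pe) + K * Q)).
  by rewrite mulr_gt0//; exact: le_lt_trans f1.
have h2 : C * Q <= al * K ^+ 2 * Q by rewrite ler_wpM2r.
have h3 : 0 <= eps * (K * Q) by rewrite !mulr_ge0// ltW.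
have h4 : C * sxe <= C * (2 * sxi + 2 * Q) by rewrite ler_wpM2l.
move: (2 * al)^-1 yo bg => ial yo bg.
by clear - ea T nS yo bg eq h1 h2 h3 h4; lra.
Qed.

(** The contradiction at a minimum of [v] minus the lower barrier. Only the upper Taylor bound is of
    use here; its error [C * (1 + 4 * K ^+ 2) * Q] is paid by the rate [A] at which the opening
    grows, and the slack [de] survives discounting because [eps * th <= 1 / 2]. *)
Lemma lower_barrier_arith (R : realFieldType)
    (eps C A K Q F0 Fy ge fe f pe ac y de th : R) :
  0 < eps -> 0 <= K -> 0 <= Q -> 0 < de -> C * (1 + 4 * K ^+ 2) <= A -> eps * th <= 1 / 2 ->
  Fy <= F0 + ge + - (2 * K) * fe + C * (Q + (- (2 * K)) ^+ 2 * Q) ->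
  0 <= f - de + (- ge - eps * pe - f) - (A * Q - 2 * K * fe) ->
  eps * ac = - F0 ->
  y - (ac + de * th + pe - K * Q) <= 0 -> 0 <= eps * y + Fy -> False.
Proof.
move=> eps0 K0 Q0 de0 AC th1 T nS ea f1 eq.
have h1 : eps * (y - (ac + de * th + pe - K * Q)) <= 0.
  by rewrite pmulr_rle0.
have h2 : C * (1 + 4 * K ^+ 2) * Q <= A * Q by rewrite ler_wpM2r.
have h3 : 0 <= eps * (K * Q) by rewrite !mulr_ge0// ltW.
have h4 : de * (eps * th) <= de * (1 / 2) by rewrite ler_wpM2l// ltW.
by clear - ea T nS eq h1 h2 h3 h4 de0; lra.
Qed.

Section Core.
Context {R : realType} {n : nat}.
Notation vec := 'rV[R]_n.
Variables (F : vec -> vec -> R) (v : vec -> R) (eps V r0 B al C speed : R).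
Hypotheses (eps0 : 0 < eps) (vc : continuous v) (vV : forall y, `|v y| <= V).
Hypothesis Fsub : forall y p K,
  (forall z, v z <= v y + dot p (z - y) + K * sq (z - y)) -> eps * v y + F y p <= 0.
Hypothesis Fsup : forall y p K,
  (forall z, v y + dot p (z - y) - K * sq (z - y) <= v z) -> 0 <= eps * v y + F y p.
Hypothesis coercive : forall y p, F y p <= eps * V -> sq p <= r0.
(** Upper paraboloids have squared slope at most [r0] by coercivity, lower ones at most [4 * r0].
    The margin [1] keeps a curve starting at such a slope in the box for a time [speed^-1]. *)
Hypotheses (B1 : 1 <= B) (r0B : 4 * r0 <= (B - 1) ^+ 2).
Hypotheses (al0 : 0 < al) (C0 : 0 <= C) (speed0 : 0 < speed).
Hypothesis FC1 : C1_2 F.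
Hypothesis taylor : forall x p xi pi, box B p -> box B (p + pi) ->
  let L := F x p + dot (Hx F x p) xi + dot (Hp F x p) pi in
  L + al * sq pi - C * sq xi <= F (x + xi) (p + pi) <= L + C * (sq xi + sq pi).

(* Only the speed of P is controlled while P is outside the box, so that flows of
   the clamped field qualify. *)
Definition sol (X P : R -> vec) := forall s, exists VX VP,
  [/\ vder X s VX, vder P s VP, forall i, `|VP 0 i| <= speed &
   box B (P s) -> VX = Hp F (X s) (P s) /\ VP = - Hx F (X s) (P s) - eps *: P s].

Hypothesis flow : forall x p, exists X P, [/\ sol X P, X 0 = x & P 0 = p].

(** Proximal subgradient, with its constant explicit because the length of the calibrated time step
    is computed from it. *)
Definition prox (K : R) (x p : vec) :=
  forall z, v x + dot p (z - x) - K * sq (z - x) <= v z.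

(** * Slope bounds for touching paraboloids *)

Lemma V_ge0 : 0 <= V. Proof. exact: le_trans (normr_ge0 _) (vV 0). Qed.

Lemma v_le y : v y <= V. Proof. exact: le_trans (ler_norm _) (vV y). Qed.

Lemma v_ge y : - V <= v y.
Proof. by have := vV y; rewrite ler_norml => /andP[]. Qed.

Lemma upper_grad y p K :
  (forall z, v z <= v y + dot p (z - y) + K * sq (z - y)) -> sq p <= r0.
Proof.
move=> /Fsub h; apply: (@coercive y).
by have := ler_wpM2l (ltW eps0) (v_ge y); rewrite mulrN; lra.
Qed.

Lemma r0_ge0 : 0 <= r0.
Proof.
have [s [y [_ yP]]] := @barrier_max R n v V 1 0 0 (cst 0) (cst 1) (cst 0) (cst 0) (cst 0)
  (lexx 0) ltr01 vc vV (@cst_continuous _ _ _) (@cst_continuous _ _ _)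
  (@cst_continuous _ _ _) (@cst_continuous _ _ _) (@cst_continuous _ _ _)
  (fun s _ => lexx 1).
apply: le_trans (sq_ge0 (2 *: y)) _; apply: (@upper_grad y _ 1) => z.
have := yP 0 z; rewrite lexx /cst /= !dot0l !subr0 => /(_ isT).
have -> : sq z = sq y + 2 * dot y (z - y) + sq (z - y) by rewrite -sqD addrC subrK.
by rewrite dotZl; lra.
Qed.

Lemma peak w e : 0 < e -> exists2 N0, 0 < N0 &
  forall N, N0 <= N -> forall z, v z - N * sq (z - w) <= v w + e.
Proof.
move=> e0; have /cvgrPdist_le/(_ _ e0)/nbhs_ballP[d /= d0 dP] := @vc w.
have d2 : 0 < (d / 2) ^+ 2 by rewrite exprn_gt0// divr_gt0.
exists ((2 * V + 1) / (d / 2) ^+ 2).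
  by rewrite divr_gt0// ltr_wpDl// mulr_ge0// V_ge0.
move=> N; rewrite ler_pdivrMr// => NN z.
have N0 : 0 < N.
  by rewrite -(pmulr_lgt0 _ d2); apply: lt_le_trans NN; rewrite ltr_wpDl// mulr_ge0// V_ge0.
have s0 := sq_ge0 (z - w).
have [zw|zw] := leP (sq (z - w)) ((d / 2) ^+ 2); last first.
  have : N * (d / 2) ^+ 2 <= N * sq (z - w) by rewrite ler_wpM2l ?ltW.
  by have := v_le z; have := v_ge w; lra.
have : `|v w - v z| <= e.
  apply: dP; rewrite -ball_normE /ball_ /= distrC.
  apply: (@le_lt_trans _ _ (d / 2)); first by apply: norm_le_sq => //; rewrite ltW// divr_gt0.
  by move: d0; rewrite ltr_pdivrMr// mulrDr mulr1; lra.
rewrite ler_norml => /andP[h _].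
by have : 0 <= N * sq (z - w); [rewrite mulr_ge0// ltW|lra].
Qed.

Lemma sup_convolution (N : R) w : 0 < N -> exists2 y, 4 * N ^+ 2 * sq (y - w) <= r0 &
  forall z, v z - N * sq (z - w) <= v y - N * sq (y - w).
Proof.
move=> N0.
have [s [y [_ yP]]] := @barrier_max R n v V N 0 0 (cst 0) (cst N) (cst 0) (cst w) (cst w)
  (lexx 0) N0 vc vV (@cst_continuous _ _ _) (@cst_continuous _ _ _)
  (@cst_continuous _ _ _) (@cst_continuous _ _ _) (@cst_continuous _ _ _)
  (fun s _ => lexx N).
have {}yP z : v z - N * sq (z - w) <= v y - N * sq (y - w).
  by have := yP 0 z; rewrite lexx /cst /= !dot0l !add0r => /(_ isT).
exists y => //.
have -> : 4 * N ^+ 2 * sq (y - w) = sq ((2 * N) *: (y - w)) by rewrite sqZ; ring.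
apply: (@upper_grad y _ N) => z.
have := yP z.
have -> : sq (z - w) = sq (y - w) + 2 * dot (y - w) (z - y) + sq (z - y).
  by rewrite -sqD [_ + (z - y)]addrC addrA subrK.
by rewrite dotZl; lra.
Qed.

(** A Lipschitz bound in disguise (optimising over [N] gives the constant [sqrt (2 * r0)]), drawn
    from the subsolution property. Doubling the penalty [M] and moving to the new maximiser costs at
    most [r0 / (4 * M)]; these costs sum geometrically to [r0 / (2 * N)], and [peak] ends the
    iteration. *)
Lemma lipschitz_quad (N : R) z w : 0 < N -> v z - N * sq (z - w) <= v w + r0 / (2 * N).
Proof.
move=> N0.
have iter k : forall M, 0 < M -> forall z, exists y,
    v z - M * sq (z - w) <= v y - (2 ^+ k * M) * sq (y - w) + r0 / (2 * M).
  elim: k => [|k IHk] M M0 z'.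
    by exists z'; rewrite expr0 mul1r lerDl divr_ge0 ?r0_ge0// mulr_ge0// ltW.
  have [y y1 yP] := sup_convolution w M0.
  have M20 : 0 < 2 * M by rewrite mulr_gt0.
  have [y' y'P] := IHk (2 * M) M20 y.
  exists y'; have := yP z'; move: y'P.
  have -> : 2 ^+ k.+1 * M = 2 ^+ k * (2 * M) by rewrite exprS; ring.
  have -> : r0 / (2 * M) = r0 / (2 * (2 * M)) + r0 / (2 * (2 * M)).
    by field; rewrite gt_eqF.
  have : M * sq (y - w) <= r0 / (2 * (2 * M)).
    rewrite ler_pdivlMr ?mulr_gt0//; move: y1.
    have -> : M * sq (y - w) * (2 * (2 * M)) = 4 * M ^+ 2 * sq (y - w) by ring.
    by [].
  lra.
apply/ler_addgt0Pr => e e0.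
have [N0' N0'0 pk] := peak w e0.
have [k kP] := half_pow_small N0' N0.
have [y yP] := iter k N N0 z.
have := pk (2 ^+ k * N) _ y.
rewrite mulrC -ler_pdivrMr ?exprn_gt0// => /(_ kP).
rewrite mulrC; lra.
Qed.

(** The supersolution test gives no upper bound on slopes, so the Lipschitz bound is played against
    the paraboloid at [x + r *: p]. There the paraboloid rises by at least [3 / 4 * r * sq p], while
    the bound allows [r / 2 * sq p + r * r0]: hence the factor [4]. *)
Lemma prox_grad K x p : prox K x p -> sq p <= 4 * r0.
Proof.
move=> xp; pose K' := `|K| + 1.
have K'0 : 0 < K' by rewrite ltr_wpDl.
have KK' : K <= K' by rewrite /K'; have := ler_norm K; lra.
pose r := (4 * K')^-1.
have r_gt0 : 0 < r by rewrite invr_gt0 mulr_gt0.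
have := xp (x + r *: p).
have := @lipschitz_quad (2 * K') (x + r *: p) x (mulr_gt0 (ltr0n _ 2) K'0).
rewrite [x + _]addrC addrK dotZr sqZ -/(sq p).
have s0 := sq_ge0 p.
have -> : 2 * K' * (r ^+ 2 * sq p) = r / 2 * sq p by rewrite /r; field; rewrite gt_eqF.
have -> : r0 / (2 * (2 * K')) = r * r0 by rewrite /r; field; rewrite gt_eqF.
have : K * (r ^+ 2 * sq p) <= r / 4 * sq p.
  have -> : r / 4 * sq p = K' * (r ^+ 2 * sq p) by rewrite /r; field; rewrite gt_eqF.
  by rewrite ler_wpM2r// mulr_ge0// sqr_ge0.
move=> h1 h2 h3.
rewrite -(ler_pM2l r_gt0); have -> : r * sq p = 4 * (r / 4 * sq p) by field.
have e1 : r / 2 * sq p = 2 * (r / 4 * sq p) by field.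
have e2 : r * sq p = 4 * (r / 4 * sq p) by field.
by rewrite e1 in h2; rewrite e2 in h3; rewrite mulrCA; lra.
Qed.

Lemma small_box (p : vec) : sq p <= 4 * r0 -> box (B - 1) p.
Proof. by move=> p4; apply: sq_box; rewrite ?subr_ge0//; exact: le_trans p4 r0B. Qed.

Lemma box_sub (p : vec) : box (B - 1) p -> box B p.
Proof. by move=> pB i; apply: le_trans (pB i) _; rewrite gerBl. Qed.

(** * Comparison along a characteristic *)

Section Along.
Variables X P : R -> vec.
Hypothesis XP : sol X P.

Lemma sol_X_continuous : continuous X.
Proof. by move=> s; have [VX [VP [dX _ _ _]]] := XP s; exact: vder_continuous dX. Qed.

Lemma sol_P_continuous : continuous P.
Proof. by move=> s; have [VX [VP [_ dP _ _]]] := XP s; exact: vder_continuous dP. Qed.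

Lemma box_stay t s : box (B - 1) (P t) -> `|s - t| * speed <= 1 -> box B (P s).
Proof.
move=> Pt st i.
have /choice[dP dPP] s' : exists VP, vder P s' VP /\ forall i, `|VP 0 i| <= speed.
  by have [_ [VP [_ dP sp _]]] := XP s'; exists VP.
suff : `|P s 0 i - P t 0 i| <= `|s - t| * speed.
  move=> h; have := Pt i; rewrite -(subrK (P t 0 i) (P s 0 i)) => h'.
  by apply: le_trans (ler_normD _ _) _; lra.
have key a b : a <= b -> `|P b 0 i - P a 0 i| <= `|b - a| * speed.
  move=> ab; have [||c _ ->] := @MVT_segment R (fun t => P t 0 i) (fun t => dP t 0 i) a b ab.
  - by move=> x _; exact: (dPP x).1.
  - apply: continuous_subspaceT => x; exact: is_derive_continuous ((dPP x).1 i).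
  - by rewrite normrM mulrC ler_wpM2l// (dPP c).2.
have [/key//|/ltW/key] := leP t s.
by rewrite distrC (distrC t).
Qed.

(* Along the flow F has derivative -eps P.F_p, so that act' = P.F_p and
   act' + eps act = P.F_p - F: calibration of v along (X, P) means v (X s) = act s. *)
Definition act (s : R) : R := - F (X s) (P s) / eps.

Lemma act_derive s : box B (P s) ->
  is_derive s 1 act (dot (P s) (Hp F (X s) (P s))).
Proof.
move=> Ps; have [VX [VP [dX dP _ /(_ Ps)[VXE VPE]]]] := XP s.
have -> : act = (- eps^-1) *: (fun t => F (X t) (P t)).
  by apply/funext => t; rewrite /act mulNr mulrC -mulNr.
have d := chain_rule FC1 dX dP.
apply: is_derive_eq; rewrite /GRing.scale /= VXE VPE !dotE.
rewrite (dotC (Hp F _ _) (Hx F _ _)) (dotC (Hp F _ _) (P s)).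
by field; rewrite gt_eqF.
Qed.

Lemma act_continuous : continuous act.
Proof.
move=> s; have [VX [VP [dX dP _ _]]] := XP s.
have -> : act = (- eps^-1) *: (fun t => F (X t) (P t)).
  by apply/funext => t; rewrite /act mulNr mulrC -mulNr.
have d := chain_rule FC1 dX dP.
exact: (is_derive_continuous (@is_deriveZ _ _ _ _ (- eps^-1) s 1 _ d)).
Qed.

Section Subsolution.
Variables (xi dxi : R -> vec) (be dbe : R -> R) (s0 s1 : R).
Hypothesis s01 : s0 <= s1.
Hypothesis Pbox : forall s, s0 <= s <= s1 -> box B (P s).
Hypothesis xi_der : forall s, vder xi s (dxi s).
Hypothesis be_der : forall s : R, is_derive s 1 be (dbe s).
Hypothesis be_ge : forall s, s0 <= s <= s1 ->
  2 * C * sq (xi s) + sq (dxi s) / (2 * al) <= dbe s + eps * be s.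

Definition gap (b : R -> R) s := v (X s + xi s) - dot (P s) (xi s) - act s - b s.

(** A barrier of finite steepness [K] replaces the evaluation at [X s + xi s], at the price of [e]
    at the initial time; [barrier_arith] forbids a larger excess later. [be_ge] is exactly the cost
    of the displacement in that computation. *)
Lemma gap_forward g : 0 <= g -> gap be s0 <= g -> gap be s1 <= g.
Proof.
move=> g0 gap0; apply/ler_addgt0Pr => e e0.
have e20 : 0 < e / 2 by rewrite divr_gt0.
have [N0 N00 pk] := peak (X s0 + xi s0) e20.
(* [2 * N0] lets half of the penalty serve in [peak]; [sq (P s0) / e] absorbs the slope at the
   initial time, up to [e / 2]; the last two terms give [C <= al * K ^+ 2]. *)
pose K := 2 * N0 + sq (P s0) / e + C / al + 1.
have sP := sq_ge0 (P s0).
have KP : 0 <= sq (P s0) / e by rewrite divr_ge0// ltW.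
have CA : 0 <= C / al by rewrite divr_ge0// ltW.
have K1 : 1 <= K by rewrite /K; lra.
have K0 : 0 < K by lra.
have KC : C <= al * K ^+ 2.
  have h : C / al <= K by rewrite /K; lra.
  rewrite ler_pdivrMr// mulrC in h; apply: le_trans h _.
  by rewrite ler_wpM2l ?(ltW al0)// expr2 ler_peMr// ltW.
pose S s y := act s + be s + dot (P s) (y - X s) + K * sq (y - (X s + xi s)).
have bec : continuous be by move=> s; exact: is_derive_continuous (be_der s).
have xic : continuous xi by move=> s; exact: vder_continuous (xi_der s).
have [s [y [ss yP]]] := @barrier_max R n v V K s0 s1 (fun s => act s + be s) (cst K) P X
  (fun s => X s + xi s) s01 K0 vc vV
  (fun s => cvgD (act_continuous (x := s)) (bec s)) (@cst_continuous _ _ _)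
  sol_P_continuous sol_X_continuous
  (fun s => cvgD (sol_X_continuous (x := s)) (xic s)) (fun s _ => lexx K).
have {}yP s' y' : s0 <= s' <= s1 -> v y' - S s' y' <= v y - S s y by exact: yP.
rewrite leNgt; apply/negP => gap1.
have f1 : g + e < v y - S s y.
  have := yP s1 (X s1 + xi s1); rewrite s01 lexx => /(_ isT); apply: lt_le_trans.
  move: gap1; rewrite /gap /S subrr sq0 mulr0 [X s1 + _ - X s1]addrAC subrr add0r.
  by lra.
have init : v y - S s0 y <= g + e.
  rewrite /S; set w := X s0 + xi s0.
  have -> : y - X s0 = xi s0 + (y - w).
    by apply/rowP => i; rewrite /w !mxE; ring.
  rewrite dotDr; set eta := y - w.
  have := pk (K / 2) _ y; rewrite ler_pdivlMr//.
  have -> : N0 * 2 <= K by rewrite /K; lra.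
  move=> /(_ isT); rewrite -/w -/eta => pkK.
  have yo := @dot_young _ _ K (- eta) (P s0) K0.
  rewrite dotNl sqN dotC in yo.
  have PK : K^-1 * sq (P s0) <= e.
    rewrite mulrC ler_pdivrMr// mulrC -ler_pdivrMr//; rewrite /K; lra.
  move: gap0; rewrite /gap -/w; lra.
have s0s : s0 < s.
  rewrite lt_neqAle; case/andP: (ss) => -> _; rewrite andbT.
  by apply/eqP => s0s; move: f1; rewrite -s0s ltNge init.
set eta := y - (X s + xi s).
have touch z : v z <= v y + dot (P s + (2 * K) *: eta) (z - y) + K * sq (z - y).
  have := yP s z ss; rewrite /S -/eta.
  have -> : z - X s = (y - X s) + (z - y) by rewrite [RHS]addrC addrA subrK.
  have -> : z - (X s + xi s) = eta + (z - y) by rewrite /eta [RHS]addrC addrA subrK.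
  by move: (y - X s) (z - y) => A d; rewrite dotDr sqD dotDl dotZl; lra.
have ps := upper_grad touch.
have eq := Fsub touch.
have Ps := Pbox ss.
have pbox : box B (P s + (2 * K) *: eta).
  by apply/box_sub/small_box/(le_trans ps); have := r0_ge0; lra.
have [VX [VP [dX dP _ /(_ Ps)[VXE VPE]]]] := XP s.
have yE : y = X s + (xi s + eta) by rewrite /eta addrA addrC subrK.
have /andP[T _] := taylor (X s) (xi s + eta) Ps pbox.
rewrite -yE sqZ (dotDr _ (xi s) eta) dotZr in T.
have dS : is_derive s 1 (fun t => S t y)
   (dot (P s) (Hp F (X s) (P s)) + dbe s
     + (dot VP (y - X s) - dot (P s) VX) + K * (- (2 * dot eta (VX + dxi s)))).
  have d1 := act_derive Ps; have d2 := be_der s.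
  have d3 : is_derive s 1 (fun t => dot (P t) (y - X t)) (dot VP (y - X s) - dot (P s) VX).
    have := vder_dot dP (vderB (vder_cst y s) dX).
    by rewrite sub0r dotNr.
  have d4 : is_derive s 1 (fun t => sq (y - (X t + xi t))) (- (2 * dot eta (VX + dxi s))).
    have := vder_sq (vderB (vder_cst y s) (vderD dX (xi_der s))).
    by rewrite sub0r dotNr mulrN.
  apply: (@is_deriveD _ _ _ (fun t => act t + be t + dot (P t) (y - X t))
     (K *: (fun t => sq (y - (X t + xi t))))).
(* The maximum may sit at [s1], so only differences to the left are available; [s0 < s] provides
   them. *)
have nS : 0 <= - (dot (P s) (Hp F (X s) (P s)) + dbe s
     + (dot VP (y - X s) - dot (P s) VX) + K * (- (2 * dot eta (VX + dxi s)))).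
  apply: (@derive_left_ge0 _ (fun t => - S t y) s _ (s - s0)); rewrite ?subr_gt0//.
  move=> h /andP[h0 hs]; have := yP (s - h) y.
  have -> : s0 <= s - h <= s1.
    case/andP: ss => _ ss1; apply/andP; split; first by rewrite lerBrDl -lerBrDr.
    by apply: le_trans ss1; rewrite gerBl ltW.
  by move=> /(_ isT); rewrite lerD2l.
have yX : y - X s = xi s + eta by rewrite yE addrC addKr.
have e1 : dot VP (y - X s) = - dot (Hx F (X s) (P s)) (xi s) - eps * dot (P s) (xi s)
    + (- dot (Hx F (X s) (P s)) eta - eps * dot (P s) eta).
  by rewrite VPE yX dotDr !dotDl !dotNl !dotZl.
have e2 : dot eta (VX + dxi s) = dot (Hp F (X s) (P s)) eta + dot eta (dxi s).
  by rewrite VXE dotDr (dotC eta).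
rewrite e1 e2 VXE in nS.
rewrite /S yX dotDr -/eta in f1.
have yo := @dot_young _ _ (2 * al) (K *: eta) (dxi s) (mulr_gt0 (ltr0n _ 2) al0).
rewrite dotZl sqZ in yo.
have bg := be_ge ss; rewrite [sq (dxi s) / _]mulrC in bg.
apply: (barrier_arith eps0 (ltW K0) (sq_ge0 eta) C0 KC _ T nS yo bg (sqDle _ _) _ f1 eq).
  by rewrite addr_ge0// ltW.
by rewrite /act; field; rewrite gt_eqF.
Qed.

End Subsolution.

(** A deficit [d] at [s0] is continued by the solution of [w' = - eps * w], which leaves
    [dbe + eps * be] unchanged; forward comparison with [be - w] carries a strict deficit to
    [s1]. *)
Lemma gap_backward (xi dxi : R -> vec) (be dbe : R -> R) (s0 s1 : R) :
  s0 <= s1 -> (forall s, s0 <= s <= s1 -> box B (P s)) ->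
  (forall s, vder xi s (dxi s)) -> (forall s : R, is_derive s 1 be (dbe s)) ->
  (forall s, s0 <= s <= s1 ->
    2 * C * sq (xi s) + sq (dxi s) / (2 * al) <= dbe s + eps * be s) ->
  0 <= gap xi be s1 -> 0 <= gap xi be s0.
Proof.
move=> s01 Pbox dxiP dbeP beP gap1; rewrite leNgt; apply/negP => gap0.
pose d := - gap xi be s0.
pose w (s : R) := d * expR (- eps * s) * expR (eps * s0).
have ws0 : w s0 = d by rewrite /w (mulNr eps) expRN divfK// gt_eqF// expR_gt0.
have wder (s : R) : is_derive s 1 w (- eps * w s).
  have h := is_derive_expRM (- eps) s.
  rewrite [X in is_derive s 1 X _](_ : w = (d * expR (eps * s0)) *: (fun s => expR (- eps * s))).
    by apply: is_derive_eq; rewrite /w /GRing.scale /=; ring.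
  by apply/funext => t; rewrite /w /= /GRing.scale /= mulrAC.
have := @gap_forward xi dxi (fun s => be s - w s) (fun s => dbe s - - eps * w s) s0 s1
  s01 Pbox dxiP (fun s => is_deriveB (dbeP s) (wder s)) _ 0 (lexx 0).
have E s : gap xi (fun s => be s - w s) s = gap xi be s + w s by rewrite /gap; ring.
rewrite !E ws0 /d subrr lexx => H.
have {}H : gap xi be s1 + w s1 <= 0.
  by apply: H => // s ss; have := beP s ss; lra.
have : 0 < w s1 by rewrite !mulr_gt0 ?expR_gt0// oppr_gt0.
by move: gap1 H; lra.
Qed.

(** Cost of steering linearly between the characteristic and a given point during a time [t]: the
    term in [C] is the loss along the way, [(al * t)^-1] the price of the velocity. *)
Definition prox_const (t : R) := 4 * C * t + (al * t)^-1.

Lemma vder_ramp (a b : R) (z : vec) s : vder (fun r => (a * r + b) *: z) s (a *: z).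
Proof.
apply: vder_scale.
have -> : (fun r => a * r + b) = (a *: id) + cst b :> (R -> R) by [].
by apply: is_derive_eq; rewrite /GRing.scale /= mulr1 addr0.
Qed.

Lemma is_derive_affine (a b s : R) : is_derive s 1 (fun r => a * r + b) a.
Proof.
have -> : (fun r => a * r + b) = (a *: id) + cst b :> (R -> R) by [].
by apply: is_derive_eq; rewrite /GRing.scale /= mulr1 addr0.
Qed.

(** The displacement shrinks linearly from [z - X s] to zero at [s + t], where the gap is
    nonnegative and can be carried backward. The allowance vanishes at [s + t] and is at most zero
    before; [eps * t <= 1 / 2] limits the effect of discounting to one half, whence the doubled
    constants in [D]. *)
Lemma calibrated_prox (s t : R) : 0 < t -> eps * t <= 1 / 2 ->
  (forall r, s <= r <= s + t -> box B (P r)) ->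
  v (X s) = act s -> act (s + t) <= v (X (s + t)) ->
  prox (prox_const t) (X s) (P s).
Proof.
move=> t0 et Pbox cals calt z; set ze := z - X s.
pose D := 4 * C + (al * t ^+ 2)^-1.
have D0 : 0 <= D by rewrite addr_ge0 ?mulr_ge0// invr_ge0 mulr_ge0 ?sqr_ge0// ltW.
pose ze' := (- t^-1) *: ze.
have q0 := sq_ge0 ze.
have := @gap_backward (fun r => (- t^-1 * r + t^-1 * (s + t)) *: ze) (fun=> (- t^-1) *: ze)
  (fun r => D * sq ze * r + - (D * sq ze * (s + t))) (fun=> D * sq ze) s (s + t).
have st : s <= s + t by rewrite lerDl ltW.
move=> /(_ st Pbox (fun r => vder_ramp _ _ _ r) (fun r => is_derive_affine _ _ r)).
have e1 : - t^-1 * (s + t) + t^-1 * (s + t) = 0 by ring.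
have e2 : - t^-1 * s + t^-1 * (s + t) = 1 by field; rewrite gt_eqF.
rewrite /gap e1 e2 scale0r scale1r addr0 dot0r subr0 subrr subr0.
have -> : X s + ze = z by rewrite /ze addrC subrK.
have -> : v z - dot (P s) ze - act s - (D * sq ze * s - D * sq ze * (s + t)) =
    v z - (v (X s) + dot (P s) ze - prox_const t * sq ze).
  by rewrite cals /prox_const /D; field; rewrite !gt_eqF.
rewrite !subr_ge0; apply; last by [].
move=> r /andP[rs rt].
rewrite !sqZ sqrrN.
pose th := - t^-1 * r + t^-1 * (s + t).
have th0 : 0 <= th.
  have -> : th = (s + t - r) / t by rewrite /th; field; rewrite gt_eqF.
  by rewrite divr_ge0 ?subr_ge0// ltW.
have th1 : th <= 1.
  have -> : th = (s + t - r) / t by rewrite /th; field; rewrite gt_eqF.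
  by rewrite ler_pdivrMr// mul1r; lra.
have th2 : th ^+ 2 <= 1 by rewrite expr_le1.
rewrite -/th.
have h1 : C * (th ^+ 2 * sq ze) <= C * (1 * sq ze) by rewrite ler_wpM2l// ler_wpM2r.
have h2 : t^-1 ^+ 2 * sq ze / (2 * al) = (al * t ^+ 2)^-1 * sq ze / 2.
  by field; rewrite !gt_eqF.
rewrite h2.
have h3 : eps * (s + t - r) * (D * sq ze) <= 1 / 2 * (D * sq ze).
  apply: ler_wpM2r; first exact: mulr_ge0.
  by apply: le_trans et; apply: ler_wpM2l; [exact: ltW|by rewrite lerBlDl lerD2r].
have h4 : D * sq ze = 4 * (C * sq ze) + (al * t ^+ 2)^-1 * sq ze by rewrite /D; ring.
move: ((al * t ^+ 2)^-1 * sq ze) (D * sq ze) h3 h4 => a b h3 h4.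
by lra.
Qed.

(** The mirror construction: the displacement opens from zero at [s]. The allowance is now
    nonnegative and discounting helps, so the undoubled constants suffice. *)
Lemma calibrated_upper (s t : R) : 0 < t ->
  (forall r, s <= r <= s + t -> box B (P r)) ->
  v (X s) <= act s -> v (X (s + t)) = act (s + t) ->
  forall z, v z <= v (X (s + t)) + dot (P (s + t)) (z - X (s + t))
    + prox_const t * sq (z - X (s + t)).
Proof.
move=> t0 Pbox cals calt z; set ze := z - X (s + t).
pose D := 2 * C + (2 * al * t ^+ 2)^-1.
have q0 := sq_ge0 ze.
have := @gap_forward (fun r => (t^-1 * r + - (t^-1 * s)) *: ze) (fun=> t^-1 *: ze)
  (fun r => D * sq ze * r + - (D * sq ze * s)) (fun=> D * sq ze) s (s + t).
have st : s <= s + t by rewrite lerDl ltW.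
move=> /(_ st Pbox (fun r => vder_ramp _ _ _ r) (fun r => is_derive_affine _ _ r)).
have e1 : t^-1 * s - t^-1 * s = 0 by ring.
have e2 : t^-1 * (s + t) - t^-1 * s = 1 by field; rewrite gt_eqF.
rewrite /gap e1 e2 scale0r scale1r addr0 dot0r subr0 subrr subr0.
have D0 : 0 <= D by rewrite addr_ge0 ?mulr_ge0// invr_ge0 !mulr_ge0 ?sqr_ge0// ltW.
have al1 : 0 <= (al * t)^-1 by rewrite invr_ge0 mulr_ge0 ?ltW.
have Ct : 0 <= C * t by rewrite mulr_ge0// ltW.
have -> : X (s + t) + ze = z by rewrite /ze addrC subrK.
move=> /(_ _ 0 (lexx 0)) H.
have {}H : v z - dot (P (s + t)) ze - act (s + t) - (D * sq ze * (s + t) - D * sq ze * s) <= 0.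
  apply: H; last by rewrite subr_le0.
  move=> r /andP[rs rt]; rewrite !sqZ.
  pose th := t^-1 * r + - (t^-1 * s).
  have th0 : 0 <= th.
    have -> : th = (r - s) / t by rewrite /th; field; rewrite gt_eqF.
    by rewrite divr_ge0 ?subr_ge0// ltW.
  have th1 : th <= 1.
    have -> : th = (r - s) / t by rewrite /th; field; rewrite gt_eqF.
    by rewrite ler_pdivrMr// mul1r; lra.
  have th2 : th ^+ 2 <= 1 by rewrite expr_le1.
  rewrite -/th.
  have h1 : C * (th ^+ 2 * sq ze) <= C * (1 * sq ze) by rewrite ler_wpM2l// ler_wpM2r.
  have h2 : t^-1 ^+ 2 * sq ze / (2 * al) = (2 * al * t ^+ 2)^-1 * sq ze.
    by field; rewrite !gt_eqF.
  have h3 : 0 <= eps * ((D * sq ze) * (r - s)).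
    by rewrite mulr_ge0 ?(ltW eps0)// !mulr_ge0// subr_ge0.
  rewrite h2.
  have h4 : D * sq ze = 2 * (C * sq ze) + (2 * al * t ^+ 2)^-1 * sq ze by rewrite /D; ring.
  move: ((2 * al * t ^+ 2)^-1 * sq ze) (D * sq ze) h3 h4 => a b h3 h4.
  by lra.
have h5 : D * sq ze * (s + t) - D * sq ze * s <= prox_const t * sq ze.
  have -> : D * sq ze * (s + t) - D * sq ze * s = (2 * (C * t) + (al * t)^-1 / 2) * sq ze.
    by rewrite /D; field; rewrite !gt_eqF.
  by rewrite ler_wpM2r// /prox_const -mulrA; lra.
by rewrite calt; lra.
Qed.

End Along.

(** One half is the supersolution test. For the other, forward comparison with zero displacement
    bounds [v] above along the characteristic and the paraboloid bounds it below. The two bounds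
    agree at time zero, so their difference has a nonnegative right derivative; the transport terms
    cancel in it and leave [- eps * b0]. *)
Lemma prox_eq K x p : prox K x p -> eps * v x + F x p = 0.
Proof.
move=> xp; apply/eqP; rewrite eq_le (Fsup xp) andbT.
have [X [P [XP X0 P0]]] := flow x p.
have pB := small_box (prox_grad xp).
pose b0 := v x - act X P 0.
pose w (s : R) := b0 * expR (- eps * s).
have wder (s : R) : is_derive s 1 w (- eps * w s).
  have h := is_derive_expRM (- eps) s.
  rewrite [X in is_derive s 1 X _](_ : w = b0 *: (fun s => expR (- eps * s)))//.
  by apply: is_derive_eq; rewrite /w /GRing.scale /=; ring.
have w0 : w 0 = b0 by rewrite /w mulr0 expR0 mulr1.
pose th s := act X P s + w s - (v x + dot p (X s - x)) + K * sq (X s - x).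
have Pbox s : 0 <= s <= speed^-1 -> box B (P s).
  move=> /andP[s0 s1]; apply: (box_stay XP (t := 0)); first by rewrite P0.
  by rewrite subr0 ger0_norm// -ler_pdivlMr// mul1r.
have sp0 : 0 < speed^-1 by rewrite invr_gt0.
have th_ge s : 0 < s <= speed^-1 -> 0 <= th s.
  move=> /andP[s0 s1].
  have H := @gap_forward X P XP (fun=> 0) (fun=> 0) w (fun s => - eps * w s) 0 s (ltW s0).
  have {}H : gap X P (fun=> 0) w s <= 0.
    apply: H => //.
    - by move=> r /andP[rge rs]; apply: Pbox; rewrite rge (le_trans rs).
    - by move=> r; exact: vder_cst.
    - by move=> r _; rewrite sq0 mul0r mulr0 addr0 mulNr addNr.
    - by rewrite /gap X0 P0 dot0r addr0 w0 /b0; lra.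
  have := xp (X s); move: H; rewrite /gap dot0r addr0 /th; lra.
have th0 : th 0 = 0 by rewrite /th X0 subrr dot0r sq0 w0 /b0; ring.
have P0B : box B (P 0) by rewrite P0; exact: box_sub.
have [VX [VP [dX dP _ /(_ P0B)[VXE VPE]]]] := XP 0.
have dth : is_derive (0 : R) 1 th (- eps * b0).
  have d1 := act_derive XP P0B.
  have d2 := wder 0.
  have d3 := vder_dot (vder_cst p 0) (vderB dX (vder_cst x 0)).
  have d4 := vder_sq (vderB dX (vder_cst x 0)).
  have d5 := is_derive_cst (v x) (0 : R) 1.
  have D := is_deriveD (is_deriveB (is_deriveD d1 d2) (is_deriveD d5 d3)) (is_deriveZ K d4).
  apply: (is_derive_eq D); rewrite X0 subrr !dot0l subr0 VXE X0 P0 w0 /GRing.scale /=.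
  by ring.
have := @derive_right_ge0 _ th 0 _ speed^-1 sp0 dth.
rewrite th0 => H.
have : 0 <= - eps * b0 by apply: H => h hs; rewrite add0r; exact: th_ge.
rewrite /b0 /act X0 P0.
have -> : - eps * (v x - - F x p / eps) = - (eps * v x + F x p) by field; rewrite gt_eqF.
by rewrite oppr_ge0.
Qed.

Lemma cal_act X P s : eps * v (X s) + F (X s) (P s) = 0 <-> v (X s) = act X P s.
Proof.
split=> [h|->]; last by rewrite /act; field; rewrite gt_eqF.
have -> : act X P s = v (X s) - (eps * v (X s) + F (X s) (P s)) / eps.
  by rewrite /act; field; rewrite gt_eqF.
by rewrite h mul0r subr0.
Qed.

Lemma prox_le K K' x p : K <= K' -> prox K x p -> prox K' x p.
Proof.
move=> KK' xp z; apply: le_trans (xp z).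
by rewrite lerB// ler_wpM2r// sq_ge0.
Qed.

Lemma small_time (a b c d : R) : 0 <= a -> 0 <= b -> 0 <= c -> 0 <= d ->
  exists2 sg, 0 < sg & [/\ a * sg <= 1, b * sg <= 1, c * sg <= 1 & d * sg <= 1].
Proof.
move=> a0 b0 c0 d0; have den : 0 < a + b + c + d + 1.
  by rewrite ltr_wpDl// !addr_ge0.
exists (a + b + c + d + 1)^-1; first by rewrite invr_gt0.
by split; rewrite ler_pdivrMr// mul1r; lra.
Qed.

(** * Short-time calibration behind a lower paraboloid *)

Section Local.
Variables (K D1 A sg : R).
Hypotheses (K1 : 1 <= K) (sg0 : 0 < sg).
Hypotheses (D1_ge : 4 * C + 2 * (eps * K) <= D1) (A_ge : C * (1 + 4 * (K + 1) ^+ 2) <= A).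
Hypotheses (eps_sg : 2 * eps * sg <= 1) (speed_sg : speed * sg <= 1).
Hypotheses (D1_sg : 4 * D1 * sg <= 1) (A_sg : 2 * A * sg <= 1).
Variables (X P : R -> vec) (tau : R).
Hypothesis XP : sol X P.
Hypothesis prox_tau : prox K (X tau) (P tau).

Lemma local_box s : tau - sg <= s <= tau -> box B (P s).
Proof.
move=> /andP[s1 s2]; apply: (box_stay XP (t := tau)).
  exact/small_box/(prox_grad prox_tau).
rewrite distrC ger0_norm ?subr_ge0// mulrC; apply: le_trans speed_sg.
by rewrite ler_wpM2l ?(ltW speed0)// lerBlDr -lerBlDl.
Qed.

Lemma local_cal_end : v (X tau) = act X P tau.
Proof. exact/cal_act/(prox_eq prox_tau). Qed.

(** The displacement is constant in time, so only the loss in [x] and the discount erode the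
    paraboloid, by [D1 * (tau - s) <= 1 / 4]. *)
Lemma local_lower s : tau - sg <= s <= tau ->
  forall z, act X P s + dot (P s) (z - X s) - (K + 1 / 4) * sq (z - X s) <= v z.
Proof.
move=> /andP[s1 s2] z; set ze := z - X s.
have q0 := sq_ge0 ze.
have D10 : 0 <= D1.
  by apply: le_trans D1_ge; rewrite addr_ge0 ?mulr_ge0 ?(ltW eps0) ?(le_trans ler01 K1).
have H := @gap_backward X P XP (fun=> ze) (fun=> 0)
  (fun r => D1 * sq ze * r + - ((K + D1 * tau) * sq ze)) (fun=> D1 * sq ze) s tau s2.
have {}H : 0 <= v (X s + ze) - dot (P s) ze - act X P s
   - (D1 * sq ze * s - (K + D1 * tau) * sq ze).
  apply: H.
  - by move=> r /andP[rs rt]; apply: local_box; rewrite rt andbT (le_trans s1).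
  - by move=> r; exact: vder_cst.
  - by move=> r; exact: is_derive_affine.
  - move=> r /andP[rs rt]; rewrite sq0 mul0r addr0.
    have tr0 : 0 <= tau - r by rewrite subr_ge0.
    have h1 : (2 * eps * (tau - r)) * (D1 * sq ze) <= 1 * (D1 * sq ze).
      apply: ler_wpM2r; first exact: mulr_ge0.
      apply: le_trans eps_sg; apply: ler_wpM2l; first by rewrite mulr_ge0// ltW.
      by rewrite lerBlDr -lerBlDl (le_trans s1).
    have h2 : (4 * C + 2 * (eps * K)) * sq ze <= D1 * sq ze by rewrite ler_wpM2r.
    lra.
  - have := prox_tau (X tau + ze); rewrite local_cal_end [X tau + ze - X tau]addrAC subrr add0r.
    by rewrite /gap; lra.
have h3 : 4 * (D1 * (tau - s)) * sq ze <= 1 * sq ze.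
  rewrite ler_wpM2r//; apply: le_trans D1_sg; rewrite mulrA ler_wpM2l ?mulr_ge0//.
  by rewrite lerBlDr -lerBlDl.
move: H; have -> : X s + ze = z by rewrite /ze addrC subrK.
lra.
Qed.

(** Suppose [v] exceeds the paraboloid by at least [m > 0] at time [s]. The time-dependent barrier
    meets [v] at [(tau, X tau)], so the least excess over it is attained after [s], which the
    supersolution property excludes. Together with the opening [K + 1 / 4] of [local_lower], the
    larger [K + 1 / 2] forces the point found to be [X s]. *)
Lemma local_touch s : tau - sg <= s <= tau ->
  exists y, v y <= act X P s + dot (P s) (y - X s) - (K + 1 / 2) * sq (y - X s).
Proof.
move=> ss; have /andP[s1 s2] := ss.
have Nvc : continuous (fun y => - v y) by move=> y; exact: (cvgN (@vc y)).
have NvV y : `|- v y| <= V by rewrite normrN.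
have K1' := K1; have K12 : 0 < K + 1 / 2 by lra.
have [s' [y [_ yP]]] := @barrier_max R n (fun y => - v y) V (K + 1 / 2) s s
  (cst (- act X P s)) (cst (K + 1 / 2)) (cst (- P s)) (cst (X s)) (cst (X s)) (lexx s)
  K12 Nvc NvV (@cst_continuous _ _ _) (@cst_continuous _ _ _)
  (@cst_continuous _ _ _) (@cst_continuous _ _ _) (@cst_continuous _ _ _)
  (fun _ _ => lexx _).
exists y; rewrite leNgt; apply/negP => pos.
set m := v y - (act X P s + dot (P s) (y - X s) - (K + 1 / 2) * sq (y - X s)).
have m0 : 0 < m by rewrite subr_gt0.
have {}yP z : m <= v z - (act X P s + dot (P s) (z - X s) - (K + 1 / 2) * sq (z - X s)).
  by have := yP s z; rewrite lexx /m /cst !dotNl => /(_ isT); lra.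
clearbody m; move: {pos} y yP => _ yP.
(* A tilt in time that uses at most half of [m] over the window and makes the supersolution
   contradiction strict. *)
pose de := m / (2 * sg).
have de0 : 0 < de by rewrite divr_gt0// mulr_gt0.
have desg : de * sg = m / 2 by rewrite /de; field; rewrite gt_eqF.
(* The opening is [K + 1] at [tau] and, by the bound on [A * sg], still at least [K + 1 / 2] at
   [s]. *)
pose k r := A * r + (K + 1 - A * tau).
pose ac r := act X P r + (- de * r + de * tau).
have acc : continuous (fun r => - ac r).
  move=> r; apply: (cvgN (cvgD (@act_continuous _ _ XP r) _)).
  exact: is_derive_continuous (is_derive_affine _ _ _).
have A0 : 0 <= A.
  by apply: le_trans A_ge; rewrite mulr_ge0// addr_ge0// mulr_ge0// sqr_ge0.
have krange r : s <= r <= tau -> K + 1 / 2 <= k r <= K + 1.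
  move=> /andP[sr rt]; rewrite /k.
  have : 0 <= A * (tau - r) by rewrite mulr_ge0// subr_ge0.
  have : 2 * (A * (tau - r)) <= 1.
    apply: le_trans A_sg; rewrite mulrA ler_wpM2l ?mulr_ge0//.
    by rewrite lerBlDr -lerBlDl (le_trans s1).
  by move=> h1 h2; apply/andP; split; lra.
have kc : continuous k by move=> r; exact: is_derive_continuous (is_derive_affine _ _ _).
have NPc : continuous (fun r => - P r).
  by move=> r; exact: (cvgN (@sol_P_continuous _ _ XP r)).
have [r [y [rs yr]]] := @barrier_max R n (fun y => - v y) V (K + 1 / 2) s tau
  (fun r => - ac r) k (fun r => - P r) X X s2 K12 Nvc NvV acc kc NPc
  (sol_X_continuous XP) (sol_X_continuous XP) (fun r rr => proj1 (andP (krange r rr))).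
pose S r y := ac r + dot (P r) (y - X r) - k r * sq (y - X r).
have {}yr r' y' : s <= r' <= tau -> v y - S r y <= v y' - S r' y'.
  by move=> /(yr _ y'); rewrite !dotNl /S; lra.
have f0 : v y - S r y <= 0.
  have := yr tau (X tau); rewrite s2 lexx => /(_ isT) /le_trans; apply.
  by rewrite /S /ac subrr dot0r sq0 local_cal_end; lra.
have sr : s < r.
  rewrite lt_neqAle; case/andP: (rs) => -> _; rewrite andbT.
  apply/eqP => sr; move: f0; rewrite -sr /S /ac => f0.
  have := yP y.
  have /andP[k1 _] := krange s (ltac:(by rewrite lexx s2)).
  have h1 : (K + 1 / 2) * sq (y - X s) <= k s * sq (y - X s) by rewrite ler_wpM2r// sq_ge0.
  have h2 : de * (tau - s) <= de * sg.
    by rewrite ler_wpM2l ?(ltW de0)// lerBlDr -lerBlDl.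
  lra.
set eta := y - X r in f0.
have touch z : v y + dot (P r + - (2 * k r) *: eta) (z - y) - k r * sq (z - y) <= v z.
  have := yr r z rs; rewrite /S -/eta.
  have -> : z - X r = eta + (z - y) by rewrite /eta [RHS]addrC addrA subrK.
  by move: eta (z - y) => E d; rewrite dotDr sqD dotDl dotZl; lra.
have /andP[k1 k2] := krange r rs.
have K0 : 0 <= k r by lra.
have Pr : box B (P r) by apply: local_box; case/andP: rs => r1 ->; rewrite (le_trans s1).
have pbox : box B (P r + - (2 * k r) *: eta).
  by apply/box_sub/small_box; exact: prox_grad touch.
have [VX [VP [dX dP _ /(_ Pr)[VXE VPE]]]] := XP r.
have yE : y = X r + eta by rewrite /eta addrC subrK.
have /andP[_ T] := taylor (X r) eta Pr pbox.
rewrite -yE sqZ dotZr in T.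
have dS : is_derive r 1 (fun t => S t y)
   (dot (P r) (Hp F (X r) (P r)) - de + (dot VP eta - dot (P r) VX)
     - (A * sq eta - 2 * k r * dot (Hp F (X r) (P r)) eta)).
  have d1 := act_derive XP Pr; have d2 := is_derive_affine (- de) (de * tau) r.
  have d3 := vder_dot dP (vderB (vder_cst y r) dX).
  have d4 := vder_sq (vderB (vder_cst y r) dX).
  have d5 := is_derive_affine A (K + 1 - A * tau) r.
  have D := is_deriveB (is_deriveD (is_deriveD d1 d2) d3) (is_deriveM d5 d4).
  apply: (is_derive_eq D).
  rewrite -/eta sub0r !dotNr VXE (dotC eta) /GRing.scale /= -/(k r); ring.
have nS := @derive_left_ge0 _ (fun t => S t y) r _ (r - s) _ dS.
rewrite subr_gt0 in nS.
have {}nS := nS sr _.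
have e1 : dot VP eta = - dot (Hx F (X r) (P r)) eta - eps * dot (P r) eta.
  by rewrite VPE !dotDl !dotNl !dotZl.
rewrite e1 VXE in nS.
apply: (@lower_barrier_arith _ eps C A (k r) (sq eta) _ _ _ _ _ _ (act X P r) (v y) de (tau - r)
  eps0 K0 (sq_ge0 eta) de0 _ _ T (nS _) _ _ (Fsup touch)).
- apply: le_trans A_ge; rewrite ler_wpM2l// lerD2l ler_wpM2l//.
  by rewrite lerXn2r ?nnegrE// (le_trans K0 k2).
- rewrite ler_pdivlMr// mulrC mulrA; apply: le_trans eps_sg; rewrite ler_wpM2l//.
    by rewrite mulr_ge0// ltW.
  by case/andP: rs => rs' _; rewrite lerBlDr -lerBlDl (le_trans s1).
- move=> h /andP[h0 hs]; have := yr (r - h) y.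
  have -> : s <= r - h <= tau.
    case/andP: rs => rs1 rs2; apply/andP; split.
      by rewrite lerBrDl -lerBrDr.
    by apply: le_trans rs2; rewrite gerBl ltW.
  by move=> /(_ isT); rewrite lerD2l lerN2.
- by rewrite /act; field; rewrite gt_eqF.
- by have -> : de * (tau - r) = - de * r + de * tau by ring.
Qed.

Lemma local_calibrated s : tau - sg <= s <= tau ->
  v (X s) = act X P s /\ prox (K + 1) (X s) (P s).
Proof.
move=> ss; have lo := local_lower ss; have [y yP] := local_touch ss.
have yX : y = X s.
  apply/eqP; rewrite -subr_eq0; apply/eqP/sq_eq0.
  by have := lo y; lra.
have cal : v (X s) = act X P s.
  apply/eqP; rewrite eq_le; apply/andP; split.
    by move: yP; rewrite yX subrr dot0r sq0; lra.
  by have := lo (X s); rewrite subrr dot0r sq0; lra.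
split=> // z; apply: le_trans (lo z); rewrite cal.
by have := sq_ge0 (z - X s); lra.
Qed.

End Local.

(** The length [sg] is chosen from [K] before the curve and the time; propagation rests on this
    order of quantifiers. *)
Lemma calibrated_short K : exists2 sg, 0 < sg &
  forall X P tau, sol X P -> prox K (X tau) (P tau) ->
  forall s, tau - sg <= s <= tau -> v (X s) = act X P s /\ sq (P s) <= 4 * r0.
Proof.
pose K' := Num.max 1 K.
have K'1 : 1 <= K' by rewrite le_max lexx.
pose D1 := 4 * C + 2 * (eps * K').
pose A := C * (1 + 4 * (K' + 1) ^+ 2).
have K'0 : 0 <= K' by exact: le_trans K'1.
have D10 : 0 <= 4 * D1 by rewrite mulr_ge0// addr_ge0// mulr_ge0// mulr_ge0// ltW.
have A0 : 0 <= 2 * A.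
  by rewrite mulr_ge0// mulr_ge0// addr_ge0// mulr_ge0// sqr_ge0.
have ep0 : 0 <= 2 * eps by rewrite mulr_ge0// ltW.
have [sg sg0 [h1 h2 h3 h4]] := small_time ep0 (ltW speed0) D10 A0.
exists sg => // X P tau XP pr s ss.
have pr' : prox K' (X tau) (P tau) by apply: prox_le pr; rewrite le_max lexx orbT.
have [cal pr2] := local_calibrated K'1 sg0 (lexx _) (lexx _) h1 h2 h3 h4 XP pr' ss.
by split=> //; exact: prox_grad pr2.
Qed.

(** Each local step raises the constant by one and shortens the next admissible step, so bare
    iteration could stall at a finite time. Once a piece of length [t0] is calibrated,
    [calibrated_prox] resets the constant at its left end to [prox_const t0], and all further steps
    have the same length [sg2]. *)
Theorem calibrated_past K X P : sol X P -> prox K (X 0) (P 0) ->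
  forall s, s <= 0 -> v (X s) = act X P s /\ sq (P s) <= 4 * r0.
Proof.
move=> XP pr0.
have [sg1 sg10 loc1] := calibrated_short K.
pose t0 := Num.min sg1 (2 * eps)^-1.
have t00 : 0 < t0 by rewrite lt_min sg10 invr_gt0 mulr_gt0.
have t0e : eps * t0 <= 1 / 2.
  have : t0 <= (2 * eps)^-1 by rewrite ge_min lexx orbT.
  rewrite -ler_pdivlMl//; have -> : eps^-1 * (1 / 2) = (2 * eps)^-1.
    by field; rewrite gt_eqF.
  by [].
have [sg2 sg20 loc2] := calibrated_short (prox_const t0).
have good k : forall s, - (t0 + k%:R * sg2) <= s <= 0 ->
    v (X s) = act X P s /\ sq (P s) <= 4 * r0.
  elim: k => [|k IHk] s /andP[s1 s2].
    apply: (loc1 X P 0 XP pr0); rewrite s2 andbT sub0r; apply: le_trans s1.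
    by rewrite mul0r addr0 lerN2 ge_min lexx.
  have [sk|sk] := leP (- (t0 + k%:R * sg2)) s; first by apply: IHk; rewrite sk.
  set tau := - (t0 + k%:R * sg2) in IHk sk.
  have k0 : 0 <= k%:R * sg2 by rewrite mulr_ge0// ltW.
  have range r : tau <= r <= tau + t0 -> tau <= r <= 0.
    move=> /andP[r1 r2]; rewrite r1 (le_trans r2)//.
    by rewrite /tau opprD addrAC addNr add0r oppr_le0.
  have cal r : tau <= r <= tau + t0 -> v (X r) = act X P r by move=> /range/IHk[].
  apply: (loc2 X P tau XP).
    apply: calibrated_prox => //.
    - by move=> r /range/IHk[_ Pr]; apply/box_sub/small_box.
    - by apply: cal; rewrite lexx lerDl ltW.
    - by rewrite cal// lexx lerDl ltW.
  rewrite (ltW sk) andbT; apply: le_trans s1.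
  have -> : t0 + k.+1%:R * sg2 = (t0 + k%:R * sg2) + sg2 by rewrite -natr1; ring.
  by rewrite (opprD (t0 + _)) lexx.
move=> s s0; apply: (good (Num.bound (- s / sg2))).
rewrite s0 andbT lerNl; apply: (@le_trans _ _ ((Num.bound (- s / sg2))%:R * sg2)).
  rewrite -ler_pdivrMr//; apply: ltW; apply: archi_boundP.
  by rewrite divr_ge0 ?oppr_ge0// ltW.
by rewrite lerDr ltW.
Qed.

(** A lower paraboloid at [s] is built from calibrated time after [s], an upper one from calibrated
    time before it; hence the strict [s < 0]. *)
Theorem calibrated_pinch X P : sol X P ->
  (forall s, s <= 0 -> v (X s) = act X P s /\ sq (P s) <= 4 * r0) ->
  forall s, s < 0 -> exists K, forall z,
    `|v z - v (X s) - dot (P s) (z - X s)| <= K * sq (z - X s).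
Proof.
move=> XP past s s0.
have pbox r : r <= 0 -> box B (P r) by move=> /past[_ Pr]; apply/box_sub/small_box.
pose t := Num.min (- s) (2 * eps)^-1.
have t00 : 0 < t by rewrite lt_min oppr_gt0 s0 invr_gt0 mulr_gt0.
have t0e : eps * t <= 1 / 2.
  have : t <= (2 * eps)^-1 by rewrite ge_min lexx orbT.
  rewrite -ler_pdivlMl//; have -> : eps^-1 * (1 / 2) = (2 * eps)^-1.
    by field; rewrite gt_eqF.
  by [].
have st : s + t <= 0 by rewrite -lerBrDl sub0r ge_min lexx.
have lo : prox (prox_const t) (X s) (P s).
  apply: calibrated_prox => //.
  - by move=> r /andP[_ rs]; apply: pbox; exact: le_trans rs st.
  - by have [] := past s (ltW s0).
  - by have [->] := past (s + t) st.
have up := @calibrated_upper X P XP (s - 1) 1 ltr01.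
rewrite subrK in up.
have {}up z := up _ _ _ z.
exists (Num.max (prox_const t) (prox_const 1)) => z.
have q0 := sq_ge0 (z - X s).
have m1 : prox_const t * sq (z - X s) <= Num.max (prox_const t) (prox_const 1) * sq (z - X s).
  by rewrite ler_wpM2r// le_max lexx.
have m2 : prox_const 1 * sq (z - X s) <= Num.max (prox_const t) (prox_const 1) * sq (z - X s).
  by rewrite ler_wpM2r// le_max lexx orbT.
have {}up : v z <= v (X s) + dot (P s) (z - X s) + prox_const 1 * sq (z - X s).
  apply: up.
  - by move=> r /andP[_ rs]; apply: pbox; exact: le_trans rs (ltW s0).
  - by have [|->] := past (s - 1); first by rewrite subr_le0 (le_trans (ltW s0)).
  - by have [] := past s (ltW s0).
by have := lo z; rewrite ler_norml => lo'; apply/andP; split; lra.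
Qed.

End Core.

(** * The clamped discounted flow *)

Section Clamp.
Context {R : realType} {n : nat}.
Notation vec := 'rV[R]_n.
Variable B : R.
Hypothesis B0 : 0 <= B.

Lemma coordB (u w : vec) i : (u - w) 0 i = u 0 i - w 0 i.
Proof. by rewrite !mxE. Qed.

(** Truncating each coordinate is 1-Lipschitz and the identity on the box, so it turns derivative
    bounds on the box into global ones. *)
Definition clamp (p : vec) : vec := \row_i Num.max (- B) (Num.min B (p 0 i)).

Lemma clamp_box p : box B (clamp p).
Proof.
move=> i; rewrite mxE ler_norml le_max lexx /= ge_max ge_min lexx /= andbT.
by rewrite ge0_cp.
Qed.

Lemma clamp_id p : box B p -> clamp p = p.
Proof.
move=> pB; apply/rowP => i; rewrite mxE; have := pB i; rewrite ler_norml => /andP[h1 h2].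
by rewrite (min_idPr h2) (max_idPr h1).
Qed.

Lemma clamp_lip p q i : `|clamp p 0 i - clamp q 0 i| <= `|p 0 i - q 0 i|.
Proof.
rewrite !mxE; move: (p 0 i) (q 0 i) => a b.
have N : - B <= B by move: B0; lra.
have key (x y : R) : x <= y ->
    `|Num.max (- B) (Num.min B x) - Num.max (- B) (Num.min B y)| <= y - x.
  move=> xy; rewrite ler_norml.
  by case: (leP B x) => ?; case: (leP B y) => ?;
     case: (leP (- B) x) => ?; case: (leP (- B) y) => ?;
     rewrite ?(max_idPr N); apply/andP; split; lra.
have [ab|/ltW ab] := leP a b.
  by rewrite [leRHS]distrC [leRHS]ger0_norm ?subr_ge0// key.
by rewrite distrC [leRHS]ger0_norm ?subr_ge0// key.
Qed.

End Clamp.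

Section Flow.
Context {R : realType} {n : nat}.
Notation vec := 'rV[R]_n.
Variables (F : vec -> vec -> R) (eps B : R).
Hypothesis Fper : periodicH F.
Hypothesis FC2 : C2_2 F.
Hypotheses (eps0 : 0 < eps) (B0 : 0 <= B).

Definition fieldX (x p : vec) : vec := Hp F x (clamp B p).
Definition fieldP (x p : vec) : vec := - Hx F x (clamp B p) - eps *: clamp B p.

Definition clamped_sol_at (X P : R -> vec) (s : R) :=
  vder X s (fieldX (X s) (P s)) /\ vder P s (fieldP (X s) (P s)).

Lemma fieldX_coord x p i : fieldX x p 0 i = dpart F (false, i) x (clamp B p).
Proof. by rewrite mxE. Qed.

Lemma fieldP_coord x p i :
  fieldP x p 0 i = - dpart F (true, i) x (clamp B p) - eps * clamp B p 0 i.
Proof. by rewrite !mxE. Qed.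

Lemma field_bounded : exists2 M, 0 < M & forall x p i, `|fieldP x p 0 i| <= M.
Proof.
have [M M0 MP] := dpart_bounded B0 Fper FC2.1.
exists (M + eps * B + 1); first by rewrite ltr_wpDl// addr_ge0// mulr_ge0// ltW.
move=> x p i; rewrite fieldP_coord; apply: le_trans (ler_normB _ _) _.
rewrite normrN normrM (gtr0_norm eps0).
have h1 := MP (true, i) x _ (clamp_box B0 p).
have h2 : eps * `|clamp B p 0 i| <= eps * B by rewrite ler_wpM2l ?(ltW eps0)// clamp_box.
lra.
Qed.

Lemma norm1_clamp (p q : vec) : norm1 (clamp B p - clamp B q) <= norm1 (p - q).
Proof.
by apply: ler_sum => i _; rewrite !coordB clamp_lip.
Qed.

Lemma field_lip : exists2 M, 0 <= M & forall x p x' p' i,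
  `|fieldX x p 0 i - fieldX x' p' 0 i| <= M * (norm1 (x - x') + norm1 (p - p')) /\
  `|fieldP x p 0 i - fieldP x' p' 0 i| <=
     M * (norm1 (x - x') + norm1 (p - p')) + eps * `|p 0 i - p' 0 i|.
Proof.
have [M M0 MP] := dpart_lipschitz Fper FC2 B0.
exists M => // x p x' p' i.
have key k : `|dpart F k x (clamp B p) - dpart F k x' (clamp B p')| <=
    M * (norm1 (x - x') + norm1 (p - p')).
  apply: le_trans (MP k _ _ _ _ (clamp_box B0 p) (clamp_box B0 p')) _.
  by rewrite ler_wpM2l// lerD2l norm1_clamp.
split; first by rewrite !fieldX_coord; exact: key.
rewrite !fieldP_coord; set a := dpart _ _ _ _; set b := dpart _ _ _ _.
have -> : - a - eps * clamp B p 0 i - (- b - eps * clamp B p' 0 i) =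
    - (a - b) - eps * (clamp B p 0 i - clamp B p' 0 i) by ring.
apply: le_trans (ler_normB _ _) _; rewrite normrN lerD//; first exact: key.
by rewrite normrM (gtr0_norm eps0) ler_wpM2l ?(ltW eps0)// clamp_lip.
Qed.

Lemma clamped_flow (x p : vec) : exists X P,
  [/\ forall s, clamped_sol_at X P s, X 0 = x & P 0 = p].
Proof.
have [M M0 MP] := field_lip.
pose cX (z : bool * 'I_n -> R) : vec := \row_i z (true, i).
pose cP (z : bool * 'I_n -> R) : vec := \row_i z (false, i).
pose f z (j : bool * 'I_n) : R :=
  if j.1 then fieldX (cX z) (cP z) 0 j.2 else fieldP (cX z) (cP z) 0 j.2.
pose L := M * (2 * n%:R) + eps.
have L0 : 0 < L by rewrite ltr_wpDl// mulr_ge0// mulr_ge0.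
have sum_e (u : vec) e : (forall i, `|u 0 i| <= e) -> norm1 u <= n%:R * e.
  move=> ue; apply: (@le_trans _ _ (\sum_(i < n) e)); first exact: ler_sum.
  by rewrite sumr_const card_ord mulr_natl.
have fL z w e : (forall j, `|z j - w j| <= e) -> forall j, `|f z j - f w j| <= L * e.
  move=> zw [b i].
  have e0 : 0 <= e by exact: le_trans (normr_ge0 _) (zw (b, i)).
  have h1 : norm1 (cX z - cX w) <= n%:R * e by apply: sum_e => k; rewrite coordB !mxE zw.
  have h2 : norm1 (cP z - cP w) <= n%:R * e by apply: sum_e => k; rewrite coordB !mxE zw.
  have h3 : M * (norm1 (cX z - cX w) + norm1 (cP z - cP w)) <= M * (2 * n%:R) * e.
    by rewrite -mulrA ler_wpM2l// -mulrA mulr_natl mulr2n lerD.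
  have h4 : 0 <= eps * e by rewrite mulr_ge0// ltW.
  have [k1 k2] := MP (cX z) (cP z) (cX w) (cP w) i.
  rewrite /f /L mulrDl; case: b => /=; first by lra.
  have h5 : eps * `|cP z 0 i - cP w 0 i| <= eps * e.
    by rewrite ler_wpM2l ?(ltW eps0)// !mxE zw.
  lra.
pose z0 (j : bool * 'I_n) : R := if j.1 then x 0 j.2 else p 0 j.2.
have [Z [Z0 dZ]] := picard z0 L0 fL.
exists (fun t => cX (Z t)), (fun t => cP (Z t)); split.
- move=> s; split=> i.
    have := dZ s (true, i); rewrite /f /=.
    by have -> : (fun t => cX (Z t) 0 i) = (fun t => Z t (true, i)) by apply/funext => t; rewrite mxE.
  have := dZ s (false, i); rewrite /f /=.
  by have -> : (fun t => cP (Z t) 0 i) = (fun t => Z t (false, i)) by apply/funext => t; rewrite mxE.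
- by apply/rowP => i; rewrite mxE Z0.
- by apply/rowP => i; rewrite mxE Z0.
Qed.

Lemma field_lip_sq : exists2 L, 0 <= L & forall x p x' p',
  sq (fieldX x p - fieldX x' p') + sq (fieldP x p - fieldP x' p') <=
  L * (sq (x - x') + sq (p - p')).
Proof.
have [M M0 MP] := field_lip.
pose N : R := n%:R.
have N0 : 0 <= N by [].
pose c := M ^+ 2 * (2 * N).
have c0 : 0 <= c by rewrite mulr_ge0 ?sqr_ge0// mulr_ge0.
exists (N * c + (N * (2 * c) + 2 * eps ^+ 2)).
  apply: addr_ge0; first exact: mulr_ge0.
  by apply: addr_ge0; apply: mulr_ge0 => //; [exact: mulr_ge0|exact: sqr_ge0].
move=> x p x' p'; set E := sq (x - x') + sq (p - p').
have E0 : 0 <= E by rewrite addr_ge0 ?sq_ge0.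
set m := norm1 (x - x') + norm1 (p - p').
have mE : M ^+ 2 * m ^+ 2 <= c * E.
  rewrite /c -mulrA ler_wpM2l ?sqr_ge0//.
  have h1 := sqr_norm1_le (x - x'); have h2 := sqr_norm1_le (p - p').
  have := sqr_ge0 (norm1 (x - x') - norm1 (p - p')).
  rewrite /m /E -/N in h1 h2 *; nra.
have m0 : 0 <= m by rewrite addr_ge0 ?norm1_ge0.
have sqM (a : R) : `|a| <= M * m -> a ^+ 2 <= c * E.
  move=> am; apply: le_trans mE; rewrite -exprMn -real_normK ?num_real//.
  by rewrite lerXn2r// nnegrE mulr_ge0.
have sum_c (u : vec) (b : R) : (forall i, u 0 i ^+ 2 <= b) -> sq u <= N * b.
  move=> ub; apply: (@le_trans _ _ (\sum_(i < n) b)).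
    by apply: ler_sum => i _; rewrite -expr2.
  by rewrite sumr_const card_ord mulr_natl.
rewrite mulrDl lerD//.
  rewrite -mulrA; apply: sum_c => i; rewrite (coordB (fieldX x p)).
  by apply: sqM; have [] := MP x p x' p' i.
apply: (@le_trans _ _ (\sum_(i < n) (2 * (c * E) + 2 * eps ^+ 2 * ((p - p') 0 i * (p - p') 0 i)))).
  apply: ler_sum => i _; rewrite -expr2 -real_normK ?num_real//.
  have [_ h] := MP x p x' p' i.
  rewrite (coordB (fieldP x p)) (coordB p p').
  set a := `|fieldP x p 0 i - fieldP x' p' 0 i|; set b := p 0 i - p' 0 i in h *.
  rewrite -/m -/a in h.
  have a0 : 0 <= a by exact: normr_ge0.
  have b0 := normr_ge0 b.
  have b2 : `|b| ^+ 2 = b * b by rewrite real_normK ?num_real// expr2.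
  have h2 : a ^+ 2 <= (M * m + eps * `|b|) ^+ 2.
    by rewrite lerXn2r// nnegrE addr_ge0// mulr_ge0// ltW.
  apply: le_trans h2 _.
  have := sqr_ge0 (M * m - eps * `|b|).
  have -> : 2 * eps ^+ 2 * (b * b) = 2 * (eps * `|b|) ^+ 2 by rewrite exprMn b2; ring.
  have -> : (M * m + eps * `|b|) ^+ 2 =
    2 * (M * m) ^+ 2 + 2 * (eps * `|b|) ^+ 2 - (M * m - eps * `|b|) ^+ 2 by ring.
  move: mE; rewrite -exprMn; lra.
rewrite big_split /= sumr_const card_ord -mulr_sumr -/(dot _ _) -/(sq _).
have -> : (2 * (c * E)) *+ n = N * (2 * c) * E by rewrite -mulr_natl /N; ring.
rewrite (mulrDl (N * (2 * c))) lerD2l ler_wpM2l//; first by rewrite mulr_ge0 ?sqr_ge0.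
by rewrite /E lerDr sq_ge0.
Qed.

(** The distance multiplied by [expR (a * r)] is nondecreasing, by expanding [sq (u + f) >= 0].
    Asking for solutions on [[s, 0]] makes the estimate serve twice: for continuous dependence, and
    to identify an arbitrary local solution with a clamped one. *)
Lemma gronwall_past : exists2 L, 0 <= L & forall X P X' P' s, s <= 0 ->
  (forall r, s <= r <= 0 -> clamped_sol_at X P r) ->
  (forall r, s <= r <= 0 -> clamped_sol_at X' P' r) ->
  sq (X s - X' s) + sq (P s - P' s) <=
    expR (- (L * s)) * (sq (X 0 - X' 0) + sq (P 0 - P' 0)).
Proof.
have [L L0 LP] := field_lip_sq.
exists (1 + L); first by rewrite addr_ge0.
move=> X P X' P' s s0 sol1 sol2.
pose E r := sq (X r - X' r) + sq (P r - P' r).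
pose dE r := 2 * dot (X r - X' r) (fieldX (X r) (P r) - fieldX (X' r) (P' r))
  + 2 * dot (P r - P' r) (fieldP (X r) (P r) - fieldP (X' r) (P' r)).
have EP r : s <= r <= 0 -> is_derive r 1 E (dE r).
  move=> rs; have [d1 d2] := sol1 r rs; have [d3 d4] := sol2 r rs.
  exact: is_deriveD (vder_sq (vderB d1 d3)) (vder_sq (vderB d2 d4)).
pose a := 1 + L.
have := @derive_ge0_le _ ((fun r => expR (a * r)) * E)
  (fun r => expR (a * r) *: dE r + E r *: (a * expR (a * r))) s 0 s0.
move=> H.
have : expR (a * s) * E s <= expR (a * 0) * E 0.
  apply: H.
    by move=> r rs; apply: is_deriveM; [exact: is_derive_expRM|exact: EP].
  move=> r rs; rewrite /GRing.scale /=.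
  have -> : expR (a * r) * dE r + E r * (a * expR (a * r)) = expR (a * r) * (dE r + a * E r).
    by ring.
  rewrite mulr_ge0 ?expR_ge0//.
  have := LP (X r) (P r) (X' r) (P' r).
  rewrite /dE /E /a; move: (X r - X' r) (P r - P' r) (fieldX _ _ - _) (fieldP _ _ - _).
  move=> u w fu fw h; have := sq_ge0 (u + fu); have := sq_ge0 (w + fw).
  by rewrite !sqD; move: h; rewrite mulrDl mul1r; lra.
rewrite mulr0 expR0 mul1r mulrC -ler_pdivlMr ?expR_gt0// -expRN mulrC.
by rewrite /E -/a.
Qed.

End Flow.

(** * Backward invariance of the graph *)

Section Differentiable.
Context {R : realType} {n : nat}.
Notation vec := 'rV[R]_n.

Lemma diff_grad (u : vec -> R) (x h : vec) : differentiable u x ->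
  'd u x h = dot (grad u x) h.
Proof.
move=> ux; rewrite [X in 'd u x X]row_sum_delta linear_sum.
apply: eq_bigr => i _; rewrite linearZ /= mxE deriveE//.
by rewrite /GRing.scale /= mulrC.
Qed.

Lemma differentiable_lower (u : vec -> R) (x : vec) e : differentiable u x -> 0 < e ->
  exists2 r, 0 < r & forall y, `|y - x| <= r ->
    u x + dot (grad u x) (y - x) - e * `|y - x| <= u y.
Proof.
move=> ux e0; have /diff_locallyP[_ /eqaddoP/(_ _ e0)] := ux.
move=> /nbhs_ballP[r /= r0 rP]; exists (r / 2); first by rewrite divr_gt0.
move=> y yr; have := rP (y - x); rewrite -ball_normE /ball_ /= sub0r normrN.
move=> /(_ _); rewrite /= !fctE /= subrK diff_grad// => H.
have {}H : `|u y - (u x + dot (grad u x) (y - x))| <= e * `|y - x|.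
  by apply: H; apply: le_lt_trans yr _; rewrite ltr_pdivrMr// mulr_natr mulr2n ltrDl.
by move: H; rewrite ler_norml => /andP[]; lra.
Qed.

(** The affine function of slope [p] lends its differential, already linear and continuous;
    uniqueness of the differential transfers it to [u]. *)
Lemma quad_pinch_differentiable (u : vec -> R) (x p : vec) K :
  (forall y, `|u y - u x - dot p (y - x)| <= K * sq (y - x)) -> differentiable u x.
Proof.
move=> uP; pose q := quad 0 p x 0.
have qE y : q y = dot p (y - x) by rewrite /q /quad mul0r add0r addr0.
have dq : differentiable q x by exact: quad_differentiable.
have dqE : 'd q x = (fun h => dot p h) :> (vec -> R).
  by apply/funext => h; rewrite diff_grad// quad_grad subrr scaler0 addr0.
apply/diff_locallyP.
suff L : u \o shift x = cst (u x) + 'd q x +o_ (0 : vec) (id : vec -> vec).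
  have dc : continuous ('d q x) by apply: diff_continuous.
  have -> : 'd u x = 'd q x :> (vec -> R) by exact: diff_unique.
  by [].
apply/eqaddoP => e e0.
pose M := `|K| * n%:R + 1.
have M0 : 0 < M by rewrite ltr_wpDl// mulr_ge0.
apply/nbhs_ballP; exists (e / M); first exact: divr_gt0.
move=> h; rewrite -ball_normE /= sub0r normrN => /ltW hM.
rewrite /= !fctE /= dqE; have := uP (h + x); rewrite addrK opprD addrA => /le_trans; apply.
apply: (@le_trans _ _ (`|K| * sq h)); first by rewrite ler_wpM2r ?sq_ge0// ler_norm.
apply: (@le_trans _ _ (`|K| * (n%:R * `|h| ^+ 2))); first by rewrite ler_wpM2l// sq_le_norm.
rewrite mulrA expr2 mulrA ler_wpM2r//.
rewrite ler_pdivlMr// mulrC in hM; apply: le_trans hM.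
by rewrite ler_wpM2r// lerDl.
Qed.

End Differentiable.

Section Graph.
Context {R : realType} {n : nat}.
Notation vec := 'rV[R]_n.
Variables (F : vec -> vec -> R) (v : vec -> R) (eps V r0 B : R).
Hypotheses (Fper : periodicH F) (FC2 : C2_2 F) (Fpos : Hpp_posdef F).
Hypotheses (eps0 : 0 < eps) (vc : continuous v) (vV : forall y, `|v y| <= V).
Hypothesis Fsub : forall y p K,
  (forall z, v z <= v y + dot p (z - y) + K * sq (z - y)) -> eps * v y + F y p <= 0.
Hypothesis Fsup : forall y p K,
  (forall z, v y + dot p (z - y) - K * sq (z - y) <= v z) -> 0 <= eps * v y + F y p.
Hypothesis coercive : forall y p, F y p <= eps * V -> sq p <= r0.
Hypotheses (B1 : 1 <= B) (r0B : 4 * r0 <= (B - 1) ^+ 2).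

Let B0 : 0 <= B. Proof. exact: le_trans ler01 B1. Qed.
Let FC1 : C1_2 F := FC2.1.

Lemma clamped_sol_sol speed X P : (forall x p i, `|fieldP F eps B x p 0 i| <= speed) ->
  (forall s, clamped_sol_at F eps B X P s) -> sol F eps B speed X P.
Proof.
move=> sp XP s; have [dX dP] := XP s.
exists (fieldX F B (X s) (P s)), (fieldP F eps B (X s) (P s)); split => // Ps.
by rewrite /fieldX /fieldP clamp_id.
Qed.

Lemma clamped_past K X P : (forall s, clamped_sol_at F eps B X P s) ->
  prox v K (X 0) (P 0) ->
  forall s, s <= 0 -> eps * v (X s) + F (X s) (P s) = 0 /\ sq (P s) <= 4 * r0.
Proof.
move=> XP pr s s0.
have [al [C [al0 C0 T]]] := taylor_bounds Fper FC2 Fpos B0.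
have [speed sp0 spP] := field_bounded Fper FC2 eps0 B0.
have flow x p : exists X P, [/\ sol F eps B speed X P, X 0 = x & P 0 = p].
  have [X' [P' [XP' X0 P0]]] := clamped_flow Fper FC2 eps0 B0 x p.
  by exists X', P'; split => //; exact: clamped_sol_sol.
have [cal sP] := calibrated_past eps0 vc vV Fsub Fsup coercive B1 r0B al0 C0 sp0 FC1 T
  flow (clamped_sol_sol spP XP) pr s0.
by split=> //; apply/(cal_act F v eps0).
Qed.

Lemma clamped_pinch X P : (forall s, clamped_sol_at F eps B X P s) ->
  (forall s, s <= 0 -> eps * v (X s) + F (X s) (P s) = 0 /\ sq (P s) <= 4 * r0) ->
  forall s, s < 0 -> differentiable v (X s) /\ P s = grad v (X s).
Proof.
move=> XP past s s0.
have [al [C [al0 C0 T]]] := taylor_bounds Fper FC2 Fpos B0.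
have [speed sp0 spP] := field_bounded Fper FC2 eps0 B0.
have [K KP] := calibrated_pinch eps0 vc vV Fsub coercive B1 r0B al0 C0 FC1 T
  (clamped_sol_sol spP XP)
  (fun r r0' => conj ((cal_act F v eps0 X P r).1 (past r r0').1) (past r r0').2) s0.
split; first exact: quad_pinch_differentiable KP.
by rewrite (quad_pinch_grad KP).
Qed.

(** Minimise [v y - dot p (y - x) + N * sq (y - x)]. For large [N] the minimiser lies where
    differentiability controls [v] up to [e], and comparison with [x] gives
    [N ^+ 2 * sq (y - x) <= e ^+ 2]: the touching slope is within [2 * e] of [p]. *)
Lemma prox_approx (x : vec) d : differentiable v x -> 0 < d ->
  exists x' p' K, prox v K x' p' /\ sq (x' - x) + sq (p' - grad v x) <= d.
Proof.
move=> vx d0; set p := grad v x.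
(* The total error is at most [5 * e ^+ 2], hence at most [5 * e] as [e <= 1]. *)
pose e := Num.min 1 (d / 8).
have e0 : 0 < e by rewrite lt_min ltr01 divr_gt0.
have e1 : e <= 1 by rewrite ge_min lexx.
have ed : e <= d / 8 by rewrite ge_min lexx orbT.
have [r r_gt0 rP] := differentiable_lower vx e0.
have V0 : 0 <= V by exact: le_trans (normr_ge0 _) (vV 0).
have sp := sq_ge0 p.
(* Comparison with [x] and Young's inequality give [N * sq eta <= 4 * V + sq p], so this [N] forces
   [|eta| <= r]. *)
pose N := (4 * V + sq p) / r ^+ 2 + 1.
have r2 : 0 < r ^+ 2 by rewrite exprn_gt0.
have c0 : 0 <= 4 * V + sq p by rewrite addr_ge0// mulr_ge0.
have N1 : 1 <= N by rewrite lerDr divr_ge0// ltW.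
have N0 : 0 < N by lra.
have Nr : 4 * V + sq p <= N * r ^+ 2.
  have -> : N * r ^+ 2 = 4 * V + sq p + r ^+ 2.
    by rewrite /N; field; rewrite gt_eqF.
  by rewrite lerDl ltW.
have Nvc : continuous (fun y => - v y) by move=> y; exact: (cvgN (@vc y)).
have NvV y : `|- v y| <= V by rewrite normrN.
have [s' [y [_ yP]]] := @barrier_max R n (fun y => - v y) V N 0 0
  (cst 0) (cst N) (cst (- p)) (cst x) (cst x) (lexx 0)
  N0 Nvc NvV (@cst_continuous _ _ _) (@cst_continuous _ _ _)
  (@cst_continuous _ _ _) (@cst_continuous _ _ _) (@cst_continuous _ _ _)
  (fun _ _ => lexx _).
have {}yP z : v y - dot p (y - x) + N * sq (y - x) <= v z - dot p (z - x) + N * sq (z - x).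
  by have := yP 0 z; rewrite lexx /cst !dotNl => /(_ isT); lra.
set eta := y - x in yP.
exists y, (p + - (2 * N) *: eta), N; split.
  move=> z; have := yP z.
  have -> : z - x = eta + (z - y) by rewrite /eta [RHS]addrC addrA subrK.
  by move: (eta) (z - y) => E w; rewrite dotDr sqD dotDl dotZl; lra.
have s_eta := sq_ge0 eta.
have yx := yP x; rewrite subrr dot0r sq0 mulr0 in yx.
have small : `|eta| <= r.
  apply: norm_le_sq; first exact: ltW.
  have yo := @dot_young _ _ 1 eta p ltr01; rewrite invr1 !mul1r dotC in yo.
  have := vV x; have := vV y; rewrite !ler_norml => /andP[h1 _] /andP[_ h2].
  have h3 : sq eta <= N * sq eta by rewrite ler_peMl.
  rewrite -(ler_pM2l N0); apply: le_trans Nr.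
  by lra.
have := rP y small; rewrite -/eta -/p => low.
have Ne : N * sq eta <= e * `|eta| by lra.
have Ne2 : N ^+ 2 * sq eta <= e ^+ 2.
  have [->|eta0] := eqVneq eta 0; first by rewrite sq0 mulr0 sqr_ge0.
  have nn : `|eta| ^+ 2 <= sq eta.
    rewrite -[leRHS]sqr_sqrtr// lerXn2r ?nnegrE ?sqrtr_ge0//.
    by apply: norm_le_sq; rewrite ?sqrtr_ge0 ?sqr_sqrtr.
  have n0 : 0 < `|eta| by rewrite normr_gt0.
  have se0 : 0 < sq eta by apply: lt_le_trans nn; rewrite exprn_gt0.
  rewrite -(ler_pM2r se0); apply: (@le_trans _ _ (e ^+ 2 * `|eta| ^+ 2)); last first.
    by rewrite ler_wpM2l// sqr_ge0.
  have -> : N ^+ 2 * sq eta * sq eta = (N * sq eta) ^+ 2 by ring.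
  by rewrite -exprMn lerXn2r// nnegrE mulr_ge0// ltW.
have ee : e ^+ 2 <= d / 8 by apply: le_trans ed; rewrite expr2 ler_piMl// ltW.
have N2 : sq eta <= N ^+ 2 * sq eta by rewrite ler_peMl// expr_ge1// ltW.
have -> : p + - (2 * N) *: eta - p = - (2 * N) *: eta by rewrite addrC addKr.
rewrite sqZ; have -> : (- (2 * N)) ^+ 2 * sq eta = 4 * (N ^+ 2 * sq eta) by ring.
lra.
Qed.

Lemma F_continuous : continuous (fun z : vec * vec => F z.1 z.2).
Proof.
move=> z; apply/cvgrPdist_le => e e0; pose x := z.1; pose p := z.2.
have [r r_gt0 rP] := C1_2_expansion FC1 x p ltr01.
pose M := norm1 (Hx F x p) + norm1 (Hp F x p) + 2 * n%:R + 1.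
have M0 : 0 < M by rewrite ltr_wpDl// !addr_ge0 ?norm1_ge0// mulr_ge0.
pose d := Num.min r (e / M).
have d0 : 0 < d by rewrite lt_min r_gt0 divr_gt0.
have : nbhs z (ball z d) by exact: nbhsx_ballx.
apply: filterS => -[x' p'] [].
rewrite -!ball_normE /ball_ /= -/x -/p distrC (distrC p) => /ltW xd /ltW pd.
have dr : d <= r by rewrite ge_min lexx.
have dM : d * M <= e by rewrite -ler_pdivlMr// ge_min lexx orbT.
have := rP (x' - x) (p' - p) (le_trans xd dr) (le_trans pd dr).
rewrite ![_ + (_ - _)]addrC !subrK mul1r => main.
have dot_le (u w : vec) : `|w| <= d -> `|dot u w| <= norm1 u * d.
  move=> wd; rewrite /dot /norm1 mulr_suml; apply: le_trans (ler_norm_sum _ _ _) _.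
  apply: ler_sum => i _; rewrite normrM ler_wpM2l//.
  exact: le_trans (coord_le_norm _ _) wd.
have a1 := dot_le (Hx F x p) _ xd; have a2 := dot_le (Hp F x p) _ pd.
have b1 : norm1 (x' - x) <= n%:R * d.
  by apply: le_trans (norm1_le_norm _) _; rewrite ler_wpM2l.
have b2 : norm1 (p' - p) <= n%:R * d.
  by apply: le_trans (norm1_le_norm _) _; rewrite ler_wpM2l.
rewrite distrC; set D := F x' p' - F x p in main *.
set l := dot _ _ + dot _ _ in main.
have -> : D = (D - l) + l by rewrite subrK.
apply: le_trans (ler_normD _ _) _; apply: le_trans (lerD main (ler_normD _ _)) _.
apply: le_trans dM; rewrite /M.
move: (norm1 (Hx F x p)) (norm1 (Hp F x p)) (n%:R : R) a1 a2 b1 b2 => h1 h2 N a1 a2 b1 b2.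
nra.
Qed.

(** Both conclusions are closed conditions on [(X s, P s)]. They hold along curves issued from
    proximal points, which approximate the given curve at time [s] when they start close enough. *)
Lemma clamped_past_differentiable X P : (forall s, clamped_sol_at F eps B X P s) ->
  differentiable v (X 0) -> P 0 = grad v (X 0) ->
  forall s, s <= 0 -> eps * v (X s) + F (X s) (P s) = 0 /\ sq (P s) <= 4 * r0.
Proof.
move=> XP vX P0 s s0.
have [L L0 gron] := gronwall_past Fper FC2 eps0 B0.
have close d : 0 < d -> exists x' p', [/\ `|X s - x'| <= d, `|P s - p'| <= d,
    eps * v x' + F x' p' = 0 & sq p' <= 4 * r0].
  move=> d0; pose c := expR (- (L * s)).
  have c0 : 0 < c by exact: expR_gt0.
  have [x' [p' [K [pr xp]]]] := prox_approx vX (divr_gt0 (exprn_gt0 2 d0) c0).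
  have [X' [P' [XP' X'0 P'0]]] := clamped_flow Fper FC2 eps0 B0 x' p'.
  have pr' : prox v K (X' 0) (P' 0) by rewrite X'0 P'0.
  have [cal sP] := clamped_past XP' pr' s0.
  have G := gron X P X' P' s s0 (fun r _ => XP r) (fun r _ => XP' r).
  rewrite X'0 P'0 -(sqN (X 0 - x')) -(sqN (P 0 - p')) !opprB P0 -/c in G.
  have {}G : sq (X s - X' s) + sq (P s - P' s) <= d ^+ 2.
    apply: le_trans G _; apply: le_trans (ler_wpM2l (ltW c0) xp) _.
    by rewrite mulrC divfK// gt_eqF.
  have g1 := sq_ge0 (X s - X' s); have g2 := sq_ge0 (P s - P' s).
  by exists (X' s), (P' s); split => //; apply: norm_le_sq; rewrite ?(ltW d0)//; lra.
have closed (G : vec * vec -> R) (b : R) : continuous G ->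
    (forall x' p', eps * v x' + F x' p' = 0 -> sq p' <= 4 * r0 -> G (x', p') <= b) ->
    G (X s, P s) <= b.
  move=> Gc Gb; apply/ler_addgt0Pr => e e0.
  have /cvgrPdist_le/(_ _ e0)/nbhs_ballP[d /= d0 dP] := @Gc (X s, P s).
  have [x' [p' [xd pd cal sP]]] := close (d / 2) (divr_gt0 d0 (ltr0n _ 2)).
  have d2 : d / 2 < d by rewrite ltr_pdivrMr// mulr_natr mulr2n ltrDl.
  have := dP (x', p'); rewrite ler_norml => /(_ _)/andP[|_].
    by split; rewrite -ball_normE /ball_ /=; [exact: le_lt_trans xd d2|exact: le_lt_trans pd d2].
  by have := Gb _ _ cal sP; lra.
have gc : continuous (fun z : vec * vec => eps * v z.1 + F z.1 z.2).
  move=> z; apply: cvgD; last exact: F_continuous.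
  apply: cvgM; first exact: cvg_cst.
  by apply: (@cvg_comp _ _ _ fst v _ _ _ (@fst_continuous _ _ z)); exact: vc.
have sc : continuous (fun z : vec * vec => sq z.2).
  by move=> z; apply: dot_continuous; exact: snd_continuous.
split; last by apply: (closed (fun z => sq z.2)).
apply/eqP; rewrite eq_le; apply/andP; split.
  by apply: (closed (fun z => eps * v z.1 + F z.1 z.2)) => // x' p' ->.
rewrite -oppr_le0; apply: (closed (fun z => - (eps * v z.1 + F z.1 z.2))).
  by move=> z; exact: (cvgN (@gc z)).
by move=> x' p' /= ->; rewrite oppr0.
Qed.

(** Pinching covers [s < 0]; at [s = 0] the claim is the hypothesis. The conclusion in [box (B - 1)]
    is what later removes the clamp. *)
Lemma clamped_graph X P : (forall s, clamped_sol_at F eps B X P s) ->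
  differentiable v (X 0) -> P 0 = grad v (X 0) ->
  forall s, s <= 0 -> [/\ box (B - 1) (P s), differentiable v (X s) & P s = grad v (X s)].
Proof.
move=> XP vX P0 s s0.
have past := clamped_past_differentiable XP vX P0.
have Ps : box (B - 1) (P s) by apply: small_box B1 r0B _ _; have [] := past s s0.
have [s_lt0|s_ge0] := ltP s 0; first by have [] := clamped_pinch XP past s_lt0.
have s00 : s = 0 by apply/eqP; rewrite eq_le s0 s_ge0.
by rewrite s00 in Ps *; split.
Qed.

End Graph.

(** * Translation of the momentum by [c] *)

Section Shift.
Context {R : realType} {n : nat}.
Notation vec := 'rV[R]_n.
Variable c : vec.

Definition shiftp (H : vec -> vec -> R) (h : R) (x q : vec) : R := H x (c + q) - h.

Lemma shift_quotient (f g : R -> R) : (forall t, f t - f 0 = g t - g 0) ->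
  (derivable f 0 1 <-> derivable g 0 1) /\ derive1 f 0 = derive1 g 0.
Proof.
move=> fg.
have E : (fun h => h^-1 *: (f (h *: 1 + 0) - f 0)) = (fun h => h^-1 *: (g (h *: 1 + 0) - g 0)).
  by apply/funext => t; rewrite fg.
by rewrite /derivable !derive1E /derive E.
Qed.

Lemma pder_shiftp H h a b x q :
  (pder_ex (shiftp H h) a b x q <-> pder_ex H a b x (c + q)) /\
  pder (shiftp H h) a b x q = pder H a b x (c + q).
Proof.
apply: shift_quotient => t; rewrite /shiftp !addrA.
by rewrite !scale0r !addr0; ring.
Qed.

Lemma shiftp_C1 H h : C1_2 H -> C1_2 (shiftp H h).
Proof.
move=> HC b i; have [Hex Hc] := HC b i; split=> [x q|z].
  by apply/(pder_shiftp _ _ _ _ _ _).1.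
rewrite (_ : (fun z : vec * vec => _) =
  (fun z => pder H (cdir b i).1 (cdir b i).2 z.1 z.2) \o (fun z => (z.1, c + z.2))); last first.
  by apply/funext => y; rewrite /= (pder_shiftp _ _ _ _ _ _).2.
apply: (@continuous_comp _ _ _ (fun z : vec * vec => (z.1, c + z.2))); last exact: Hc.
have c1 : (fun y : vec * vec => y.1) y @[y --> z] --> z.1 by exact: fst_continuous.
have c2 : (fun y : vec * vec => c + y.2) y @[y --> z] --> c + z.2.
  by apply: cvgD; [exact: cvg_cst|exact: snd_continuous].
exact: (cvg_pair c1 c2).
Qed.

Lemma shiftp_C2 H h : C2_2 H -> C2_2 (shiftp H h).
Proof.
move=> [HC HC2]; split=> [|b i]; first exact: shiftp_C1.
rewrite (_ : pder _ _ _ = shiftp (pder H (cdir b i).1 (cdir b i).2) 0).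
  exact: shiftp_C1.
by apply/funext => x; apply/funext => q; rewrite (pder_shiftp _ _ _ _ _ _).2 /shiftp subr0.
Qed.

Lemma shiftp_Hx H h x q : Hx (shiftp H h) x q = Hx H x (c + q).
Proof. by apply/rowP => i; rewrite !mxE (pder_shiftp _ _ _ _ _ _).2. Qed.

Lemma shiftp_Hp H h x q : Hp (shiftp H h) x q = Hp H x (c + q).
Proof. by apply/rowP => i; rewrite !mxE (pder_shiftp _ _ _ _ _ _).2. Qed.

Lemma shiftp_posdef H h : Hpp_posdef H -> Hpp_posdef (shiftp H h).
Proof.
move=> Hpos x q xi xi0.
have -> : Hpp (shiftp H h) x q = Hpp H x (c + q); last exact: Hpos.
apply/matrixP => i j; rewrite [LHS]mxE [RHS]mxE.
rewrite (_ : pder (shiftp H h) 0 (evec j) = shiftp (pder H 0 (evec j)) 0).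
  by rewrite (pder_shiftp _ _ _ _ _ _).2.
by apply/funext => y; apply/funext => p; rewrite (pder_shiftp _ _ _ _ _ _).2 /shiftp subr0.
Qed.

End Shift.

(** Growth with slope one bounds [|c + q|] on a sublevel set; the factor [n] converts the maximum
    norm to [sq]. *)
Lemma superlinear_coercive (R : realType) (n : nat) (H : 'rV[R]_n -> 'rV[R]_n -> R)
    (c : 'rV[R]_n) (h M : R) : superlinear H ->
  exists r0, forall x q, shiftp c H h x q <= M -> sq q <= r0.
Proof.
move=> /(_ 1)[K KP]; pose m := Num.max (Num.max K 0) (M + h).
exists (n%:R * (m + `|c|) ^+ 2) => x q; rewrite /shiftp lerBlDr => HM.
have m0 : 0 <= m by rewrite !le_max lexx orbT.
have cq : `|c + q| <= m.
  rewrite leNgt; apply/negP => mc.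
  have cq0 : 0 < `|c + q| by exact: le_lt_trans mc.
  have : 1 <= H x (c + q) / `|c + q|.
    by apply: KP; apply: le_lt_trans mc; rewrite !le_max lexx.
  rewrite ler_pdivlMr// mul1r => /le_trans/(_ HM) /(lt_le_trans mc).
  by rewrite ltNge le_max lexx orbT.
apply: le_trans (sq_le_norm _) _; rewrite ler_wpM2l// lerXn2r ?nnegrE ?addr_ge0//.
have -> : q = (c + q) - c by rewrite addrC addKr.
by apply: le_trans (ler_normB _ _) _; rewrite lerD2r.
Qed.

Section Viscosity.
Context {R : realType} {n : nat}.
Notation vec := 'rV[R]_n.
Variables (G : vec -> R -> vec -> R) (v : vec -> R).

Lemma visc_sub_quad y p K : visc_sub G v ->
  (forall z, v z <= v y + dot p (z - y) + K * sq (z - y)) -> G y (v y) p <= 0.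
Proof.
move=> vs touch; have := vs (quad 0 p y K) y (quad_C1 _ _ _ _).
rewrite quad_grad subrr scaler0 addr0; apply; near=> z.
have := touch z; rewrite /quad subrr dot0r sq0; lra.
Unshelve. all: by end_near. Qed.

Lemma visc_super_quad y p K : visc_super G v ->
  (forall z, v y + dot p (z - y) - K * sq (z - y) <= v z) -> 0 <= G y (v y) p.
Proof.
move=> vs touch; have := vs (quad 0 p y (- K)) y (quad_C1 _ _ _ _).
rewrite quad_grad subrr scaler0 addr0; apply; near=> z.
have := touch z; rewrite /quad subrr dot0r sq0; lra.
Unshelve. all: by end_near. Qed.

End Viscosity.

(** Invariance is split into existence of the backward orbit and membership of every local solution.
    The orbit is continued to a small [d > 0] so that the two-sided derivative at time zero makes
    sense. *)
Theorem theorem3p3 (R : realType) (n : nat)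
  (H : 'rV[R]_n -> 'rV[R]_n -> R) (c : 'rV[R]_n) (h : R) :
  periodicH H -> C2_2 H -> Hpp_posdef H -> superlinear H ->
  (exists u, visc_sol_torus (crit_eq H c h) u) ->
  (forall h' : R, (exists u, visc_sol_torus (crit_eq H c h') u) -> h' = h) ->
  forall eps : R, 0 < eps ->
  forall v : 'rV[R]_n -> R, visc_sol_torus (disc_eq H c h eps) v ->
  forall x p : 'rV[R]_n, graph_c c v (x, p) ->
    (* the backward flow from (x,p) exists for all times s <= 0 ... *)
    (exists (X P : R -> 'rV[R]_n) (d : R), 0 < d /\ X 0 = x /\ P 0 = p /\
        forall t, t < d -> disc_flow_at H c eps X P t) /\
    (* ... and phi^s(x,p) lies in graph(c + v_x) for every s <= 0 *)
    (forall s : R, s <= 0 -> forall (X P : R -> 'rV[R]_n) (a b : R),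
        a < s -> 0 < b -> X 0 = x -> P 0 = p ->
        (forall t, a < t < b -> disc_flow_at H c eps X P t) ->
        graph_c c v (X s, P s)).
Proof.
move=> Hper HC2 Hpos Hsup _ _ eps eps0 v [vper [vc [vsub vsup]]] x p [x0 [vx [-> ->]]] {p}.
pose F := shiftp c H h.
have Fper : periodicH F by move=> y q k kZ; rewrite /F /shiftp Hper.
have FC2 : C2_2 F by exact: shiftp_C2.
have Fpos : Hpp_posdef F by exact: shiftp_posdef.
have [V V0 vV] : exists2 V, 0 <= V & forall y, `|v y| <= V.
  have [|V V0 VP] := @periodic_bounded R n (fun y _ => v y) 0 (lexx 0)
      (fun y _ k kZ => vper y k kZ).
    by move=> z; apply: (@cvg_comp _ _ _ fst v _ _ _ (@fst_continuous _ _ z)); exact: vc.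
  by exists V => // y; apply: (VP y 0); exact: box0.
have [r0 coer] := superlinear_coercive c h (eps * V) Hsup.
have Fsub y q K : (forall z, v z <= v y + dot q (z - y) + K * sq (z - y)) ->
    eps * v y + F y q <= 0.
  by move=> /(visc_sub_quad vsub); rewrite /disc_eq /F /shiftp addrA.
have Fsup y q K : (forall z, v y + dot q (z - y) - K * sq (z - y) <= v z) ->
    0 <= eps * v y + F y q.
  by move=> /(visc_super_quad vsup); rewrite /disc_eq /F /shiftp addrA.
have r00 : 0 <= r0 := r0_ge0 eps0 vc vV Fsub coer.
(* [(4 * r0 + 1) ^+ 2 >= 4 * r0] avoids a square root; the freedom in [B] is used for given
   solutions. *)
have large B : 4 * r0 + 2 <= B -> 1 <= B /\ 4 * r0 <= (B - 1) ^+ 2.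
  by move=> Bl; split; [lra|rewrite expr2; nra].
have flow_at B (X P : R -> 'rV[R]_n) t : box B (P t) ->
    disc_flow_at H c eps X (fun t => c + P t) t <-> clamped_sol_at F eps B X P t.
  move=> Pt; rewrite /disc_flow_at /clamped_sol_at /fieldX /fieldP clamp_id//.
  rewrite shiftp_Hp shiftp_Hx.
  have -> : - Hx H (X t) (c + P t) + eps *: c - eps *: (c + P t) =
      - Hx H (X t) (c + P t) - eps *: P t.
    by rewrite scalerDr opprD addrA addrK.
  have shiftc W : vder (fun t => c + P t) t W <-> vder P t W.
    split=> [PW|PW].
      have := vderB PW (vder_cst c t); rewrite subr0.
      by have -> : (fun t => c + P t - c) = P by apply/funext => r; rewrite addrC addKr.
    by have := vderD (vder_cst c t) PW; rewrite add0r.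
  split=> -[dX dP].
    by split; [exact/vderP|apply/shiftc/vderP].
  by split; [apply/vderP|apply/vderP; apply/shiftc].
split.
  pose B := 4 * r0 + 2.
  have [B1 r0B] := large B (lexx _).
  have B0 : 0 <= B by exact: le_trans ler01 B1.
  have [X [P [XP X0 P0]]] := clamped_flow Fper FC2 eps0 B0 x0 (grad v x0).
  have [speed sp0 spP] := field_bounded Fper FC2 eps0 B0.
  have inv s : s <= 0 -> [/\ box (B - 1) (P s), differentiable v (X s) & P s = grad v (X s)].
    by apply: (clamped_graph Fper FC2 Fpos eps0 vc vV Fsub Fsup coer B1 r0B XP); rewrite ?P0 X0.
  (* After time zero the curve is not known to lie on the graph, but it stays in the box up to
     [speed^-1], where the clamped field is the true one. *)
  exists X, (fun t => c + P t), speed^-1; split; first by rewrite invr_gt0.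
  split=> //; split; first by rewrite P0.
  move=> t td; apply/(flow_at B); last exact: XP.
  have [t0|t0] := leP t 0; first by have [Pt _ _] := inv t t0; exact: box_sub Pt.
  apply: (box_stay (clamped_sol_sol spP XP) (t := 0)).
    by have [] := inv 0 (lexx 0).
  by rewrite subr0 gtr0_norm// -ler_pdivlMr// mul1r ltW.
move=> s s0 X P a b as_ b0 X0 P0 XP.
pose Q t := P t - c.
have XQ t : s <= t <= 0 -> disc_flow_at H c eps X (fun t => c + Q t) t.
  move=> /andP[st t0]; have -> : (fun t => c + Q t) = P.
    by apply/funext => r; rewrite /Q addrC subrK.
  by apply: XP; rewrite (lt_le_trans as_ st) (le_lt_trans t0 b0).
(* A given solution has no slope bound a priori, but it is bounded on the compact interval;
   enlarging the box to contain it makes it a solution of the clamped system as well. *)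
have [M MP] : exists M, forall t, s <= t <= 0 -> `|sq (Q t)| <= M.
  apply: continuous_segment_bounded => // t st.
  have Pc : {for t, continuous Q}.
    have tab : a < t < b.
      by case/andP: st => h1 h2; rewrite (lt_le_trans as_ h1) (le_lt_trans h2 b0).
    have [_ dP'] := XP t tab; have /vderP d1 := dP'.
    exact: vder_continuous (vderB d1 (vder_cst c t)).
  exact: (dot_continuous Pc Pc).
pose B := Num.max (4 * r0 + 2) (M + 1).
have Bl : 4 * r0 + 2 <= B by rewrite le_max lexx.
have [B1 r0B] := large B Bl.
have B0 : 0 <= B by exact: le_trans ler01 B1.
have BM : M + 1 <= B by rewrite le_max lexx orbT.
have Qbox t : s <= t <= 0 -> box B (Q t).
  move=> /MP QM; apply: sq_box => //; apply: le_trans (ler_norm _) _.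
  by apply: le_trans QM _; rewrite expr2; nra.
have [X' [P' [XP' X'0 P'0]]] := clamped_flow Fper FC2 eps0 B0 x0 (grad v x0).
have [L L0 gron] := gronwall_past Fper FC2 eps0 B0.
have := gron X Q X' P' s s0 (fun r rs => (flow_at B X Q r (Qbox r rs)).1 (XQ r rs))
  (fun r _ => XP' r).
have Q0 : Q 0 = grad v x0 by rewrite /Q P0 addrC addKr.
rewrite X0 X'0 Q0 P'0 !subrr !sq0 addr0 mulr0 => le0.
have q1 := sq_ge0 (X s - X' s); have q2 := sq_ge0 (Q s - P' s).
have Xs : X s = X' s by apply/eqP; rewrite -subr_eq0; apply/eqP/sq_eq0; lra.
have Qs : Q s = P' s by apply/eqP; rewrite -subr_eq0; apply/eqP/sq_eq0; lra.
have [_ vXs P's] : [/\ box (B - 1) (P' s), differentiable v (X' s) & P' s = grad v (X' s)].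
  by apply: (clamped_graph Fper FC2 Fpos eps0 vc vV Fsub Fsup coer B1 r0B XP') s0; rewrite ?P'0 X'0.
exists (X s); rewrite Xs; split=> //; congr pair.
by rewrite -P's -Qs /Q addrC subrK.
Qed.
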